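(* Fix $d$. There exist constants $C_{gap}>0$, $C,c>0$ and $C_d>0$ (depending only on $d$) such that the following holds. Let $\boldsymbol{\mathcal Y}=\boldsymbol{\mathcal X}+\boldsymbol{\mathcal Z}$ with tensors in $\mathbb{R}^{p_1\times\cdots\times p_d}$, where $\boldsymbol{\mathcal X}$ is fixed and admits a tensor-train (TT) decomposition with ranks $(r_1,\dots,r_{d-1})$ and $\boldsymbol{\mathcal Z}$ has independent, mean-zero, $\sigma$-sub-Gaussian entries. Let $p=\min\{p_1,\dots,p_d\}$, and suppose $$\lambda_k:=s_{r_k}([\boldsymbol{\mathcal X}]_k)\ge C_{gap}\Bigl(\bigl(\textstyle\sum_{i=1}^dp_ir_{i-1}r_i\bigr)^{1/2}+(p_{k+1}\cdots p_d)^{1/2}\Bigr)\sigma,\qquad1\le k\le d-1.$$ Run TTOI on $\boldsymbol{\mathcal Y}$ with input ranks $(r_1,\dots,r_{d-1})$. Then, with probability at least $1-C\exp(-cp)$, $$\max_{k=1,\dots,d-1}\bigl\|\sin\Theta(\widehat U_k^{(0)},\widetilde U_k^{(0)})\bigr\|\le\tfrac12,$$ $$\max_{\substack{k=1,\dots,d-1\\t=2,4,6,\dots}}\bigl\|\sin\Theta(\widehat U_k^{(t)},\widetilde U_k^{(t)})\bigr\|\le\tfrac12,\qquad\max_{\substack{k=2,\dots,d\\t=1,3,5,\dots}}\bigl\|\sin\Theta(\widehat V_k^{(t)},\widetilde V_k^{(t)})\bigr\|\le\tfrac12,$$ and for all $t\ge1$ (and all $1\le k\le d-1$) $$\max\{A_k^{(t)},B^{(t)}\}\le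 C_d\,\sigma^2\sum_{i=1}^dp_ir_ir_{i-1}.$$
   Context: Throughout $d\ge2$, $p_1,\dots,p_d$ and $r_1,\dots,r_{d-1}$ are positive integers, $r_0=r_d=1$. A random variable $z$ is $\sigma$-sub-Gaussian if $\mathbb{E}e^{t(z-\mathbb{E}z)}\le e^{\sigma^2t^2/2}$ for all $t\in\mathbb{R}$. Matrices. $s_1(A)\ge s_2(A)\ge\cdots\ge0$ are the singular values of $A$; $\|A\|$ is the spectral norm, $\|A\|_{\mathrm F}$ the Frobenius norm (also used for tensors, entrywise). $\mathrm{SVD}^L_r(A)$ and $\mathrm{SVD}^R_r(A)$ are the matrices with orthonormal columns consisting of the leading $r$ left, respectively right, singular vectors of $A$ (any choice in case of ties). The ''left (right) singular space'' of a matrix, given with $r$ columns, means the matrix of its leading $r$ left (right) singular vectors. $U\otimes V$ is the usual Kronecker product, with blocks $U_{ij}V$. For $U,\widehat U\in\mathbb{R}^{p\times r}$ with orthonormal columns, $\|\sin\Theta(U,\widehat U)\|=\sqrt{1-s_r(U^\top\widehat U)^2}$. Tensors. The sequential unfolding $[\boldsymbol{\mathcal X}]_k\in\mathbb{R}^{(p_1\cdots p_k)\times(p_{k+1}\cdots p_d)}$ has entry $\boldsymbol{\mathcal X}_{i_1,\dots,i_d}$ at row $i_1+(i_2-1)p_1+\cdots+(i_k-1)p_1\cdots p_{k-1}$ and column $i_{k+1}+(i_{k+2}-1)p_{k+1}+\cdots+(i_d-1)p_{k+1}\cdots p_{d-1}$. $\mathrm{Reshape}$ of matrices is column-major: for $A\in\mathbb{R}^{q_1\times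 q_2q_3}$ and $\widetilde A\in\mathbb{R}^{q_1q_2\times q_3}$, $\widetilde A=\mathrm{Reshape}(A,q_1q_2,q_3)$ and $A=\mathrm{Reshape}(\widetilde A,q_1,q_2q_3)$ iff $\widetilde A_{(i_2-1)q_1+i_1,i_3}=A_{i_1,(i_3-1)q_2+i_2}$ for all indices. $\boldsymbol{\mathcal X}$ admits a TT decomposition with ranks $(r_1,\dots,r_{d-1})$ if there are $G_1\in\mathbb{R}^{p_1\times r_1}$, $\boldsymbol{\mathcal G}_k\in\mathbb{R}^{r_{k-1}\times p_k\times r_k}$ ($2\le k\le d-1$), $G_d\in\mathbb{R}^{p_d\times r_{d-1}}$ with $\boldsymbol{\mathcal X}_{i_1,\dots,i_d}=\sum_{\alpha_1=1}^{r_1}\cdots\sum_{\alpha_{d-1}=1}^{r_{d-1}}G_{1,[i_1,\alpha_1]}\boldsymbol{\mathcal G}_{2,[\alpha_1,i_2,\alpha_2]}\cdots\boldsymbol{\mathcal G}_{d-1,[\alpha_{d-2},i_{d-1},\alpha_{d-1}]}G_{d,[i_d,\alpha_{d-1}]}$. It is understood that $r_k\le r_{k-1}p_k$ and $r_{k-1}\le p_kr_k$ for all $k$, so that all matrices of singular vectors below exist. Sequential products. For $M_i\in\mathbb{R}^{(p_ir_{i-1})\times r_i}$ ($1\le i\le d-1$): $M_{\mathrm{prod},1}^{(L)}=M_1$, $M_{\mathrm{prod},k+1}^{(L)}=(I_{p_{k+1}}\otimes M_{\mathrm{prod},k}^{(L)})M_{k+1}$. For $B_j\in\mathbb{R}^{(p_jr_j)\times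 r_{j-1}}$ ($2\le j\le d$): $B_{\mathrm{prod},d}^{(R)}=B_d$, $B_{\mathrm{prod},k}^{(R)}=(B_{\mathrm{prod},k+1}^{(R)}\otimes I_{p_k})B_k$. TTOI (tensor-train orthogonal iteration) with input $\boldsymbol{\mathcal Y}\in\mathbb{R}^{p_1\times\cdots\times p_d}$ and ranks $r_1,\dots,r_{d-1}$ produces iterates $\widehat{\boldsymbol{\mathcal X}}^{(t)}$, $t=0,1,2,\dots$: Initialization ($t=0$): $R_1^{(0)}=[\boldsymbol{\mathcal Y}]_1$; for $k=1,\dots,d-1$, $\widehat U_k^{(0)}=\mathrm{SVD}^L_{r_k}(R_k^{(0)})$, $\widetilde R_k^{(0)}=\widehat U_k^{(0)\top}R_k^{(0)}$, and if $k<d-1$, $R_{k+1}^{(0)}=\mathrm{Reshape}(\widetilde R_k^{(0)},r_kp_{k+1},p_{k+2}\cdots p_d)$. Then $[\widehat{\boldsymbol{\mathcal X}}^{(0)}]_{d-1}=(\widehat U^{(0)})_{\mathrm{prod},d-1}^{(L)}\widetilde R_{d-1}^{(0)}$. Backward update ($t$ odd): $\widehat V_d^{(t)}=\mathrm{SVD}^R_{r_{d-1}}(\widetilde R_{d-1}^{(t-1)})$; for $k=d-1,\dots,2$, $\widehat V_k^{(t)}=\mathrm{SVD}^R_{r_{k-1}}\bigl(\widetilde R_{k-1}^{(t-1)}((\widehat V^{(t)})_{\mathrm{prod},k+1}^{(R)}\otimes I_{p_k})\bigr)$. Then $[\widehat{\boldsymbol{\mathcal X}}^{(t)}]_1=[\boldsymbol{\mathcal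 Y}]_1(\widehat V^{(t)})_{\mathrm{prod},2}^{(R)}(\widehat V^{(t)})_{\mathrm{prod},2}^{(R)\top}$. Forward update ($t\ge2$ even): $R_1^{(t)}=[\boldsymbol{\mathcal Y}]_1$; for $k=1,\dots,d-1$, $\widehat U_k^{(t)}=\mathrm{SVD}^L_{r_k}\bigl(R_k^{(t)}(\widehat V^{(t-1)})_{\mathrm{prod},k+1}^{(R)}\bigr)$, $\widetilde R_k^{(t)}=\widehat U_k^{(t)\top}R_k^{(t)}$, and if $k<d-1$, $R_{k+1}^{(t)}=\mathrm{Reshape}(\widetilde R_k^{(t)},r_kp_{k+1},p_{k+2}\cdots p_d)$. Then $[\widehat{\boldsymbol{\mathcal X}}^{(t)}]_{d-1}=(\widehat U^{(t)})_{\mathrm{prod},d-1}^{(L)}\widetilde R_{d-1}^{(t)}$. Quantities in the claim. For even $t\ge0$: $\widetilde U_1^{(t)}\in\mathbb{R}^{p_1\times r_1}$ is the left singular space of $[\boldsymbol{\mathcal X}]_1$ and, for $2\le k\le d-1$, $\widetilde U_k^{(t)}\in\mathbb{R}^{(p_kr_{k-1})\times r_k}$ is the left singular space of $(I_{p_k}\otimes(\widehat U^{(t)})_{\mathrm{prod},k-1}^{(L)\top})[\boldsymbol{\mathcal X}]_k$. For odd $t$: $\widetilde V_d^{(t)}\in\mathbb{R}^{p_d\times r_{d-1}}$ is the right singular space of $[\boldsymbol{\mathcal X}]_{d-1}$ and, for $2\le k\le d-1$, $\widetilde V_k^{(t)}\in\mathbb{R}^{(p_kr_k)\times r_{k-1}}$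 is the right singular space of $[\boldsymbol{\mathcal X}]_{k-1}((\widehat V^{(t)})_{\mathrm{prod},k+1}^{(R)}\otimes I_{p_k})$. For odd $t$, $A_k^{(t)}=\|(\widehat U^{(t-1)})_{\mathrm{prod},k}^{(L)\top}[\boldsymbol{\mathcal Z}]_k((\widehat V^{(t)})_{\mathrm{prod},k+2}^{(R)}\otimes I_{p_{k+1}})\|_{\mathrm F}^2$ (the last factor being $I_{p_d}$ if $k=d-1$) and $B^{(t)}=\|[\boldsymbol{\mathcal Z}]_1(\widehat V^{(t)})_{\mathrm{prod},2}^{(R)}\|_{\mathrm F}^2$. For even $t\ge2$, $A_k^{(t)}=\|(I_{p_k}\otimes(\widehat U^{(t)})_{\mathrm{prod},k-1}^{(L)\top})[\boldsymbol{\mathcal Z}]_k(\widehat V^{(t-1)})_{\mathrm{prod},k+1}^{(R)}\|_{\mathrm F}^2$ (the first factor being $I_{p_1}$ if $k=1$) and $B^{(t)}=\|(\widehat U^{(t)})_{\mathrm{prod},d-1}^{(L)\top}[\boldsymbol{\mathcal Z}]_{d-1}\|_{\mathrm F}^2$. *)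

(* Defs.v *)
From HB Require Import structures.
From mathcomp Require Import all_boot all_order all_algebra.
From mathcomp.real_closed Require Export mxtens.
From mathcomp Require Import all_classical all_reals all_analysis.

Set Implicit Arguments.
Unset Strict Implicit.
Unset Printing Implicit Defensive.

Import Order.TTheory GRing.Theory Num.Theory.
Local Open Scope classical_set_scope.
Local Open Scope ring_scope.

(** Conventions.  The modes are numbered 1, ..., d and [p k], [r k] are the
    dimension and the rank with index [k] (values outside the ranges
    1 <= k <= d, resp. 0 <= k <= d, are never used); [r 0 = r d = 1] is a
    hypothesis of the theorem.  Positions inside a mode, and rows and columns
    of matrices, are numbered from 0.  The Kronecker product is [tensmx]
    (notation [A *t B], with blocks [A i j *: B]). *)

Section Matrices.
Variable R : realType.

Definition frob m n (A : 'M[R]_(m, n)) : R :=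
  Num.sqrt (\sum_i \sum_j A i j ^+ 2).

(** [s i] is the (i+1)-st singular value *)
Definition is_svd m n (A : 'M[R]_(m, n))
    (U : 'M[R]_m) (s : nat -> R) (V : 'M[R]_n) : Prop :=
  [/\ U^T *m U = 1%:M /\ V^T *m V = 1%:M,
      forall i, 0 <= s i,
      forall i j, (i <= j)%N -> s j <= s i,
      forall i, (minn m n <= i)%N -> s i = 0 &
      A = U *m (\matrix_(i < m, j < n) (s i *+ (i == j :> nat))) *m V^T].

(** s_k(A) for k >= 1; all singular value decompositions of A share the same
    sequence of singular values *)
Definition singval m n (A : 'M[R]_(m, n)) (k : nat) : R :=
  xget (fun=> 0) [set s : nat -> R | exists U V, is_svd A U s V] k.-1.

(** Q is a possible value of SVD^L_r(A), resp. SVD^R_r(A): the product with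
    [pid_mx r] keeps the first r columns *)
Definition is_SVDL m n r (A : 'M[R]_(m, n)) (Q : 'M[R]_(m, r)) : Prop :=
  exists U s V, is_svd A U s V /\ Q = U *m pid_mx r.

Definition is_SVDR m n r (A : 'M[R]_(m, n)) (Q : 'M[R]_(n, r)) : Prop :=
  exists U s V, is_svd A U s V /\ Q = V *m pid_mx r.

Definition sinTheta n r (U Uh : 'M[R]_(n, r)) : R :=
  Num.sqrt (1 - singval (U^T *m Uh) r ^+ 2).

(** Column-major reshape: entries with the same column-major linear index are
    equal (when m * n = m' * n' the sum has exactly one term) *)
Definition mx_reshape m n m' n' (A : 'M[R]_(m, n)) : 'M[R]_(m', n') :=
  \matrix_(a, b) \sum_(i < m) \sum_(j < n | (i + j * m == a + b * m')%N) A i j.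

End Matrices.

Section Tensors.
Variables (R : realType) (d : nat) (p : nat -> nat).

Definition mindex := {dffun forall j : 'I_d, 'I_(p j.+1)}.
Definition tensor := mindex -> R.

(** p_1 ... p_k *)
Fixpoint pL k : nat := if k is k'.+1 then (p k * pL k')%N else 1%N.
(** p_k ... p_{k+n-1} *)
Fixpoint prodR k n : nat := if n is n'.+1 then (prodR k.+1 n' * p k)%N else 1%N.
(** p_k ... p_d *)
Definition pR k : nat := prodR k (d.+1 - k).

Definition row_code k (i : mindex) : nat :=
  (\sum_(j < d | j < k) i j * \prod_(1 <= l < j.+1) p l)%N.
Definition col_code k (i : mindex) : nat :=
  (\sum_(j < d | k <= j) i j * \prod_(k.+1 <= l < j.+1) p l)%N.

(** [X]_k: for 1 <= k <= d, exactly one multi-index has given row and column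
    codes *)
Definition unfolding (X : tensor) k : 'M[R]_(pL k, pR k.+1) :=
  \matrix_(a, b)
    \sum_(i : mindex | (row_code k i == a) && (col_code k i == b)) X i.

Variable r : nat -> nat.

(** With r_0 = r_d = 1 the cores [G 0] and [G d.-1] are the matrices
    G_1 and G_d. *)
Definition has_TT (X : tensor) : Prop :=
  exists G : forall j : 'I_d, 'I_(r j) -> 'I_(p j.+1) -> 'I_(r j.+1) -> R,
  forall i : mindex, X i =
    \sum_(a : {dffun forall k : 'I_d.+1, 'I_(r k)})
      \prod_(j < d) G j (a (widen_ord (leqnSn d) j)) (i j) (a (lift ord0 j)).

Definition left_family := forall k, 'M[R]_(p k * r k.-1, r k).
Definition right_family := forall k, 'M[R]_(r k * p k, r k.-1).

(** M_prod,k^(L).  As r_0 = 1, the value at k = 0 is the 1 x 1 matrix [1], so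
    that M_prod,1 = M_1. *)
Fixpoint Lprod (M : left_family) k : 'M[R]_(pL k, r k) :=
  if k is k'.+1 then (1%:M *t Lprod M k') *m M k'.+1 else const_mx 1.

(** I_{p_k} (x) M_prod,k-1^(L)T for k >= 1; this is I_{p_1} if k = 1 *)
Definition IkronL (M : left_family) k : 'M[R]_(p k * r k.-1, pL k) :=
  if k is k'.+1 then 1%:M *t (Lprod M k')^T else 0.

(** Product of the factors B_k, ..., B_{k+n-1}.  It is only used for
    k + n = d + 1, where [n = 0] gives the 1 x 1 matrix [1] since r_d = 1. *)
Fixpoint Rprod_rec (B : right_family) k n : 'M[R]_(prodR k n, r k.-1) :=
  if n is n'.+1 then (Rprod_rec B k.+1 n' *t 1%:M) *m B k else const_mx 1.

(** B_prod,k^(R), equal to the 1 x 1 matrix [1] if k = d + 1 *)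
Definition Rprod (B : right_family) k : 'M[R]_(pR k, r k.-1) :=
  Rprod_rec B k (d.+1 - k).

Definition RkronI_rec (B : right_family) k n : 'M[R]_(prodR k n, r k * p k) :=
  if n is n'.+1 then Rprod_rec B k.+1 n' *t 1%:M else 0.

(** B_prod,k+1^(R) (x) I_{p_k} for k <= d; this is I_{p_d} if k = d *)
Definition RkronI (B : right_family) k : 'M[R]_(pR k, r k * p k) :=
  RkronI_rec B k (d.+1 - k).

(** [U t] and [Rm t], [Rt t] (the matrices R_k and R~_k) are meaningful for
    even [t], [V t] for odd [t].  The first [mx_reshape] is the identity since
    r_0 = 1. *)
Record is_TTOI (Y : tensor) (U : nat -> left_family) (V : nat -> right_family)
    (Rm : nat -> forall k, 'M[R]_(p k * r k.-1, pR k.+1))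
    (Rt : nat -> forall k, 'M[R]_(r k, pR k.+1))
    (Xh : nat -> tensor) : Prop := IsTTOI {
  TTOI_R1 : forall t, ~~ odd t -> Rm t 1%N = mx_reshape _ _ (unfolding Y 1) ;
  TTOI_U0 : forall k, (1 <= k <= d.-1)%N -> is_SVDL (Rm 0%N k) (U 0%N k) ;
  TTOI_U : forall t k, (2 <= t)%N -> ~~ odd t -> (1 <= k <= d.-1)%N ->
    is_SVDL (Rm t k *m Rprod (V t.-1) k.+1) (U t k) ;
  TTOI_Rt : forall t k, ~~ odd t -> (1 <= k <= d.-1)%N ->
    Rt t k = (U t k)^T *m Rm t k ;
  TTOI_R : forall t k, ~~ odd t -> (1 <= k < d.-1)%N ->
    Rm t k.+1 = mx_reshape _ _ (Rt t k) ;
  (* V_{k+1}, with V_d = SVD^R(R~_{d-1}) being the case k = d - 1 *)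
  TTOI_V : forall t k, odd t -> (1 <= k <= d.-1)%N ->
    is_SVDR (Rt t.-1 k *m RkronI (V t) k.+1) (V t k.+1) ;
  TTOI_Xeven : forall t, ~~ odd t ->
    unfolding (Xh t) d.-1 = Lprod (U t) d.-1 *m Rt t d.-1 ;
  TTOI_Xodd : forall t, odd t ->
    unfolding (Xh t) 1 = unfolding Y 1 *m Rprod (V t) 2 *m (Rprod (V t) 2)^T }.

(** Ut is a left singular space U~_k, resp. Vt is a right singular space V~_k,
    with [M] and [B] the current iterates *)
Definition is_Utilde (X : tensor) (M : left_family) k (Ut : 'M[R]_(_, r k)) :=
  is_SVDL (IkronL M k *m unfolding X k) Ut.

(** indexed by k + 1, for 1 <= k <= d - 1 *)
Definition is_Vtilde (X : tensor) (B : right_family) k (Vt : 'M[R]_(_, r k)) :=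
  is_SVDR (unfolding X k *m RkronI B k.+1) Vt.

Definition A_term (Z : tensor) (U : nat -> left_family)
    (V : nat -> right_family) (t k : nat) : R :=
  if odd t
  then frob ((Lprod (U t.-1) k)^T *m unfolding Z k *m RkronI (V t) k.+1) ^+ 2
  else frob (IkronL (U t) k *m unfolding Z k *m Rprod (V t.-1) k.+1) ^+ 2.

Definition B_term (Z : tensor) (U : nat -> left_family)
    (V : nat -> right_family) (t : nat) : R :=
  if odd t
  then frob (unfolding Z 1 *m Rprod (V t) 2) ^+ 2
  else frob ((Lprod (U t) d.-1)^T *m unfolding Z d.-1) ^+ 2.

End Tensors.

Section Probability.
Context {dsp : measure_display} {T : measurableType dsp} {R : realType}.
Variable P : probability T R.

Definition mutually_independent (I : finType) (Z : I -> {RV P >-> R}) : Prop :=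
  forall (J : {set I}) (B : I -> set R),
    (forall i, i \in J -> measurable (B i)) ->
    P (\bigcap_(i in [set` J]) (Z i @^-1` B i)) =
    (\prod_(i in J) P (Z i @^-1` B i))%E.

(** The bound for t = 1 and t = -1 already makes z integrable. *)
Definition sub_gaussian (sigma : R) (z : {RV P >-> R}) : Prop :=
  forall t : R,
    ('E_P[fun w => expR (t * (z w - fine 'E_P[z]))] <=
     (expR (sigma ^+ 2 * t ^+ 2 / 2))%:E)%E.

End Probability.

(* Main.v *)
Require Import Defs.
From mathcomp Require Import all_boot all_order all_algebra.
From mathcomp Require Import all_classical all_reals all_analysis.
From mathcomp Require Import measurable_realfun.
From mathcomp Require Import ring lra.

Set Implicit Arguments.
Unset Strict Implicit.
Unset Printing Implicit Defensive.

Import Order.TTheory GRing.Theory Num.Theory.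
Import numFieldNormedType.Exports HBNNSimple.
Local Open Scope classical_set_scope.
Local Open Scope ring_scope.

(** The theorem splits into a deterministic statement about the algorithm and a
    uniform bound for the noise.

    Deterministic part.  Write [X]_k for the k-th unfolding.  Every matrix that
    the algorithm decomposes is W M + N, where W is the k-th unfolding of the
    signal compressed on one side by the factors that were just computed, M is
    the compression on the other side by the factors of the previous pass (the
    identity at initialization), and N is the unfolding of the noise with the
    same compressions.  Let Q be the computed singular subspace.  As W M has
    rank at most r_k, what Q leaves of W M + N has norm at most that of N;
    hence Q leaves at most twice the norm of N of W M ([svd_perturb]).  If M
    shrinks vectors by a bounded factor only and the gap condition holds, Q
    loses at most half of every vector of the column space of W.  This has two
    consequences: the sine bound for Q ([sinTheta_le]), and the fact that the
    compression by Q keeps at least half of the norm of every vector.  By the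
    second one, a full sequence of compressions shrinks the signal by a factor
    of 2^(-d) at worst ([left_lowerS], [right_lowerS]), and this is the hypothesis on M in
    the next pass.  The fraction depends on d only and is derived anew in every
    pass, so the bounds hold for all t with the same constants ([lower_all]).

    Noise.  At initialization N is measured in the spectral norm, because its
    columns are not compressed; afterwards both sides are compressed, N has
    small size, and its Frobenius norm is bounded.  Both norms are suprema of a
    form in Z that is linear in each of the factors U_1, ..., V_d and in one or
    two further unit vectors.  The unit ball of any norm on matrices with n
    entries has a (1/2)-net of at most 18^n points ([exists_net]); for a linear
    form the supremum over the ball is at most twice the maximum over such a
    net.  Releasing the factors one after the other, the supremum is at most 2^d
    times the maximum over a list of at most 18^n tensors of norm at most 1,
    where n is the total number of entries ([tests_frob], [tests_op]).  For one
    tensor the sub-Gaussian tail bound applies ([tail_abs]), and the union bound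
    costs a factor that the tail at level 6 sigma sqrt(n) absorbs
    ([event_of_tests]).  The bounds for A_k and B are part of the noise event. *)

(** * Frobenius and spectral norms *)

Section Frobenius.
Variable R : realType.

Lemma frob_sqE m n (A : 'M[R]_(m, n)) : frob A ^+ 2 = \sum_i \sum_j A i j ^+ 2.
Proof.
rewrite sqr_sqrtr //; apply: sumr_ge0 => i _; apply: sumr_ge0 => j _.
exact: sqr_ge0.
Qed.

Lemma frob_ge0 m n (A : 'M[R]_(m, n)) : 0 <= frob A.
Proof. exact: sqrtr_ge0. Qed.
Hint Resolve frob_ge0 : core.

Lemma frob_sq_tr m n (A : 'M[R]_(m, n)) : frob A ^+ 2 = \tr (A^T *m A).
Proof.
rewrite frob_sqE exchange_big; apply: eq_bigr => j _; rewrite mxE.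
by apply: eq_bigr => i _; rewrite mxE expr2.
Qed.

Lemma ler_frob m n p q (A : 'M[R]_(m, n)) (B : 'M[R]_(p, q)) (c : R) :
  0 <= c -> frob A ^+ 2 <= c ^+ 2 * frob B ^+ 2 -> frob A <= c * frob B.
Proof.
move=> c0; rewrite -exprMn => h.
by rewrite -(@ler_pXn2r _ 2) // nnegrE ?mulr_ge0.
Qed.

Lemma eq_frob m n p q (A : 'M[R]_(m, n)) (B : 'M[R]_(p, q)) :
  frob A ^+ 2 = frob B ^+ 2 -> frob A = frob B.
Proof. by move=> h; apply/eqP; rewrite -(@eqrXn2 _ 2) // h. Qed.

Lemma frob_tr m n (A : 'M[R]_(m, n)) : frob A^T = frob A.
Proof. by apply: eq_frob; rewrite !frob_sq_tr trmxK mxtrace_mulC. Qed.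

Lemma frob0 m n : frob (0 : 'M[R]_(m, n)) = 0.
Proof. by apply/eqP; rewrite -sqrf_eq0 frob_sq_tr mulmx0 mxtrace0. Qed.

Lemma frob_entry m n (A : 'M[R]_(m, n)) i j : `|A i j| <= frob A.
Proof.
rewrite -(@ler_pXn2r _ 2) // ?nnegrE // frob_sqE (bigD1 i) //= (bigD1 j) //=.
rewrite -normrX ger0_norm ?sqr_ge0 // -addrA lerDl addr_ge0 //.
  by apply: sumr_ge0 => k _; exact: sqr_ge0.
by apply: sumr_ge0 => l _; apply: sumr_ge0 => k _; exact: sqr_ge0.
Qed.

Lemma frob_eq0 m n (A : 'M[R]_(m, n)) : (frob A == 0) = (A == 0).
Proof.
apply/eqP/eqP => [h|->]; last exact: frob0.
apply/matrixP => i j; rewrite mxE; apply/eqP; rewrite -normr_le0.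
by rewrite -h frob_entry.
Qed.

Lemma frob_delta n (i : 'I_n) : frob (delta_mx i 0 : 'cV[R]_n) = 1.
Proof.
apply/eqP; rewrite -(@eqrXn2 _ 2) // frob_sqE (bigD1 i) //= big_ord1 mxE !eqxx.
by rewrite !expr1n big1 ?addr0 // => k k0; rewrite big_ord1 mxE (negbTE k0) expr0n.
Qed.

Lemma frobZ m n (a : R) (A : 'M[R]_(m, n)) : frob (a *: A) = `|a| * frob A.
Proof.
apply/eqP; rewrite -(@eqrXn2 _ 2) ?mulr_ge0 // exprMn !frob_sqE real_normK ?num_real //.
rewrite mulr_sumr; apply/eqP/eq_bigr => i _; rewrite mulr_sumr.
by apply: eq_bigr => j _; rewrite mxE exprMn.
Qed.

Lemma frobN m n (A : 'M[R]_(m, n)) : frob (- A) = frob A.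
Proof. by rewrite -scaleN1r frobZ normrN1 mul1r. Qed.

Lemma tr_mul_comm m n (A B : 'M[R]_(m, n)) : \tr (A^T *m B) = \tr (B^T *m A).
Proof. by rewrite -mxtrace_tr trmx_mul trmxK. Qed.

Lemma frob_CS m n (A B : 'M[R]_(m, n)) : `|\tr (A^T *m B)| <= frob A * frob B.
Proof.
have E : forall x y : R, 0 <= x ^+ 2 * frob A ^+ 2
    - 2 * x * y * \tr (A^T *m B) + y ^+ 2 * frob B ^+ 2.
  move=> x y.
  suff -> : x ^+ 2 * frob A ^+ 2 - 2 * x * y * \tr (A^T *m B) + y ^+ 2 * frob B ^+ 2
     = frob (x *: A - y *: B) ^+ 2 by exact: sqr_ge0.
  have trE : (x *: A - y *: B)^T = x *: A^T - y *: B^T.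
    by apply/matrixP => i j; rewrite !mxE.
  rewrite !frob_sq_tr trE mulmxBl !mulmxBr -!scalemxAl -!scalemxAr.
  by rewrite !raddfB /= !mxtraceZ (tr_mul_comm B A); ring.
have [/eqP|nz] := eqVneq (frob A * frob B) 0.
  rewrite mulf_eq0 !frob_eq0 => /orP[]/eqP->; rewrite ?trmx0
    ?mul0mx ?mulmx0 mxtrace0 normr0 mulr_ge0 //.
have p : 0 < frob A * frob B by rewrite lt_def nz mulr_ge0.
have e1 := E (frob B) (frob A); have e2 := E (frob B) (- frob A).
rewrite ler_norml; apply/andP; split; rewrite -(ler_pM2l p); nra.
Qed.

Lemma frobD m n (A B : 'M[R]_(m, n)) : frob (A + B) <= frob A + frob B.
Proof.
have trE : (A + B)^T = A^T + B^T by rewrite linearD.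
rewrite -(@ler_pXn2r _ 2) // ?nnegrE ?addr_ge0 // sqrrD !frob_sq_tr.
rewrite trE mulmxDl !mulmxDr !raddfD /= (tr_mul_comm B A).
have := ler_norml (\tr (A^T *m B)) (frob A * frob B); rewrite frob_CS => /esym/andP[_].
by lra.
Qed.

Lemma frobB m n (A B : 'M[R]_(m, n)) : frob (A - B) <= frob A + frob B.
Proof. by rewrite -(frobN B) frobD. Qed.

Lemma frobM m n p (A : 'M[R]_(m, n)) (B : 'M[R]_(n, p)) :
  frob (A *m B) <= frob A * frob B.
Proof.
apply: ler_frob => //; rewrite !frob_sqE [X in _ * X]exchange_big mulr_suml.
apply: ler_sum => i _; rewrite mulr_sumr; apply: ler_sum => j _.
have /= := frob_CS (row i A)^T (col j B).
rewrite /mxtrace trmxK big_ord1 mxE.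
have -> : \sum_j0 row i A 0 j0 * col j B j0 0 = (A *m B) i j.
  by rewrite mxE; apply: eq_bigr => k _; rewrite !mxE.
move=> h; have : `|(A *m B) i j| ^+ 2 <= (frob (row i A)^T * frob (col j B)) ^+ 2.
  by rewrite ler_pXn2r // nnegrE mulr_ge0.
rewrite -normrX ger0_norm ?sqr_ge0 // exprMn !frob_sqE exchange_big big_ord1.
under [X in X * _]eq_bigr do rewrite !mxE.
by under [X in _ * X]eq_bigr do rewrite big_ord1 mxE.
Qed.

(** [c] bounds the spectral norm of [A].  Testing against matrices of every
    width allows whole matrices to be compressed without splitting them into
    columns. *)
Definition opn m n (A : 'M[R]_(m, n)) (c : R) : Prop :=
  forall q (B : 'M[R]_(n, q)), frob (A *m B) <= c * frob B.

Lemma opn_frob m n (A : 'M[R]_(m, n)) c : frob A <= c -> opn A c.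
Proof. by move=> h q B; apply: le_trans (frobM A B) _; rewrite ler_wpM2r. Qed.

Lemma opn_le m n (A : 'M[R]_(m, n)) c c' : opn A c -> c <= c' -> opn A c'.
Proof. by move=> h cc q B; apply: le_trans (h q B) _; rewrite ler_wpM2r. Qed.

Lemma opnM m n p (A : 'M[R]_(m, n)) (B : 'M[R]_(n, p)) c c' :
  0 <= c -> opn A c -> opn B c' -> opn (A *m B) (c * c').
Proof.
move=> c0 hA hB q C; rewrite -mulmxA; apply: le_trans (hA _ _) _.
by rewrite -mulrA ler_wpM2l.
Qed.

Lemma opnD m n (A B : 'M[R]_(m, n)) c c' :
  opn A c -> opn B c' -> opn (A + B) (c + c').
Proof.
move=> hA hB q C; rewrite mulmxDl mulrDl.
by apply: le_trans (frobD _ _) _; apply: lerD.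
Qed.

Lemma opnZ m n (A : 'M[R]_(m, n)) a c : opn A c -> opn (a *: A) (`|a| * c).
Proof. by move=> h q B; rewrite -scalemxAl frobZ -mulrA ler_wpM2l. Qed.

Lemma opn_tr m n (A : 'M[R]_(m, n)) c : 0 <= c -> opn A c -> opn A^T c.
Proof.
move=> c0 hA q B; have [->|nz] := eqVneq (A^T *m B) 0.
  by rewrite frob0 mulr_ge0.
have p : 0 < frob (A^T *m B) by rewrite lt_def frob_eq0 nz /=.
rewrite -(ler_pM2r p) -expr2 frob_sq_tr trmx_mul trmxK -mulmxA.
apply: le_trans (ler_norm _) _; apply: le_trans (frob_CS _ _) _.
by rewrite [c * _]mulrC -mulrA ler_wpM2l.
Qed.

Lemma opn_mulr m n p (A : 'M[R]_(m, n)) (B : 'M[R]_(n, p)) c : 0 <= c ->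
  opn B c -> frob (A *m B) <= c * frob A.
Proof.
by move=> c0 hB; rewrite -frob_tr trmx_mul -(frob_tr A); apply: opn_tr.
Qed.

Lemma frob_isom m n q (Q : 'M[R]_(m, n)) (B : 'M[R]_(n, q)) :
  Q^T *m Q = 1%:M -> frob (Q *m B) = frob B.
Proof.
move=> h; apply: eq_frob; rewrite !frob_sq_tr trmx_mul mulmxA.
by rewrite -[_ *m Q]mulmxA h mulmx1.
Qed.

Lemma opn_isom m n (Q : 'M[R]_(m, n)) : Q^T *m Q = 1%:M -> opn Q 1.
Proof. by move=> h q B; rewrite frob_isom // mul1r. Qed.

Lemma frob_pyth m n q (Q : 'M[R]_(m, n)) (B : 'M[R]_(m, q)) :
  Q^T *m Q = 1%:M ->
  frob (Q^T *m B) ^+ 2 + frob ((1%:M - Q *m Q^T) *m B) ^+ 2 = frob B ^+ 2.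
Proof.
move=> h; rewrite !frob_sq_tr !trmx_mul linearB /= trmx1 trmx_mul trmxK.
have idem : (1%:M - Q *m Q^T) *m (1%:M - Q *m Q^T) = 1%:M - Q *m Q^T.
  rewrite mulmxBl mul1mx mulmxBr mulmx1 mulmxA -[_ *m Q^T *m Q]mulmxA h mulmx1.
  by rewrite subrr subr0.
rewrite -linearD /= !mulmxA -[_ *m (1%:M - _) *m (1%:M - _)]mulmxA idem.
by rewrite mulmxBr mulmx1 mulmxBl addrC !mulmxA subrK.
Qed.

Lemma opn_perp m n (Q : 'M[R]_(m, n)) :
  Q^T *m Q = 1%:M -> opn (1%:M - Q *m Q^T) 1.
Proof.
move=> h q B; apply: ler_frob => //.
by rewrite expr1n mul1r -(frob_pyth B h) lerDr sqr_ge0.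
Qed.

Lemma opn0 m n (A : 'M[R]_(m, n)) : opn A 0 -> A = 0.
Proof.
move=> h; apply/eqP; rewrite -frob_eq0 eq_le frob_ge0 andbT.
by have := h _ 1%:M; rewrite mulmx1 mul0r.
Qed.

Lemma frob_diag m q (d : 'rV[R]_m) (B : 'M[R]_(m, q)) :
  frob (diag_mx d *m B) ^+ 2 = \sum_i d 0 i ^+ 2 * (\sum_j B i j ^+ 2).
Proof.
rewrite frob_sqE; apply: eq_bigr => i _; rewrite mulr_sumr.
by apply: eq_bigr => j _; rewrite mul_diag_mx mxE exprMn.
Qed.

Lemma frob_diag_le m q (d : 'rV[R]_m) c (B : 'M[R]_(m, q)) : 0 <= c ->
  (forall i, `|d 0 i| <= c) -> frob (diag_mx d *m B) <= c * frob B.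
Proof.
move=> c0 h; apply: ler_frob => //; rewrite frob_diag frob_sqE mulr_sumr.
apply: ler_sum => i _; apply: ler_wpM2r.
  by apply: sumr_ge0 => j _; exact: sqr_ge0.
by rewrite -[d 0 i ^+ 2]ger0_norm ?sqr_ge0 // normrX ler_pXn2r ?nnegrE.
Qed.

Lemma frob_diag_ge m q (d : 'rV[R]_m) c (B : 'M[R]_(m, q)) : 0 <= c ->
  (forall i, c <= d 0 i) -> c * frob B <= frob (diag_mx d *m B).
Proof.
move=> c0 h; rewrite -(@ler_pXn2r _ 2) // ?nnegrE ?mulr_ge0 //.
rewrite exprMn frob_diag frob_sqE mulr_sumr.
apply: ler_sum => i _; apply: ler_wpM2r.
  by apply: sumr_ge0 => j _; exact: sqr_ge0.
by rewrite ler_pXn2r ?nnegrE // (le_trans c0).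
Qed.

Lemma pid_isom m n : (n <= m)%N ->
  (pid_mx n : 'M[R]_(m, n))^T *m (pid_mx n : 'M[R]_(m, n)) = 1%:M.
Proof. by move=> h; rewrite tr_pid_mx mul_pid_mx minnn (minn_idPr h) pid_mx_1. Qed.

Lemma opn_pid m n : opn (pid_mx m : 'M[R]_(m, n)) 1.
Proof.
case: (leqP n m) => h.
  have -> : pid_mx m = pid_mx n :> 'M[R]_(m, n).
    by rewrite -(pid_mx_minh _ m n m) (minn_idPl h).
  exact/opn_isom/pid_isom.
have -> : pid_mx m = (pid_mx m : 'M[R]_(n, m))^T :> 'M[R]_(m, n) by rewrite tr_pid_mx.
by apply: opn_tr => //; apply/opn_isom/pid_isom/ltnW.
Qed.

End Frobenius.
#[global] Hint Extern 0 (is_true (0 <= frob _)) => exact: frob_ge0 : core.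

(** * Singular subspaces and their perturbation *)

Section SVD.
Variable R : realType.

Lemma is_svd_tr m n (A : 'M[R]_(m, n)) U s V : is_svd A U s V -> is_svd A^T V s U.
Proof.
case=> -[hU hV] h0 hs hz ->; split => //; first by rewrite minnC.
rewrite !trmx_mul trmxK mulmxA; congr (_ *m _ *m _).
apply/matrixP => i j; rewrite !mxE eq_sym.
by case: eqP => [->|_]; rewrite ?mulr0n.
Qed.

Lemma is_SVDL_tr m n r (A : 'M[R]_(m, n)) (Q : 'M[R]_(n, r)) :
  is_SVDR A Q -> is_SVDL A^T Q.
Proof. by case=> U [s [V [h ->]]]; exists V, s, U; split => //; exact: is_svd_tr. Qed.

Lemma SVDL_isom m n r (A : 'M[R]_(m, n)) (Q : 'M[R]_(m, r)) :
  (r <= m)%N -> is_SVDL A Q -> Q^T *m Q = 1%:M.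
Proof.
move=> rm [U [s [V [[[hU _] _ _ _ _] ->]]]].
by rewrite trmx_mul mulmxA -[_ *m U^T *m U]mulmxA hU mulmx1 pid_isom.
Qed.

Lemma SVDR_isom m n r (A : 'M[R]_(m, n)) (Q : 'M[R]_(n, r)) :
  (r <= n)%N -> is_SVDR A Q -> Q^T *m Q = 1%:M.
Proof. by move=> rn /is_SVDL_tr /SVDL_isom; apply. Qed.

Lemma svd_mul m n r (A : 'M[R]_(m, n)) U s V : is_svd A U s V ->
  (r <= m)%N -> (r <= n)%N ->
  A *m (V *m (pid_mx r : 'M[R]_(n, r))) =
  U *m (pid_mx r : 'M[R]_(m, r)) *m diag_mx (\row_i s i).
Proof.
move=> [[hU hV] h0 hs hz ->] rm rn.
rewrite -!mulmxA [V^T *m _]mulmxA hV mul1mx; congr (_ *m _).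
rewrite mul_mx_diag; apply/matrixP => i j; rewrite !mxE.
rewrite (bigD1 (widen_ord rn j)) //= big1 => [|k kj].
  rewrite !mxE /= eqxx ltn_ord /= mulr1 addr0.
  case: (eqVneq (i : nat) j) => [->|_]; last by rewrite /= mul0r mulr0n.
  by rewrite ltn_ord mul1r mulr1n.
rewrite !mxE; have -> : (k == j :> nat) = false; last by rewrite /= mulr0.
by apply/negbTE; move: kj; rewrite -val_eqE.
Qed.

(** In the singular bases the projection deletes the first [r] diagonal
    entries; the largest remaining one is [s r]. *)
Lemma svd_perp m n r (A : 'M[R]_(m, n)) U s V : is_svd A U s V ->
  let Q := U *m (pid_mx r : 'M[R]_(m, r)) in
  opn ((1%:M - Q *m Q^T) *m A) (s r).
Proof.
move=> [[hU hV] h0 hs hz ->] Q.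
have VV : V *m V^T = 1%:M by apply: mulmx1C.
have -> : (1%:M - Q *m Q^T) *m (U *m (\matrix_(i < m, j < n) (s i *+ (i == j :> nat))) *m V^T)
  = U *m (diag_mx (\row_i (if (i < r)%N then 0 else s i)) *m (pid_mx m : 'M[R]_(m, n))) *m V^T.
  have E : (1%:M - Q *m Q^T) *m U = U *m (1%:M - pid_mx r).
    rewrite mulmxBl mul1mx /Q trmx_mul !mulmxA -[_ *m U^T *m U]mulmxA hU mulmx1.
    by rewrite tr_pid_mx -[U *m _ *m _]mulmxA mul_pid_mx !minnn mulmxBr mulmx1.
  rewrite !(mulmxA (1%:M - _)) E -!(mulmxA U); congr (U *m _); rewrite ?mulmxA; congr (_ *m _).
  apply/matrixP => i j; rewrite mul_diag_mx !mxE (bigD1 i) //= big1 => [|k ki].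
    rewrite !mxE ltn_ord andbT eqxx /= addr0.
    case: (eqVneq (i:nat) j) => [e|_]; last by rewrite /= mulr0n !mulr0.
    by case: ltnP => _; rewrite e eqxx ?mulr1n /= ?subrr ?subr0 ?mulr1 ?mul0r ?mul1r.
  rewrite !mxE; have -> : (i == k :> nat) = false by rewrite eq_sym; apply/negbTE.
  have -> : (i == k) = false by rewrite eq_sym; apply/negbTE.
  by rewrite /= mulr0n subr0 mul0r.
have dle q (B : 'M[R]_(m, q)) :
  frob (diag_mx (\row_i (if (i < r)%N then 0 else s i)) *m B) <= s r * frob B.
  apply: frob_diag_le => // i; rewrite mxE; case: ltnP => h; rewrite ?normr0 //.
  by rewrite ger0_norm // hs.
move=> q B; rewrite -!mulmxA (frob_isom _ hU).
apply: le_trans (dle _ _) _; rewrite ler_wpM2l //.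
have hVt : V^T^T *m V^T = 1%:M by rewrite trmxK.
by rewrite -(frob_isom B hVt) -[leRHS]mul1r; exact: opn_pid.
Qed.
(** The kernel of [M] meets the span of the first r + 1 right singular
    vectors of [A] in some unit vector; there [A] and [N] agree, and [A] has
    norm at least [s r]. *)
Lemma svd_gap m n r (A M N : 'M[R]_(m, n)) U s V c : is_svd A U s V ->
  A = M + N -> (\rank M <= r)%N -> 0 <= c -> opn N c -> s r <= c.
Proof.
move=> hsvd hA rM c0 hN; have [[hU hV] h0 hs hz _] := hsvd.
have [mnr|] := leqP (minn m n) r; first by rewrite hz.
rewrite leq_min => /andP[rm rn].
pose W := V *m (pid_mx r.+1 : 'M[R]_(n, r.+1)).
have hW : W^T *m W = 1%:M.
  by rewrite trmx_mul mulmxA -[_ *m V^T *m V]mulmxA hV mulmx1 pid_isom.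
have [a a0 Ma] : exists2 a : 'cV[R]_r.+1, a != 0 & M *m W *m a = 0.
  have ker0 : kermx (M *m W)^T != 0.
    rewrite -mxrank_eq0 mxrank_ker mxrank_tr -lt0n subn_gt0 ltnS.
    exact: leq_trans (mxrankM_maxl _ _) rM.
  have [i /sub_kermxP ri ineq] := rowV0Pn ker0.
  exists i^T; first by rewrite -frob_eq0 frob_tr frob_eq0.
  by apply: trmx_inj; rewrite trmx0 trmx_mul trmxK; exact: ri.
have fa : 0 < frob a by rewrite lt_def frob_eq0 a0 frob_ge0.
rewrite -(ler_pM2r fa).
have -> : c * frob a = c * frob (W *m a) by rewrite frob_isom.
apply: le_trans (hN _ (W *m a)).
have -> : N *m (W *m a) = A *m W *m a by rewrite hA -[RHS]mulmxA mulmxDl (mulmxA M) Ma add0r.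
rewrite (svd_mul hsvd) // -!mulmxA (frob_isom _ hU) (frob_isom _ (pid_isom _ rm)).
by apply: frob_diag_ge => // i; rewrite mxE hs // -ltnS.
Qed.

(** [svd_gap] with no perturbation gives [s r = 0], so that the projection
    in [svd_perp] annihilates [A]. *)
Lemma svd_col m n r (A : 'M[R]_(m, n)) U s V : is_svd A U s V ->
  (\rank A <= r)%N ->
  let Q := U *m (pid_mx r : 'M[R]_(m, r)) in Q *m (Q^T *m A) = A.
Proof.
move=> hsvd rA Q; have s0 : s r = 0.
  apply/eqP; rewrite eq_le (svd_gap hsvd (esym (addr0 A)) rA) //; last first.
    by move=> q B; rewrite mul0mx frob0 mul0r.
  by case: hsvd => _ ->.
have := @svd_perp _ _ r _ _ _ _ hsvd; rewrite s0 -/Q => /opn0/eqP.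
by rewrite mulmxBl mul1mx subr_eq0 mulmxA => /eqP <-.
Qed.

(** As the rank is exactly [r], [Q^T *m A] is row free; a right inverse of it
    expresses [Q] through the columns of [A]. *)
Lemma SVDL_col m n r (A : 'M[R]_(m, n)) (Q : 'M[R]_(m, r)) : is_SVDL A Q ->
  \rank A = r -> exists C, Q = A *m C.
Proof.
move=> [U [s [V [hsvd ->]]]] rA.
have rle : (\rank A <= r)%N by rewrite rA.
have hQ := svd_col hsvd rle; set Q0 := U *m _ in hQ *.
have rf : row_free (Q0^T *m A).
  rewrite /row_free eqn_leq rank_leq_row /= -[leqLHS]rA -[in leqLHS]hQ.
  exact: mxrankM_maxr.
have [C hC] := row_freeP rf.
by exists C; rewrite -[in RHS]hQ -mulmxA hC mulmx1.
Qed.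

(** The nonzero singular values of [W] are at least [mu].  Stated through
    preimages, the property passes to [A *m W] for every [A] that does not
    shrink the range of [W], and involves no choice of singular vectors. *)
Definition bounded_below m n (W : 'M[R]_(m, n)) (mu : R) : Prop :=
  forall q (B : 'M[R]_(n, q)), exists B1, W *m B1 = W *m B /\
    mu * frob B1 <= frob (W *m B).

(** The preimages are the projections onto the first [r] right singular
    vectors, on which [A] is bounded below by [s r.-1] and outside of which it
    vanishes. *)
Lemma svd_bounded_below m n r (A : 'M[R]_(m, n)) U s V mu : is_svd A U s V ->
  (0 < r)%N -> (r <= m)%N -> (r <= n)%N -> 0 < mu -> mu <= s r.-1 ->
  (\rank A <= r)%N -> bounded_below A mu /\ \rank A = r.
Proof.
move=> hsvd r0 rm rn mu0 hmu rA; have [[hU hV] h0 hs hz _] := hsvd.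
have rAt : (\rank A^T <= r)%N by rewrite mxrank_tr.
have hQ := svd_col (is_svd_tr hsvd) rAt.
set Q := V *m _ in hQ.
have hAQ : A *m Q *m Q^T = A.
  by move/(congr1 trmx): hQ; rewrite !trmx_mul !trmxK => hAQ; rewrite ?trmx_mul; exact: hAQ.
have hmul := svd_mul hsvd rm rn; rewrite -/Q in hmul.
have hAQB q (B : 'M[R]_(r, q)) : mu * frob B <= frob (A *m Q *m B).
  rewrite hmul -!mulmxA (frob_isom _ hU) (frob_isom _ (pid_isom _ rm)).
  apply: frob_diag_ge; first exact: ltW.
  by move=> i; rewrite mxE (le_trans hmu) // hs // -ltnS (prednK r0) ltn_ord.
have hQQ : Q^T *m Q = 1%:M.
  by rewrite trmx_mul mulmxA -[_ *m V^T *m V]mulmxA hV mulmx1 pid_isom.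
clearbody Q; split.
  move=> q B; exists (Q *m (Q^T *m B)); split; first by rewrite !mulmxA hAQ.
  have e : A *m B = A *m Q *m (Q^T *m B) by rewrite mulmxA hAQ.
  by rewrite (frob_isom _ hQQ) e hAQB.
apply/eqP; rewrite eqn_leq rA /=.
apply: leq_trans (mxrankM_maxl A Q).
rewrite -mxrank_tr; suff : row_free (A *m Q)^T by move=> /eqP ->.
rewrite -kermx_eq0; apply/negPn/negP => /rowV0Pn[v /sub_kermxP hv v0].
have := hAQB _ v^T; rewrite -[A *m Q *m _]trmxK trmx_mul trmxK hv trmx0 frob0.
by rewrite pmulr_rle0 // frob_tr leNgt lt_def frob_eq0 v0 frob_ge0.
Qed.

(** The kernel of [B] is contained in that of [A]. *)
Lemma rank_le_of_bound m n p (A : 'M[R]_(m, n)) (B : 'M[R]_(p, n)) c : 0 < c ->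
  (forall q (C : 'M[R]_(n, q)), c * frob (A *m C) <= frob (B *m C)) ->
  (\rank A <= \rank B)%N.
Proof.
move=> c0 h; rewrite -(mxrank_tr A) -(mxrank_tr B).
have : (kermx B^T <= kermx A^T)%MS.
  have e : B *m (kermx B^T)^T = 0.
    by apply: trmx_inj; rewrite trmx_mul trmxK mulmx_ker trmx0.
  apply/sub_kermxP; have := h _ (kermx B^T)^T.
  rewrite e frob0 pmulr_rle0 // le_eqVlt ltNge frob_ge0 orbF frob_eq0 => /eqP E.
  by apply: trmx_inj; rewrite trmx_mul trmxK E trmx0.
move/mxrankS; rewrite !mxrank_ker => k.
have a := rank_leq_row A^T; have b := rank_leq_row B^T.
by rewrite -(subKn a) -(subKn b) leq_sub2l.
Qed.

(** Let Pi be the projection along [Q].  Then Pi (W M + N) has norm at most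
    the (r+1)-st singular value of W M + N, which is at most [delta] by
    [svd_gap]; so Pi W M has norm at most 2 delta.  As [M] shrinks rows by at
    most [c], Pi W has norm at most 2 delta / c, and applying it to a preimage
    of [W *m B] of norm at most |W B| / mu gives the factor 1/2.  The error is
    relative to [W *m B], which is what the induction over the modes needs. *)
Lemma svd_perturb m n q r (W : 'M[R]_(m, n)) (M : 'M[R]_(n, q))
    (N : 'M[R]_(m, q)) (Q : 'M[R]_(m, r)) delta c mu :
  0 < c -> 0 < mu -> 0 <= delta -> (r <= m)%N ->
  is_SVDL (W *m M + N) Q -> (\rank (W *m M) <= r)%N -> opn N delta ->
  (forall k (B : 'M[R]_(k, m)), c * frob (B *m W) <= frob (B *m W *m M)) ->
  bounded_below W mu -> 4 * delta <= c * mu ->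
  forall k (B : 'M[R]_(n, k)),
    frob ((1%:M - Q *m Q^T) *m (W *m B)) <= 1 / 2 * frob (W *m B).
Proof.
move=> c0 mu0 d0 rm hQ rWM hN hM hW hd k B.
have hQQ := SVDL_isom rm hQ.
have [U [s [V [hsvd QE]]]] := hQ.
set P := 1%:M - Q *m Q^T.
have hP : opn (P *m (W *m M)) (2 * delta).
  have sd : s r <= delta by apply: svd_gap hsvd _ rWM d0 hN.
  have -> : P *m (W *m M) = P *m (W *m M + N) + (-1) *: (P *m N).
    by rewrite mulmxDr scaleN1r addrK.
  have -> : 2 * delta = delta + `|-1| * (1 * delta) by rewrite normrN1; ring.
  apply: opnD; first by rewrite /P QE; apply: opn_le (svd_perp _ hsvd) sd.
  by apply: opnZ; apply: opnM => //; exact: opn_perp.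
have hPW : opn (P *m W) (2 * delta / c).
  have -> : P *m W = (W^T *m P^T)^T by rewrite trmx_mul !trmxK.
  have e0 : 0 <= 2 * delta / c by rewrite divr_ge0 ?mulr_ge0 // ltW.
  apply: opn_tr => // l C.
  have hMt := hM _ (C^T *m P).
  rewrite mulrAC ler_pdivlMr // mulrC.
  have -> : frob (W^T *m P^T *m C) = frob (C^T *m P *m W).
    by rewrite -frob_tr !trmx_mul !trmxK mulmxA.
  apply: le_trans hMt _.
  rewrite -(frob_tr C) -!mulmxA; apply: opn_mulr; first by rewrite mulr_ge0.
  exact: hP.
have [B1 [E hB1]] := hW _ B.
rewrite -E mulmxA; apply: le_trans (hPW _ _) _; rewrite E.
rewrite mulrAC ler_pdivrMr //.
have h1 := ler_wpM2r (frob_ge0 B1) hd.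
have h2 := ler_wpM2l (ltW c0) hB1.
nra.
Qed.

Lemma proj_lower m n r k (W : 'M[R]_(m, n)) (Q : 'M[R]_(m, r)) (B : 'M[R]_(n, k)) :
  Q^T *m Q = 1%:M ->
  frob ((1%:M - Q *m Q^T) *m (W *m B)) <= 1 / 2 * frob (W *m B) ->
  1 / 2 * frob (W *m B) <= frob (Q^T *m (W *m B)).
Proof.
move=> hQ h; have e : W *m B = Q *m (Q^T *m (W *m B)) + (1%:M - Q *m Q^T) *m (W *m B).
  by rewrite mulmxBl mul1mx mulmxA addrC subrK.
have := frobD (Q *m (Q^T *m (W *m B))) ((1%:M - Q *m Q^T) *m (W *m B)).
by rewrite -e (frob_isom _ hQ); lra.
Qed.
End SVD.

(** * Existence of singular value decompositions *)

Section SVDex.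
Variable R : realType.

Lemma continuous_frob_sq n m (A : 'M[R]_(m, n)) :
  continuous (fun x : 'rV[R]_n => frob (A *m x^T) ^+ 2).
Proof.
have csum (T : topologicalType) (I : Type) (s : seq I) (F : I -> T -> R) :
    (forall i, continuous (F i)) -> continuous (fun x => \sum_(i <- s) F i x).
  move=> cF; elim: s => [|i s IH].
    have -> : (fun x => \sum_(i <- [::]) F i x) = fun=> 0.
      by apply/funext => x; rewrite big_nil.
    exact: cst_continuous.
  have -> : (fun x => \sum_(j <- i :: s) F j x) = F i \+ fun x => \sum_(j <- s) F j x.
    by apply/funext => x; rewrite big_cons.
  by move=> x; exact: (@continuousD R R^o T _ _ x (cF i x) (IH x)).
have -> : (fun x : 'rV[R]_n => frob (A *m x^T) ^+ 2) =
    (fun x => \sum_i (\sum_k A i k * x 0 k) * (\sum_k A i k * x 0 k)).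
  apply/funext => x; rewrite frob_sqE; apply: eq_bigr => i _.
  rewrite big_ord1 mxE expr2; congr (_ * _); apply: eq_bigr => k _; rewrite mxE //.
have c1 i : continuous (fun x : 'rV[R]_n => \sum_k A i k * x 0 k).
  apply: csum => k x; apply: continuousM; first exact: cst_continuous.
  exact: coord_continuous.
by apply: csum => i x; apply: continuousM; exact: c1.
Qed.

Lemma opn_cols m n (A : 'M[R]_(m, n)) c : 0 <= c ->
  (forall x : 'cV[R]_n, frob (A *m x) <= c * frob x) -> opn A c.
Proof.
move=> c0 h q B; apply: ler_frob => //.
have colE m' (C : 'M[R]_(m', q)) : frob C ^+ 2 = \sum_j frob (col j C) ^+ 2.
  rewrite frob_sqE exchange_big; apply: eq_bigr => j _; rewrite frob_sqE.
  by apply: eq_bigr => i _; rewrite big_ord1 mxE.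
rewrite !colE mulr_sumr; apply: ler_sum => j _.
have -> : col j (A *m B) = A *m col j B 
  by apply/matrixP => i k; rewrite !mxE; apply: eq_bigr => l _; rewrite !mxE.
by rewrite -exprMn ler_pXn2r ?nnegrE ?mulr_ge0.
Qed.

(** The unit sphere is compact. *)
Lemma opn_attained m n (A : 'M[R]_(m, n.+1)) :
  exists2 v : 'cV[R]_n.+1, frob v = 1 & opn A (frob (A *m v)).
Proof.
pose K : set 'rV[R]_n.+1 := [set x | frob x^T ^+ 2 = 1].
have [] := @compact_EVT_max _ _ (fun x : 'rV[R]_n.+1 => frob (A *m x^T) ^+ 2) K.
- by exists (delta_mx 0 0); rewrite /K /= trmx_delta frob_delta expr1n.
- apply: bounded_closed_compact.
    exists 1; split; first exact: num_real.
    move=> M M1 x /= hx; apply: le_trans (ltW M1).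
    rewrite [leLHS]/Num.norm /= mx_normrE; apply/bigmax_leP; split => // -[i j] _ /=.
    apply: le_trans (frob_entry _ _ _) _.
    by rewrite -frob_tr -(@ler_pXn2r _ 2) // ?nnegrE // expr1n hx.
  rewrite (_ : K = (fun x : 'rV[R]_n.+1 => frob (1%:M *m x^T) ^+ 2) @^-1` [set 1]).
    apply: preimage_closed; last exact: closed_eq.
    by move=> x _; exact: continuous_frob_sq.
  by apply/seteqP; split => x; rewrite /K /= mul1mx.
- apply: continuous_subspaceT; exact: continuous_frob_sq.
move=> v /set_mem vK hv; exists v^T.
  by apply/eqP; rewrite -(@eqrXn2 _ 2) // vK expr1n.
apply: opn_cols => // x; have [->|x0] := eqVneq x 0.
  by rewrite mulmx0 !frob0 mulr0.
have fx : 0 < frob x by rewrite lt_def frob_eq0 x0 frob_ge0.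
have := hv ((frob x)^-1 *: x^T); rewrite inE.
have fxv : 0 <= (frob x)^-1 by rewrite invr_ge0.
have xT : ((frob x)^-1 *: x^T)^T = (frob x)^-1 *: x by apply/matrixP => i j; rewrite !mxE.
rewrite /K /= xT -scalemxAr !frobZ (ger0_norm fxv) mulVf ?gt_eqF // expr1n.
by move=> /(_ erefl); rewrite ler_pXn2r ?nnegrE ?mulr_ge0 // mulrC ler_pdivrMr.
Qed.
(** The reflection that exchanges [v] and the first basis vector. *)
Lemma orthogonal_completion n (v : 'cV[R]_n.+1) : frob v = 1 ->
  exists2 H : 'M[R]_n.+1, H^T *m H = 1%:M & H *m delta_mx 0 0 = v.
Proof.
move=> v1; set e : 'cV[R]_n.+1 := delta_mx 0 0.
have [ve|ve] := eqVneq v e.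
  exists 1%:M; [by rewrite trmx1 mul1mx|by rewrite mul1mx ve].
pose w := v - e; have w0 : w != 0 by rewrite subr_eq0.
have fw : frob w != 0 by rewrite frob_eq0.
have ww : w^T *m w = (frob w ^+ 2)%:M.
  by rewrite frob_sq_tr [LHS]mx11_scalar trace_mx11.
pose t := 2 / frob w ^+ 2.
pose H := 1%:M - t *: (w *m w^T).
have HT : H^T = H.
  by rewrite /H linearB /= trmx1 linearZ /= trmx_mul trmxK.
exists H.
  rewrite HT /H mulmxBl mul1mx mulmxBr mulmx1 -scalemxAl -!scalemxAr.
  rewrite mulmxA -[w *m w^T *m w]mulmxA ww mul_mx_scalar -scalemxAl !scalerA.
  have -> : t * (t * frob w ^+ 2) = t + t by rewrite /t; field.
  rewrite scalerDl; set X := t *: _.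
  have -> : X - (X + X) = - X by rewrite opprD addrA subrr sub0r.
  by rewrite opprK subrK.
have wT : w^T = v^T - e^T by rewrite /w linearB.
have ee : e^T *m e = 1%:M.
  by rewrite [LHS]mx11_scalar -trace_mx11 -frob_sq_tr frob_delta expr1n.
have vv : v^T *m v = 1%:M.
  by rewrite [LHS]mx11_scalar -trace_mx11 -frob_sq_tr v1 expr1n.
have we : w^T *m e = (- (frob w ^+ 2) / 2)%:M.
  have c0 : v^T *m e = e^T *m v.
    apply/matrixP => i j; rewrite !ord1 !mxE.
    by apply: eq_bigr => k _; rewrite !mxE mulrC.
  have : (frob w ^+ 2)%:M = 2 *: (1%:M - v^T *m e) :> 'M[R]_1.
    by rewrite -ww wT /w mulmxBl !mulmxBr vv ee c0 scaler_nat mulr2n opprB.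
  move=> E; have -> : w^T *m e = - (1%:M - v^T *m e) by rewrite wT mulmxBl ee opprB.
  apply: (@scalerI _ _ 2) => //; rewrite scalerN -E -scaleN1r.
  by rewrite !scale_scalar_mx; congr (_%:M); field.
rewrite -/e /H mulmxBl mul1mx -scalemxAl -mulmxA we mul_mx_scalar scalerA.
have -> : t * (- frob w ^+ 2 / 2) = -1 by rewrite /t; field.
by rewrite scaleN1r opprK addrC subrK.
Qed.

(** Induction on the size.  Let [v] maximize the norm [c] of [A *m v] on the
    unit sphere and let [u] be the direction of [A *m v].  In orthonormal bases
    starting with [v] and [u] the first column is [c] times the first basis
    vector; a further nonzero entry in the first row would make the norm exceed
    [c].  What remains is a block of norm at most [c], which also gives the
    decreasing order. *)
Lemma svd_exists n (A : 'M[R]_n) : exists U s V, is_svd A U s V.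
Proof.
elim: n A => [|n IH] A.
  exists 1%:M, (fun=> 0), 1%:M; split => //; first by rewrite trmx1 mul1mx.
  by apply/matrixP => -[].
have [v v1 hA] := opn_attained A; set c := frob (A *m v) in hA.
have c0 : 0 <= c := frob_ge0 _.
have [H HH He] := orthogonal_completion v1.
have [u u1 hu] : exists2 u : 'cV[R]_n.+1, frob u = 1 & A *m v = c *: u.
  have [z|z] := eqVneq (A *m v) 0.
    by exists v => //; rewrite /c z frob0 scale0r.
  have z' : c != 0 by rewrite frob_eq0.
  exists (c^-1 *: (A *m v)); last by rewrite scalerA divff // scale1r.
  by rewrite frobZ ger0_norm ?invr_ge0 // mulVf.
have [K KK Ke] := orthogonal_completion u1.
pose B : 'M[R]_(1 + n) := K^T *m A *m H.
have hB : opn B c.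
  have -> : c = 1 * c * 1 by rewrite mul1r mulr1.
  apply: opnM; rewrite ?mul1r //; last exact: opn_isom.
  rewrite -[c]mul1r; apply: opnM => //; apply: opn_tr => //; exact: opn_isom.
have Be : B *m delta_mx 0 0 = c *: (delta_mx 0 0 : 'cV_(1 + n)).
  by rewrite /B -!mulmxA He hu -scalemxAr -Ke mulmxA KK mul1mx.
have AE : A = K *m B *m H^T.
  have KK' := mulmx1C KK; have HH' := mulmx1C HH.
  by rewrite /B !mulmxA KK' mul1mx -mulmxA HH' mulmx1.
clearbody B.
have B00 : B 0 0 = c.
  have /matrixP/(_ 0 0) := Be; rewrite !mxE (bigD1 0) //= big1 => [|i i0].
    by rewrite !mxE !eqxx !mulr1 addr0.
  by rewrite !mxE (negbTE i0) mulr0.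
have Bi0 i : i != 0 -> B i 0 = 0.
  move=> i0; have /matrixP/(_ i 0) := Be; rewrite !mxE (bigD1 0) //= big1 => [|j j0].
    by rewrite !mxE !eqxx (negbTE i0) mulr1 addr0 mulr0.
  by rewrite !mxE (negbTE j0) mulr0.
(* the first row has norm at most [c], and its first entry is already [c] *)
have B0i i : i != 0 -> B 0 i = 0.
  move=> i0; have /= := opn_tr c0 hB (delta_mx 0 0 : 'cV_(1 + n)).
  rewrite frob_delta mulr1 -(@ler_pXn2r _ 2) ?nnegrE // frob_sqE.
  have E k : \sum_(j < 1) (B^T *m delta_mx 0 0 : 'cV[R]__) k j ^+ 2 = B 0 k ^+ 2.
    rewrite big_ord1 mxE (bigD1 0) //= big1 => [|l l0]; last by rewrite !mxE (negbTE l0) mulr0.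
    by rewrite !mxE !eqxx mulr1 addr0.
  under eq_bigr do rewrite E.
  rewrite (bigD1 0) //= B00 gerDl (bigD1 i) //= => h.
  have h2 : 0 <= \sum_(k < n.+1 | (k != 0) && (k != i)) B 0 k ^+ 2.
    by apply: sumr_ge0 => k _; exact: sqr_ge0.
  apply/eqP; rewrite -sqrf_eq0 eq_le sqr_ge0 andbT.
  by apply: le_trans h; rewrite lerDl.
pose B' := drsubmx B.
have BE : B = block_mx c%:M 0 0 B'.
  have l0 : lshift n 0 = 0 :> 'I_(1 + n) by apply: val_inj.
  rewrite -[B]submxK; congr block_mx; apply/matrixP => i j; rewrite !mxE ?ord1 ?l0 /=.
  - by rewrite B00.
  - by rewrite B0i.
  - by rewrite Bi0.
have [U [s [V hs]]] := IH B'.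
have hB' : opn B' c.
  move=> q C; have := hB _ (col_mx 0 C); rewrite BE mul_block_col !mul0mx !mulmx0 !add0r.
  have E m (D : 'M[R]_(m, q)) : frob (col_mx (0 : 'M[R]_(1, q)) D) = frob D.
    apply: eq_frob; rewrite !frob_sqE big_split_ord /= big_ord1.
    rewrite big1 ?add0r => [|j _]; last by rewrite col_mxEu mxE expr0n.
    by apply: eq_bigr => i _; apply: eq_bigr => j _; rewrite col_mxEd.
  by rewrite !E.
have s0c : s 0%N <= c.
  have r0 : (\rank (0%R : 'M[R]_n) <= 0)%N by rewrite mxrank0.
  exact: svd_gap hs (esym (add0r B')) r0 c0 hB'.
have [[hU hV] h0 hd hz hBE] := hs.
have bl m (X : 'M[R]_m) : X^T *m X = 1%:M ->
    (block_mx 1%:M 0 0 X : 'M[R]_(1 + m))^T *m block_mx 1%:M 0 0 X = 1%:M.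
  move=> hX; rewrite tr_block_mx !trmx0 trmx1 mulmx_block !mulmx0 !mul0mx mulmx1.
  by rewrite hX !addr0 add0r -scalar_mx_block.
pose U1 : 'M[R]_(1 + n) := block_mx (1%:M : 'M[R]_1) 0 0 U.
pose V1 : 'M[R]_(1 + n) := block_mx (1%:M : 'M[R]_1) 0 0 V.
exists (K *m (U1 : 'M[R]_n.+1)), (fun i => if i is i'.+1 then s i' else c),
  (H *m (V1 : 'M[R]_n.+1)); split.
- split; rewrite trmx_mul mulmxA -[_ *m _^T *m _]mulmxA.
    by rewrite KK mulmx1 bl.
  by rewrite HH mulmx1 bl.
- by case.
- case=> [|i] [|j] //= ij; last exact: hd.
  by apply: le_trans s0c; exact: hd.
- case=> [|i] /=; first by rewrite minnSS.
  by rewrite minnSS ltnS => /hz.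
rewrite [LHS]AE trmx_mul !mulmxA; congr (_ *m _); rewrite -!mulmxA; congr (_ *m _).
rewrite [LHS]BE [X in block_mx _ _ _ X]hBE.
set S := \matrix_(i < n, j < n) _; set S' := \matrix_(i < n.+1, j < n.+1) _.
have -> : S' = block_mx c%:M 0 0 S :> 'M[R]_(1 + n).
  apply: etrans (esym (submxK (S' : 'M[R]_(1 + n)))) _.
  by congr block_mx; apply/matrixP => i j; rewrite !mxE ?ord1.
suff e : block_mx c%:M 0 0 (U *m S *m V^T) = U1 *m (block_mx c%:M 0 0 S *m V1^T).
  exact: e.
rewrite /U1 /V1 tr_block_mx !trmx0 trmx1 !mulmx_block !mulmx0 !mul0mx.
by rewrite !mulmx1 !mul1mx !addr0 !add0r mulmx0 ?mulmxA.
Qed.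

(** [Qt] maps the last right singular vector of [Q^T *m Qt] to a unit vector
    in the column space of [W]; [Q] loses at most half of it, so by Pythagoras
    the square of the smallest singular value is at least 3/4. *)
Lemma sinTheta_le n m r (W : 'M[R]_(n, m)) (Q Qt : 'M[R]_(n, r)) :
  (0 < r)%N -> (r <= n)%N -> Q^T *m Q = 1%:M -> is_SVDL W Qt -> \rank W = r ->
  (forall k (B : 'M[R]_(m, k)),
    frob ((1%:M - Q *m Q^T) *m (W *m B)) <= 1 / 2 * frob (W *m B)) ->
  sinTheta Q Qt <= 1 / 2.
Proof.
move=> r0 rn hQ hQt rW h; have [C QtE] := SVDL_col hQt rW.
have hQQt := SVDL_isom rn hQt.
have s34 (s : nat -> R) : (exists U V, is_svd (Q^T *m Qt) U s V) -> 3 / 4 <= s r.-1 ^+ 2.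
  move=> [U [V hs]]; have [[hU hV] h0 hd hz hBE] := hs.
  have rr : (r.-1 < r)%N by rewrite prednK.
  pose e : 'cV[R]_r := delta_mx (Ordinal rr) 0.
  have fe : frob e = 1 by exact: frob_delta.
  have fq : frob (Q^T *m (Qt *m (V *m e))) ^+ 2 = s r.-1 ^+ 2.
    have hAV : Q^T *m Qt *m V = U *m (\matrix_(i < r, j < r) (s i *+ (i == j :> nat))).
      by rewrite hBE -!mulmxA hV mulmx1.
    rewrite !mulmxA hAV -mulmxA (frob_isom _ hU) frob_sqE (bigD1 (Ordinal rr)) //=.
    rewrite big_ord1 mxE (bigD1 (Ordinal rr)) //= big1 => [|k k0].
      rewrite !mxE !eqxx mulr1 addr0 mulr1n big1 ?addr0 // => i i0.
      rewrite big_ord1 mxE big1 ?expr0n // => k _; rewrite !mxE.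
      have [->|ki] := eqVneq k (Ordinal rr); last by rewrite mulr0.
      have -> : (i == r.-1 :> nat) = false by exact/negbTE.
      by rewrite mulr0n mul0r.
    by rewrite !mxE (negbTE k0) mulr0.
  have := frob_pyth (Qt *m (V *m e)) hQ.
  rewrite fq (frob_isom _ hQQt) (frob_isom _ hV) fe expr1n.
  have := h _ (C *m (V *m e)); rewrite (mulmxA W) -QtE (frob_isom _ hQQt) (frob_isom _ hV).
  rewrite fe mulr1; set a := frob (_ *m (Qt *m _)) => ha hs1.
  have a0 : 0 <= a := frob_ge0 _.
  have : a ^+ 2 <= 1 / 4 by nra.
  by move: hs1; lra.
have [U [s [V hs]]] := svd_exists (Q^T *m Qt).
rewrite /sinTheta /singval; case: xgetP => [s' _ hs'|/(_ s)]; last first.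
  by case; exists U, V.
have /= h34 := s34 _ hs'.
rewrite -(ger0_norm (_ : 0 <= 1 / 2)) // -sqrtr_sqr ler_wsqrtr //.
by lra.
Qed.
End SVDex.

(** * Kronecker products and unfoldings *)

Section Tens.
Variable R : realType.

Lemma big_mxtens (V : nmodType) m n (F : 'I_(m * n) -> V) :
  \sum_k F k = \sum_(i < m) \sum_(j < n) F (mxtens_index (i, j)).
Proof.
rewrite pair_bigA /= (reindex (@mxtens_index m n)) /=; last first.
  by exists (@mxtens_unindex m n) => x _; [exact: mxtens_indexK|exact: mxtens_unindexK].
by apply: eq_bigr => -[].
Qed.

Lemma tensmx11 m n : 1%:M *t 1%:M = 1%:M :> 'M[R]_(m * n).
Proof.
apply/matrixP => i j; case: (mxtens_indexP i) => i0 i1; case: (mxtens_indexP j) => j0 j1.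
rewrite tensmxE !mxE -natrM mulnb; congr (_ *+ nat_of_bool _).
by rewrite (can_eq (@mxtens_indexK _ _)).
Qed.

Lemma frob_tens1l m n k q (A : 'M[R]_(m, n)) (B : 'M[R]_(k * n, q)) c : 0 <= c ->
  opn A c -> frob ((1%:M *t A) *m B) <= c * frob B.
Proof.
move=> c0 hA; apply: ler_frob => //; rewrite !frob_sqE !big_mxtens mulr_sumr.
apply: ler_sum => i _.
pose Bi := \matrix_(a < n, b < q) B (mxtens_index (i, a)) b.
have -> : \sum_(j < n) \sum_(b < q) B (mxtens_index (i, j)) b ^+ 2 = frob Bi ^+ 2.
  by rewrite frob_sqE; apply: eq_bigr => a _; apply: eq_bigr => b _; rewrite mxE.
have -> : \sum_(j < m) \sum_(b < q) ((1%:M *t A) *m B) (mxtens_index (i, j)) b ^+ 2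
    = frob (A *m Bi) ^+ 2.
  rewrite frob_sqE; apply: eq_bigr => a _; apply: eq_bigr => b _; congr (_ ^+ 2).
  rewrite !mxE big_mxtens (bigD1 i) //= [X in _ + X]big1 ?addr0 => [|l li].
    by apply: eq_bigr => l _; rewrite tensmxE !mxE eqxx mul1r.
  by apply: big1 => h _; rewrite tensmxE mxE eq_sym (negbTE li) mul0r mul0r.
by rewrite -exprMn ler_pXn2r ?nnegrE ?mulr_ge0.
Qed.

Lemma frob_tens1r m n k q (A : 'M[R]_(m, n)) (B : 'M[R]_(n * k, q)) c : 0 <= c ->
  opn A c -> frob ((A *t 1%:M) *m B) <= c * frob B.
Proof.
move=> c0 hA; apply: ler_frob => //; rewrite !frob_sqE !big_mxtens.
rewrite exchange_big [X in _ * X]exchange_big mulr_sumr /=.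
apply: ler_sum => i _.
pose Bi := \matrix_(a < n, b < q) B (mxtens_index (a, i)) b.
have -> : \sum_(j < n) \sum_(b < q) B (mxtens_index (j, i)) b ^+ 2 = frob Bi ^+ 2.
  by rewrite frob_sqE; apply: eq_bigr => a _; apply: eq_bigr => b _; rewrite mxE.
have -> : \sum_(j < m) \sum_(b < q) ((A *t 1%:M) *m B) (mxtens_index (j, i)) b ^+ 2
    = frob (A *m Bi) ^+ 2.
  rewrite frob_sqE; apply: eq_bigr => a _; apply: eq_bigr => b _; congr (_ ^+ 2).
  rewrite !mxE big_mxtens; apply: eq_bigr => l _.
  rewrite (bigD1 i) //= big1 ?addr0 => [|h hi].
    by rewrite tensmxE !mxE eqxx mulr1.
  by rewrite tensmxE mxE eq_sym (negbTE hi) mulr0 mul0r.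
by rewrite -exprMn ler_pXn2r ?nnegrE ?mulr_ge0.
Qed.

Lemma opn_tens1l m n k (A : 'M[R]_(m, n)) c : 0 <= c -> opn A c ->
  opn ((1%:M : 'M[R]_k) *t A) c.
Proof. by move=> c0 hA q B; exact: frob_tens1l. Qed.

Lemma opn_tens1r m n k (A : 'M[R]_(m, n)) c : 0 <= c -> opn A c ->
  opn (A *t (1%:M : 'M[R]_k)) c.
Proof. by move=> c0 hA q B; exact: frob_tens1r. Qed.

Lemma const1_isom m n : m = 1%N -> n = 1%N ->
  (const_mx 1 : 'M[R]_(m, n))^T *m (const_mx 1 : 'M[R]_(m, n)) = 1%:M.
Proof. by move=> -> ->; apply/matrixP => i j; rewrite !mxE big_ord1 !mxE mul1r !ord1. Qed.

(** A column-major index determines the row and the column, so that the sum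
    in the definition has the single term [A i j]. *)
Lemma mx_reshapeE m n m' n' (A : 'M[R]_(m, n)) (a : 'I_m') (b : 'I_n') (i : 'I_m) (j : 'I_n) :
  (i + j * m = a + b * m')%N -> mx_reshape m' n' A a b = A i j.
Proof.
move=> h; rewrite mxE (bigD1 i) //= (bigD1 j) ?h //=.
have U (i' : 'I_m) (j' : 'I_n) : (i' + j' * m == a + b * m')%N -> i' = i /\ j' = j.
  rewrite -h => /eqP e; have m0 : (0 < m)%N by exact: leq_ltn_trans (leq0n i) (ltn_ord i).
  have := congr1 (modn^~ m) e; rewrite ![(_ + _ * m)%N]addnC !modnMDl !modn_small // => ii.
  split; first exact: val_inj.
  have := congr1 (divn^~ m) e; rewrite /= ![(_ + _ * m)%N]addnC !divnMDl // !divn_small //.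
  by rewrite !addn0 => jj; exact: val_inj.
rewrite big1 ?addr0 => [|j' /andP[/U[_ ->]]]; last by rewrite eqxx.
by rewrite big1 ?addr0 // => i' i'i; apply: big1 => j' /U[e _]; rewrite e eqxx in i'i.
Qed.
End Tens.

Section Unfold.
Variables (R : realType) (d : nat) (p : nat -> nat).
Local Notation mindex := (mindex d p).
Implicit Types (X : tensor R d p) (i : mindex).

Lemma pLE k : pL p k = (\prod_(1 <= l < k.+1) p l)%N.
Proof.
elim: k => [|k IH]; first by rewrite big_geq.
by rewrite big_nat_recr //= -IH mulnC.
Qed.

Lemma prodRE k n : prodR p k n = (\prod_(k <= l < k + n) p l)%N.
Proof.
elim: n k => [|n IH] k; first by rewrite addn0 big_geq.
by rewrite /= IH addSnnS mulnC [RHS]big_ltn // -addSnnS leq_addr.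
Qed.

Lemma row_codeS k (hk : (k < d)%N) i :
  row_code k.+1 i = (i (Ordinal hk) * pL p k + row_code k i)%N.
Proof.
rewrite /row_code (bigD1 (Ordinal hk)) //= -pLE; congr (_ + _)%N.
apply: eq_bigl => j; rewrite ltnS -val_eqE /= andbC.
by rewrite ltn_neqAle.
Qed.

Lemma row_code_lt k i : (k <= d)%N -> (row_code k i < pL p k)%N.
Proof.
elim: k => [|k IH] hk; first by rewrite /row_code big1.
have h : (i (Ordinal hk) < p k.+1)%N := ltn_ord _.
rewrite (row_codeS hk) /=; apply: (@leq_trans ((i (Ordinal hk)).+1 * pL p k)); last first.
  by rewrite leq_mul2r h orbT.
by rewrite mulSn addnC ltn_add2r; exact/IH/ltnW.
Qed.

Lemma col_codeS k (hk : (k < d)%N) i :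
  col_code k i = (col_code k.+1 i * p k.+1 + i (Ordinal hk))%N.
Proof.
rewrite /col_code (bigD1 (Ordinal hk)) //= big_geq // muln1 addnC big_distrl /=.
congr (_ + _)%N; apply: eq_big => [j|j /andP[kj nj]].
  by rewrite -val_eqE /= andbC ltn_neqAle eq_sym.
have kj' : (k < j)%N by rewrite ltn_neqAle kj andbT eq_sym.
by rewrite big_ltn //= -mulnA; congr (_ * _)%N; rewrite mulnC.
Qed.

Lemma col_code_lt k i : (k <= d)%N -> (col_code k i < prodR p k.+1 (d - k))%N.
Proof.
move En : (d - k)%N => n; elim: n k En => [|n IH] k En kd.
  have -> : k = d by apply/eqP; rewrite eqn_leq kd -subn_eq0 En.
  by rewrite /col_code big1 // => j; rewrite leqNgt ltn_ord.
have hk : (k < d)%N by rewrite -subn_gt0 En.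
have h : (i (Ordinal hk) < p k.+1)%N := ltn_ord _.
have h2 : (col_code k.+1 i < prodR p k.+2 n)%N by apply: IH; rewrite // subnS En.
rewrite (col_codeS hk) /=.
apply: (@leq_trans ((col_code k.+1 i).+1 * p k.+1)); last by rewrite leq_mul2r h2 orbT.
by rewrite mulSn addnC ltn_add2r.
Qed.

(** Entries are addressed by natural numbers, so that unfoldings at different
    modes can be compared without casts. *)
Definition entry X k (a b : nat) : R :=
  \sum_(i : mindex | (row_code k i == a) && (col_code k i == b)) X i.

(** For [n = d - k] this is the k-th unfolding.  A separate [n] can be replaced
    by a successor, which splits the first of the remaining modes off the
    column index. *)
Definition unf X k n : 'M[R]_(pL p k, prodR p k.+1 n) := \matrix_(a, b) entry X k a b.

Lemma unfoldingE X k : unfolding X k = unf X k (d - k).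
Proof. by apply/matrixP => a b; rewrite !mxE. Qed.

Lemma euclid_eq q a a' j j' : (a < q)%N -> (a' < q)%N ->
  (j * q + a == j' * q + a')%N = (j == j') && (a == a').
Proof.
move=> h h'; apply/eqP/andP => [e|[/eqP-> /eqP->]] //.
have q0 : (0 < q)%N by apply: leq_trans h.
have := congr1 (modn^~ q) e; have := congr1 (divn^~ q) e; rewrite /=.
by rewrite !modnMDl !modn_small // !divnMDl // !divn_small // !addn0 => -> ->.
Qed.

(** Mode k + 1 is the lowest digit of the column code for [k] and the highest
    digit of the row code for [k.+1]. *)
Lemma entry_shift X k a b j : (k < d)%N -> (a < pL p k)%N -> (j < p k.+1)%N ->
  entry X k.+1 (j * pL p k + a) b = entry X k a (b * p k.+1 + j).
Proof.
move=> hk ha hj; apply: eq_bigl => i.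
rewrite (row_codeS hk) (col_codeS hk) !euclid_eq //; last exact/row_code_lt/ltnW.
by case: (_ == j); case: (_ == a); case: (_ == b).
Qed.

Section Shift.
Variables (X : tensor R d p) (k : nat) (hk : (k < d)%N) (n : nat).

Lemma unf_shift (j : 'I_(p k.+1)) (a : 'I_(pL p k)) (b : 'I_(prodR p k.+2 n)) :
  unf X k.+1 n (mxtens_index (j, a)) b = unf X k n.+1 a (mxtens_index (b, j)).
Proof. by rewrite !mxE /= entry_shift. Qed.

Lemma unf_shift_mul m q (L : 'M[R]_(m, pL p k)) (B : 'M[R]_(prodR p k.+2 n, q))
    (a : 'I_m) (j : 'I_(p k.+1)) (b : 'I_q) :
  (L *m unf X k n.+1 *m (B *t 1%:M)) a (mxtens_index (b, j)) =
  ((1%:M *t L) *m unf X k.+1 n *m B) (mxtens_index (j, a)) b.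
Proof.
rewrite mxE big_mxtens [RHS]mxE; apply: eq_bigr => c _.
rewrite (bigD1 j) //= big1 ?addr0 => [|j' jj']; last first.
  by rewrite tensmxE [1%:M _ _]mxE (negbTE jj') !mulr0.
rewrite tensmxE [1%:M _ _]mxE eqxx mulr1; congr (_ * _).
rewrite mxE [RHS]mxE big_mxtens (bigD1 j) //= [X in _ + X]big1 ?addr0 => [|j' jj'].
  by apply: eq_bigr => l _; rewrite tensmxE [1%:M _ _]mxE eqxx mul1r unf_shift.
by apply: big1 => l _; rewrite tensmxE [1%:M _ _]mxE eq_sym (negbTE jj') !mul0r.
Qed.

(** This identity carries norm bounds from one unfolding to the next: up to
    the order of the entries, compressing the k-th unfolding by [L] and
    [B *t 1%:M] is the same as compressing the next one by [1%:M *t L] and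
    [B]. *)
Lemma frob_shift m q (L : 'M[R]_(m, pL p k)) (B : 'M[R]_(prodR p k.+2 n, q)) :
  frob (L *m unf X k n.+1 *m (B *t 1%:M)) = frob ((1%:M *t L) *m unf X k.+1 n *m B).
Proof.
apply: eq_frob; rewrite !frob_sqE [RHS]big_mxtens [RHS]exchange_big /=.
apply: eq_bigr => a _; rewrite [LHS]big_mxtens [LHS]exchange_big /=; apply: eq_bigr => j _.
by apply: eq_bigr => b _; rewrite unf_shift_mul.
Qed.

Lemma reshape_shift m (L : 'M[R]_(m, pL p k)) :
  mx_reshape (p k.+1 * m) (prodR p k.+2 n) (L *m unf X k n.+1) = (1%:M *t L) *m unf X k.+1 n.
Proof.
apply/matrixP => a b; case: (mxtens_indexP a) => j c.
rewrite (@mx_reshapeE _ _ _ _ _ _ _ _ c (mxtens_index (b, j))); last first.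
  by rewrite /= mulnDl mulnA [(b * _ * _ + _)%N]addnC addnA [(c + _)%N]addnC.
have := @unf_shift_mul _ _ L 1%:M c j b.
by rewrite tensmx11 !mulmx1.
Qed.
End Shift.
End Unfold.

(** * Linear forms in a tensor and tensor-train rank *)

Section Codes.
Variables (R : realType) (d : nat) (p : nat -> nat).
Local Notation mindex := (mindex d p).
Implicit Types (X Z : tensor R d p) (i : mindex).

Lemma row_code_eq k i i' : (forall j : 'I_d, (j < k)%N -> i j = i' j) ->
  row_code k i = row_code k i'.
Proof. by move=> h; apply: eq_bigr => j jk; rewrite h. Qed.

Lemma col_code_eq k i i' : (forall j : 'I_d, (k <= j)%N -> i j = i' j) ->
  col_code k i = col_code k i'.
Proof. by move=> h; apply: eq_bigr => j jk; rewrite h. Qed.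

Lemma row_code_inj k i i' : (k <= d)%N -> row_code k i = row_code k i' ->
  forall j : 'I_d, (j < k)%N -> i j = i' j.
Proof.
elim: k => // k IH hk; rewrite !(row_codeS hk) => /eqP.
rewrite euclid_eq; try exact/row_code_lt/ltnW.
case/andP=> /eqP e1 /eqP e2 j; rewrite ltnS leq_eqVlt => /orP[/eqP e|]; last first.
  by apply: IH => //; exact: ltnW.
have -> : j = Ordinal hk by exact: val_inj.
exact: val_inj.
Qed.

Lemma col_code_inj k i i' : (k <= d)%N -> col_code k i = col_code k i' ->
  forall j : 'I_d, (k <= j)%N -> i j = i' j.
Proof.
move En : (d - k)%N => n; elim: n k En => [|n IH] k En kd.
  have -> : k = d by apply/eqP; rewrite eqn_leq kd -subn_eq0 En.
  by move=> _ j; rewrite leqNgt ltn_ord.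
have hk : (k < d)%N by rewrite -subn_gt0 En.
rewrite !(col_codeS hk) => /eqP.
have l (i0 : mindex) : (i0 (Ordinal hk) < p k.+1)%N by exact: ltn_ord.
rewrite euclid_eq //.
case/andP=> /eqP e1 /eqP e2 j; rewrite leq_eqVlt => /orP[/eqP e|]; last first.
  by apply: IH => //; rewrite subnS En.
have -> : j = Ordinal hk by exact: val_inj.
exact: val_inj.
Qed.

Lemma code_inj k i i' : (k <= d)%N -> row_code k i = row_code k i' ->
  col_code k i = col_code k i' -> i = i'.
Proof.
move=> kd hr hc; apply/ffunP => j; case: (ltnP j k) => jk.
  exact: row_code_inj hr _ jk.
exact: col_code_inj hc _ jk.
Qed.

Section Coef.
Variables (k : nat) (kd : (k <= d)%N).
Implicit Type T : 'M[R]_(pL p k, pR d p k.+1).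

Definition coef T i : R := T (Ordinal (row_code_lt i kd)) (Ordinal (col_code_lt i kd)).

Lemma coef_sum (f : R -> mindex -> R) T :
  \sum_(a < pL p k) \sum_(b < pR d p k.+1)
    \sum_(i : mindex | (row_code k i == a) && (col_code k i == b))
    f (T a b) i =
  \sum_i f (coef T i) i.
Proof.
under eq_bigr do rewrite (exchange_big_dep xpredT) //=.
rewrite (exchange_big_dep xpredT) //=; apply: eq_bigr => i _.
rewrite (bigD1 (Ordinal (row_code_lt i kd))) //=.
rewrite (big_pred1 (Ordinal (col_code_lt i kd))) => [|b]; last first.
  by rewrite /= eqxx /= eq_sym -val_eqE.
rewrite big1 ?addr0 // => a ha; rewrite big_pred0 // => b.
have -> : (row_code k i == a) = false; last by [].
by rewrite eq_sym; apply/negbTE; move: ha; rewrite -val_eqE.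
Qed.

Lemma trace_unfolding T Z :
  \tr (T^T *m unfolding Z k) = \sum_i coef T i * Z i.
Proof.
rewrite -(coef_sum (fun t i => t * Z i)) [RHS]exchange_big; apply: eq_bigr => b _.
by rewrite mxE; apply: eq_bigr => a _; rewrite !mxE mulr_sumr.
Qed.

(** Different multi-indices read different entries of [T]. *)
Lemma coef_sq T : \sum_i coef T i ^+ 2 <= frob T ^+ 2.
Proof.
rewrite -(coef_sum (fun t i => t ^+ 2)) frob_sqE; apply: ler_sum => a _.
apply: ler_sum => b _.
have [i /andP[/eqP ia /eqP ib]|no] :=
  pickP (fun i : mindex => (row_code k i == a) && (col_code k i == b)).
  rewrite (big_pred1 i) // => i' /=; apply/idP/eqP => [/andP[/eqP e1 /eqP e2]|->].
    by apply: (code_inj kd); rewrite ?e1 ?e2.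
  by rewrite ia ib !eqxx.
by rewrite big_pred0 // sqr_ge0.
Qed.
End Coef.

Lemma unfoldingD X Z k : unfolding (fun i => X i + Z i) k = unfolding X k + unfolding Z k.
Proof. by apply/matrixP => a b; rewrite !mxE big_split. Qed.

(** The multi-indices with value [c] at [k] are in bijection with pairs
    consisting of their restrictions to the positions up to [k] and from [k]
    on; [a0] fills the positions that a restriction leaves open. *)
Lemma sum_dffun_split n (r : nat -> nat) (k : 'I_n) (c : 'I_(r k))
    (f h : {dffun forall j : 'I_n, 'I_(r j)} -> R) :
  (forall a b : {dffun forall j : 'I_n, 'I_(r j)},
    (forall j : 'I_n, (j <= k)%N -> a j = b j) -> f a = f b) ->
  (forall a b : {dffun forall j : 'I_n, 'I_(r j)},
    (forall j : 'I_n, (k <= j)%N -> a j = b j) -> h a = h b) ->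
  forall a0 : {dffun forall j : 'I_n, 'I_(r j)}, a0 k = c ->
  \sum_(a : {dffun forall j : 'I_n, 'I_(r j)} | a k == c) f a * h a =
  (\sum_(a : {dffun forall j : 'I_n, 'I_(r j)} |
    (a k == c) && [forall j : 'I_n, (k < j)%N ==> (a j == a0 j)]) f a) *
  (\sum_(a : {dffun forall j : 'I_n, 'I_(r j)} |
    (a k == c) && [forall j : 'I_n, (j < k)%N ==> (a j == a0 j)]) h a).
Proof.
move=> hf hh a0 a0c.
pose mrg (a b : {dffun forall j : 'I_n, 'I_(r j)}) : {dffun forall j : 'I_n, 'I_(r j)} :=
  finfun (fun j : 'I_n => if (j <= k)%N then a j else b j).
have mrgE a b j : mrg a b j = if (j <= k)%N then a j else b j by rewrite ffunE.
(* [mrg] and [mrg2] differ at position [k] only, where all indices have value [c] *)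
pose mrg2 (a b : {dffun forall j : 'I_n, 'I_(r j)}) : {dffun forall j : 'I_n, 'I_(r j)} :=
  finfun (fun j : 'I_n => if (j < k)%N then a j else b j).
have mrg2E a b j : mrg2 a b j = if (j < k)%N then a j else b j by rewrite ffunE.
rewrite big_distrlr /= pair_big /=.
rewrite (reindex_onto (fun a => (mrg a a0, mrg2 a0 a)) (fun ab => mrg ab.1 ab.2)) /=.
  apply: eq_big => [a|a _].
    rewrite mrgE mrg2E leqnn ltnn; apply/idP/idP => [/eqP ac|/andP[/andP[/andP[-> //]]]].
    rewrite ac eqxx /=; apply/andP; split; first (apply/andP; split).
    - by apply/forallP => j; apply/implyP => kj; rewrite mrgE leqNgt kj.
    - by apply/forallP => j; apply/implyP => kj; rewrite mrg2E kj.
    by apply/eqP/ffunP => j; rewrite !mrgE mrg2E; case: (ltngtP j k).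
  congr (_ * _); first by apply: hf => j jk; rewrite mrgE jk.
  by apply: hh => j jk; rewrite mrg2E ltnNge jk.
move=> [a b] /= /andP[/andP[/eqP ac /forallP ha] /andP[/eqP bc /forallP hb]].
congr (_, _); apply/ffunP => j.
  rewrite !mrgE; case: leqP => // kj.
  by have /implyP/(_ kj)/eqP -> := ha j.
rewrite mrg2E mrgE; case: (ltngtP j k) => [jk|//|jk].
  by have /implyP/(_ jk)/eqP -> := hb j.
have jk' : j = k by exact: val_inj.
by move: jk; rewrite jk' ac bc.
Qed.

(** For a fixed value of the k-th bond index, the tensor-train sum is a product
    of a function of the first [k] positions and a function of the others; so
    the unfolding factors through a space of dimension [r k]. *)
Lemma rank_unfolding (r : nat -> nat) X k : has_TT r X -> (k <= d)%N ->
  (\rank (unfolding X k) <= r k)%N.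
Proof.
move=> [G hG] kd; have kd1 : (k < d.+1)%N by [].
pose kk : 'I_d.+1 := Ordinal kd1.
pose D := {dffun forall j : 'I_d.+1, 'I_(r j)}.
pose g (i : mindex) (a : D) (j : 'I_d) := G j (a (widen_ord (leqnSn d) j)) (i j) (a (lift ord0 j)).
pose f i a := \prod_(j < d | (j < k)%N) g i a j.
pose h i a := \prod_(j < d | ~~ (j < k)%N) g i a j.
have XE i : X i = \sum_(c < r k) \sum_(a : D | a kk == c) f i a * h i a.
  rewrite hG (partition_big (fun a : D => a kk) xpredT) //=.
  apply: eq_bigr => c _; apply: eq_bigr => a _.
  by rewrite (bigID (fun j : 'I_d => (j < k)%N)).
have [F [H [FH [hF hH]]]] : exists F H : mindex -> 'I_(r k) -> R,
    (forall i c, \sum_(a : D | a kk == c) f i a * h i a = F i c * H i c) /\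
    (forall i i', (forall j : 'I_d, (j < k)%N -> i j = i' j) -> F i =1 F i') /\
    (forall i i', (forall j : 'I_d, (k <= j)%N -> i j = i' j) -> H i =1 H i').
  pose a0 (c : 'I_(r k)) : option D := [pick a : D | a kk == c].
  exists (fun i c => if a0 c is Some a0 then
     \sum_(a : D | (a kk == c) && [forall j : 'I_d.+1, (kk < j)%N ==> (a j == a0 j)]) f i a else 0).
  exists (fun i c => if a0 c is Some a0 then
     \sum_(a : D | (a kk == c) && [forall j : 'I_d.+1, (j < kk)%N ==> (a j == a0 j)]) h i a else 0).
  split.
    move=> i c; rewrite /a0; case: pickP => [a /eqP ac|no]; last first.
      by rewrite big_pred0 // mul0r.
    apply: sum_dffun_split => // {ac}a b hab.
      apply: eq_bigr => j jk; rewrite /g (hab (widen_ord _ _)) ?(hab (lift _ _)) //=.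
      exact: ltnW.
    apply: eq_bigr => j; rewrite -leqNgt => jk.
    rewrite /g (hab (widen_ord _ _)) ?(hab (lift _ _)) //=.
    exact: leqW.
  split=> i i' ii c; case: (a0 c) => // a; apply: eq_bigr => b _; apply: eq_bigr => j jk.
    by rewrite /g ii.
  by rewrite /g ii // leqNgt.
(* a row code that no multi-index has gets the value 0 *)
pose A := \matrix_(a < pL p k, c < r k)
  (if [pick i : mindex | row_code k i == a] is Some i then F i c else 0).
pose B := \matrix_(c < r k, b < pR d p k.+1)
  (if [pick i : mindex | col_code k i == b] is Some i then H i c else 0).
have -> : unfolding X k = A *m B; last first.
  exact: leq_trans (mxrankM_maxl A B) (rank_leq_col A).
apply/matrixP => a b; rewrite !mxE; under [RHS]eq_bigr do rewrite !mxE.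
case: pickP => [i1 /eqP h1|no]; last first.
  rewrite [LHS]big_pred0 => [|i]; last by rewrite no.
  by rewrite big1 // => c _; rewrite mul0r.
case: pickP => [i2 /eqP h2|no]; last first.
  rewrite [LHS]big_pred0 => [|i]; last by rewrite no andbF.
  by rewrite big1 // => c _; rewrite mulr0.
pose i : mindex := finfun (fun j : 'I_d => if (j < k)%N then i1 j else i2 j).
have iE j : i j = if (j < k)%N then i1 j else i2 j by rewrite ffunE.
have ii1 (j : 'I_d) : (j < k)%N -> i j = i1 j by rewrite iE => ->.
have ii2 (j : 'I_d) : (k <= j)%N -> i j = i2 j by rewrite iE ltnNge => ->.
rewrite [LHS](big_pred1 i) => [|i'].
  by rewrite XE; apply: eq_bigr => c _; rewrite FH (hF _ _ ii1) (hH _ _ ii2).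
rewrite /= -h1 -h2 -(row_code_eq ii1) -(col_code_eq ii2).
apply/idP/eqP => [/andP[/eqP e1 /eqP e2]|->]; last by rewrite !eqxx.
exact: code_inj kd e1 e2.
Qed.
End Codes.

(** * One step of the iteration *)

Section Deterministic.
Variables (R : realType) (d : nat) (p r : nat -> nat).
Hypothesis hr0 : r 0%N = 1%N.
Hypothesis hrd : r d = 1%N.

Lemma IkronLS (U : left_family R p r) k : IkronL U k.+1 = 1%:M *t (Lprod U k)^T.
Proof. by []. Qed.

Lemma Lprod_IkronL (U : left_family R p r) k :
  (Lprod U k.+1)^T = (U k.+1)^T *m IkronL U k.+1.
Proof. by rewrite /= trmx_mul trmx_tens trmx1. Qed.

Lemma Rprod_RkronI (V : right_family R p r) k : (k < d)%N ->
  Rprod d V k.+1 = RkronI d V k.+1 *m V k.+1.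
Proof.
move=> kd; rewrite /Rprod /RkronI /pR.
suff G N : (0 < N)%N -> Rprod_rec V k.+1 N = RkronI_rec V k.+1 N *m V k.+1.
  by apply: G; rewrite subSS subn_gt0.
by case: N.
Qed.

Lemma frob_RkronI (X : tensor R d p) (V : right_family R p r) k m
    (C : 'M[R]_(m, pL p k)) : (k < d)%N ->
  frob (C *m unfolding X k *m RkronI d V k.+1) =
  frob ((1%:M *t C) *m unfolding X k.+1 *m Rprod d V k.+2).
Proof.
move=> kd; rewrite !unfoldingE.
suff G N n : N = n.+1 -> frob (C *m unf X k N *m RkronI_rec V k.+1 N) =
    frob ((1%:M *t C) *m unf X k.+1 n *m Rprod_rec V k.+2 n).
  by apply: G; rewrite subnSK.
by move=> ->; exact: frob_shift.
Qed.

Lemma frob_unfolding_succ (X : tensor R d p) k m (C : 'M[R]_(m, pL p k)) : (k < d)%N ->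
  frob ((1%:M *t C) *m unfolding X k.+1) = frob (C *m unfolding X k).
Proof.
move=> kd; rewrite !unfoldingE.
suff G N n : N = n.+1 -> frob ((1%:M *t C) *m unf X k.+1 n) = frob (C *m unf X k N).
  by apply: G; rewrite subnSK.
move=> ->; rewrite -[in LHS](mulmx1 (_ *m unf X k.+1 n)) -(frob_shift X kd).
by rewrite tensmx11 mulmx1.
Qed.

Section Lower.
Variable X : tensor R d p.

(** The number of remaining modes is a variable [n], because the step from [k]
    to [k.+1] applies the property to a matrix of the form [B *t 1%:M], whose
    number of rows has to be a product. *)
Definition left_lower (U : left_family R p r) k (c : R) : Prop :=
  forall n, (d - k)%N = n -> forall q (B : 'M[R]_(prodR p k.+1 n, q)),
  c * frob (unf X k n *m B) <= frob ((Lprod U k)^T *m unf X k n *m B).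

Definition right_lower (V : right_family R p r) k (c : R) : Prop :=
  forall m (C : 'M[R]_(m, pL p k)),
  c * frob (C *m unfolding X k) <= frob (C *m unfolding X k *m Rprod d V k.+1).

Lemma left_lower0 U : left_lower U 0 1.
Proof.
move=> n _ q B; rewrite mul1r -mulmxA.
have h : ((const_mx 1 : 'M[R]_(1, r 0))^T)^T *m (const_mx 1 : 'M[R]_(1, r 0))^T = 1%:M.
  by rewrite trmx_const; apply: const1_isom.
by rewrite (frob_isom _ h).
Qed.

Lemma frob_Rprod_last (V : right_family R p r) m (C : 'M[R]_(m, _)) :
  frob (C *m Rprod d V d.+1) = frob C.
Proof.
rewrite /Rprod -(frob_tr (_ *m Rprod_rec _ _ _)) trmx_mul.
rewrite (@frob_isom _ _ _ _ (Rprod_rec V d.+1 (d.+1 - d.+1))^T) ?frob_tr //.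
suff G N : N = 0%N -> ((Rprod_rec V d.+1 N)^T)^T *m (Rprod_rec V d.+1 N)^T = 1%:M.
  by apply: G; rewrite subnn.
by move=> -> /=; rewrite trmx_const; apply: const1_isom.
Qed.

Lemma right_lower_last V : right_lower V d 1.
Proof. by move=> m C; rewrite mul1r frob_Rprod_last. Qed.

Lemma frob_IkronL1 (U : left_family R p r) q (B : 'M[R]_(_, q)) :
  frob (IkronL U 1 *m B) = frob B.
Proof.
apply: frob_isom; rewrite IkronLS trmx_tens trmxK trmx1 tensmx_mul mul1mx.
by rewrite /= trmx_const -[X in _ *t (X *m _)]trmx_const const1_isom ?tensmx11.
Qed.

Lemma IkronL_lower U k c : (k < d)%N -> left_lower U k c ->
  forall q (B : 'M[R]_(_, q)),
  c * frob (unfolding X k.+1 *m B) <= frob (IkronL U k.+1 *m unfolding X k.+1 *m B).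
Proof.
move=> kd h q; rewrite unfoldingE => B; rewrite IkronLS.
have e : (d - k)%N = (d - k.+1).+1 by rewrite subnSK.
have := h _ e _ (B *t 1%:M).
have -> : frob (unf X k (d - k.+1).+1 *m (B *t 1%:M)) = frob (unf X k.+1 (d - k.+1) *m B).
  by rewrite -[unf X k _]mul1mx (frob_shift X kd) tensmx11 mul1mx.
by rewrite (frob_shift X kd).
Qed.

Lemma RkronI_lower V k c : (k < d)%N -> right_lower V k.+1 c ->
  forall m (C : 'M[R]_(m, _)),
  c * frob (C *m unfolding X k) <= frob (C *m unfolding X k *m RkronI d V k.+1).
Proof.
by move=> kd h m C; rewrite frob_RkronI // -frob_unfolding_succ //; exact: h.
Qed.

(** Every vector in the column space of the compressed signal makes an angle
    with the computed subspace whose sine is at most 1/2.  This is the conclusion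
    of [svd_perturb]; [sinTheta_le] and [proj_lower] both start from it. *)
Definition left_close (U : left_family R p r) k : Prop :=
  forall q (B : 'M[R]_(_, q)),
  frob ((1%:M - U k *m (U k)^T) *m (IkronL U k *m unfolding X k *m B)) <=
  1 / 2 * frob (IkronL U k *m unfolding X k *m B).

Definition right_close (V : right_family R p r) k : Prop :=
  forall q (B : 'M[R]_(_, q)),
  frob ((1%:M - V k.+1 *m (V k.+1)^T) *m ((unfolding X k *m RkronI d V k.+1)^T *m B)) <=
  1 / 2 * frob ((unfolding X k *m RkronI d V k.+1)^T *m B).

Lemma left_lowerS U k c : (k < d)%N -> 0 <= c -> (U k.+1)^T *m U k.+1 = 1%:M ->
  left_lower U k c -> left_close U k.+1 -> left_lower U k.+1 (1 / 2 * c).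
Proof.
move=> kd c0 hU hL hC n <- q B; rewrite -unfoldingE Lprod_IkronL -!mulmxA.
have := hC _ B; rewrite -[IkronL U k.+1 *m _ *m B]mulmxA => h.
rewrite (mulmxA (IkronL U k.+1)) in h *.
apply: le_trans (proj_lower hU h); rewrite -(mulrA _ c) ler_wpM2l //.
exact: IkronL_lower.
Qed.

Lemma right_lowerS V k c : (k < d)%N -> 0 <= c -> (V k.+1)^T *m V k.+1 = 1%:M ->
  right_lower V k.+1 c -> right_close V k -> right_lower V k (1 / 2 * c).
Proof.
move=> kd c0 hV hR hC m C; rewrite Rprod_RkronI //.
have := proj_lower hV (hC _ C^T) => h.
have e1 : C *m unfolding X k *m (RkronI d V k.+1 *m V k.+1) =
    ((V k.+1)^T *m ((unfolding X k *m RkronI d V k.+1)^T *m C^T))^T.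
  by rewrite !trmx_mul !trmxK !mulmxA.
have e2 : (unfolding X k *m RkronI d V k.+1)^T *m C^T =
    (C *m unfolding X k *m RkronI d V k.+1)^T.
  by rewrite -(mulmxA C) [RHS]trmx_mul.
rewrite e1 frob_tr; apply: le_trans h; rewrite e2 frob_tr.
by rewrite -(mulrA _ c) ler_wpM2l //; exact: RkronI_lower.
Qed.

(** [svd_perturb] for the compressed unfolding of the signal: its nonzero
    singular values are at least [c0 * lam], since the compression by the
    earlier factors keeps the fraction [c0] ([IkronL_lower]). *)
Lemma left_step U k c0 lam q (M : 'M[R]_(_, q)) N delta c :
  (k < d)%N -> 0 < c0 -> 0 < lam -> 0 < c -> 0 <= delta ->
  (r k.+1 <= p k.+1 * r k)%N ->
  left_lower U k c0 -> bounded_below (unfolding X k.+1) lam ->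
  (\rank (unfolding X k.+1) <= r k.+1)%N ->
  (forall m (C : 'M[R]_(m, _)),
     c * frob (C *m unfolding X k.+1) <= frob (C *m unfolding X k.+1 *m M)) ->
  is_SVDL (IkronL U k.+1 *m unfolding X k.+1 *m M + N) (U k.+1) ->
  opn N delta -> 4 * delta <= c * (c0 * lam) -> left_close U k.+1.
Proof.
move=> kd c00 lam0 cp d0 rk hL hX rX hM hS hN hgap q' B.
rewrite -[IkronL U k.+1 *m unfolding X k.+1 *m B]mulmxA (mulmxA (IkronL U k.+1)).
apply: (svd_perturb cp _ d0 rk hS _ hN _ _ hgap).
- exact: mulr_gt0.
- apply: leq_trans (mxrankM_maxl _ _) _; apply: leq_trans (mxrankM_maxr _ _) rX.
- by move=> m C; rewrite mulmxA; exact: hM.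
move=> l D; have [D1 [E hD]] := hX _ D; exists D1; split; first by rewrite -!mulmxA E.
rewrite -mulrA; apply: le_trans (IkronL_lower kd hL D).
by rewrite ler_wpM2l // ltW.
Qed.

Lemma right_step V k c0 lam q (M : 'M[R]_(_, q)) N delta c :
  (k < d)%N -> 0 < c0 -> 0 < lam -> 0 < c -> 0 <= delta ->
  (r k <= r k.+1 * p k.+1)%N ->
  right_lower V k.+1 c0 -> bounded_below (unfolding X k)^T lam ->
  (\rank (unfolding X k) <= r k)%N ->
  (forall q' (B : 'M[R]_(_, q')),
     c * frob (unfolding X k *m B) <= frob (M^T *m (unfolding X k *m B))) ->
  is_SVDR (M^T *m unfolding X k *m RkronI d V k.+1 + N) (V k.+1) ->
  opn N delta -> 4 * delta <= c * (c0 * lam) -> right_close V k.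
Proof.
move=> kd c00 lam0 cp d0 rk hR hX rX hM /is_SVDL_tr hS hN hgap q' B.
set W := (unfolding X k *m RkronI d V k.+1)^T.
have e : (M^T *m unfolding X k *m RkronI d V k.+1 + N)^T = W *m M + N^T.
  by rewrite linearD /= /W !trmx_mul trmxK mulmxA.
rewrite e in hS.
have hNt := opn_tr d0 hN.
apply: (svd_perturb cp _ d0 rk hS _ hNt _ _ hgap).
- exact: mulr_gt0.
- apply: leq_trans (mxrankM_maxl _ _) _; rewrite mxrank_tr.
  exact: leq_trans (mxrankM_maxl _ _) rX.
- move=> m C; have := hM _ (RkronI d V k.+1 *m C^T).
  rewrite -(frob_tr (C *m W)) -(frob_tr (C *m W *m M)) !trmx_mul trmxK.
  by rewrite (mulmxA (unfolding X k)).
move=> l D; have [D1 [E hD]] := hX _ D; exists D1.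
have WE : W = (RkronI d V k.+1)^T *m (unfolding X k)^T by rewrite /W trmx_mul.
split; first by rewrite WE -!mulmxA E.
rewrite -mulrA; apply: (@le_trans _ _ (c0 * frob ((unfolding X k)^T *m D))).
  by rewrite ler_wpM2l // ltW.
have := RkronI_lower kd hR D^T.
by rewrite -frob_tr trmx_mul trmxK -(frob_tr (_ *m RkronI _ _ _)) -mulmxA trmx_mul trmxK.
Qed.

End Lower.

(** The default value of [singval] is 0; a positive value therefore comes from
    a decomposition with at least [k] positive singular values. *)
Lemma singval_bounded_below m n k (A : 'M[R]_(m, n)) mu :
  (0 < k)%N -> 0 < mu -> mu <= singval A k -> (\rank A <= k)%N ->
  [/\ bounded_below A mu, bounded_below A^T mu & \rank A = k].
Proof.
move=> k0 mu0; rewrite /singval; case: xgetP => [s -> [U [V hs]] hmu rA|_]; last first.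
  by rewrite leNgt mu0.
have kmn : (k <= minn m n)%N.
  rewrite leqNgt; apply/negP; rewrite -{1}(prednK k0) ltnS.
  by case: hs => _ _ _ hz _ /hz e; move: hmu; rewrite e leNgt mu0.
move: kmn; rewrite leq_min => /andP[km kn].
have [hb ->] := svd_bounded_below hs k0 km kn mu0 hmu rA.
have rAt : (\rank A^T <= k)%N by rewrite mxrank_tr.
by have [] := svd_bounded_below (is_svd_tr hs) k0 kn km mu0 hmu rAt.
Qed.
End Deterministic.

(** * Induction over the iterations *)

Section Run.
Variables (R : realType) (d : nat) (p r : nat -> nat).
Hypothesis hd : (2 <= d)%N.
Hypothesis hr0 : r 0%N = 1%N.
Hypothesis hrd : r d = 1%N.
Hypothesis hr : forall k, (1 <= k <= d.-1)%N -> (0 < r k)%N.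
Hypothesis hrk : forall k, (1 <= k <= d)%N ->
  (r k <= r k.-1 * p k)%N /\ (r k.-1 <= p k * r k)%N.

Definition orthL (U : left_family R p r) : Prop :=
  forall k, (1 <= k <= d.-1)%N -> (U k)^T *m U k = 1%:M.
Definition orthR (V : right_family R p r) : Prop :=
  forall k, (1 <= k <= d.-1)%N -> (V k.+1)^T *m V k.+1 = 1%:M.

Section Iterates.
Variables (Y : tensor R d p) (U : nat -> left_family R p r) (V : nat -> right_family R p r).
Variables (Rm : nat -> forall k, 'M[R]_(p k * r k.-1, pR d p k.+1)).
Variables (Rt : nat -> forall k, 'M[R]_(r k, pR d p k.+1)) (Xh : nat -> tensor R d p).
Hypothesis run : is_TTOI Y U V Rm Rt Xh.

(** Each reshape moves one mode from the columns to the rows, so the matrices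
    of the forward pass are unfoldings of [Y] compressed by the factors computed
    so far. *)
Lemma TTOI_RmE t k : ~~ odd t -> (k < d.-1)%N ->
  Rm t k.+1 = IkronL (U t) k.+1 *m unfolding Y k.+1.
Proof.
move=> te; elim: k => [|k IH] hk.
  rewrite (TTOI_R1 run te) IkronLS; apply/matrixP => a b.
  case: (mxtens_indexP a) => a1 a2.
  have e2 : (a2 : nat) = 0%N.
    by move: (ltn_ord a2); move: (nat_of_ord a2) => x /=; rewrite hr0; case: x.
  rewrite (@mx_reshapeE _ _ _ _ _ _ _ _ (mxtens_index (a1, ord0)) b) /=; last first.
    by rewrite e2 hr0 !muln1.
  rewrite [RHS]mxE big_mxtens (bigD1 a1) //= [X in _ + X]big1 ?addr0 => [|j ja].
    by rewrite big_ord1 tensmxE !mxE eqxx mul1r mul1r.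
  by rewrite big_ord1 tensmxE [1%:M _ _]mxE eq_sym (negbTE ja) !mul0r.
have hk' : (1 <= k.+1 < d.-1)%N by [].
have hk1 : (1 <= k.+1 <= d.-1)%N by exact: ltnW.
rewrite (TTOI_R run te hk') (TTOI_Rt run te hk1) IH; last exact: ltnW.
rewrite mulmxA -Lprod_IkronL IkronLS !unfoldingE.
have kd : (k.+1 < d)%N by rewrite (leq_trans hk) // leq_pred.
suff G N n : N = n.+1 -> mx_reshape (p k.+2 * r k.+1) (prodR p k.+3 n)
    ((Lprod (U t) k.+1)^T *m unf Y k.+1 N) =
    (1%:M *t (Lprod (U t) k.+1)^T) *m unf Y k.+2 n.
  by apply: G; rewrite subnSK.
by move=> ->; exact: reshape_shift.
Qed.

Lemma TTOI_orthL t : ~~ odd t -> orthL (U t).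
Proof.
move=> te k /andP[k1 kd]; have kd' : (1 <= k <= d)%N.
  by rewrite k1 (leq_trans kd) // leq_pred.
have [h _] := hrk kd'; rewrite mulnC in h.
have [->|t0] := eqVneq t 0%N; apply: SVDL_isom h _.
  by apply: (TTOI_U0 run); rewrite k1.
apply: (TTOI_U run) => //; last by rewrite k1.
by case: t te t0 => [|[]].
Qed.

Lemma TTOI_orthR t : odd t -> orthR (V t).
Proof.
move=> to k hk; have kd' : (1 <= k.+1 <= d)%N.
  by case/andP: hk => _ kd; rewrite /= -(ltn_predK hd) ltnS.
have [_ h] := hrk kd'; rewrite mulnC in h.
by apply: SVDR_isom h _; exact: (TTOI_V run).
Qed.
End Iterates.

Variables X Z : tensor R d p.
Let Y : tensor R d p := fun i => X i + Z i.
Variable lam delta0 : nat -> R.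
Variable delta1 : R.
Hypothesis lam0 : forall k, (1 <= k <= d.-1)%N -> 0 < lam k.
Hypothesis hX : forall k, (1 <= k <= d.-1)%N ->
  [/\ bounded_below (unfolding X k) (lam k), bounded_below (unfolding X k)^T (lam k) &
      \rank (unfolding X k) = r k].
Hypothesis delta0_ge0 : forall k, (1 <= k <= d.-1)%N -> 0 <= delta0 k.
Hypothesis delta1_ge0 : 0 <= delta1.
Hypothesis noise_op : forall U, orthL U -> forall k, (1 <= k <= d.-1)%N ->
  opn (IkronL U k *m unfolding Z k) (delta0 k).
Hypothesis noise_frob : forall U V, orthL U -> orthR V -> forall k, (1 <= k <= d)%N ->
  frob (IkronL U k *m unfolding Z k *m Rprod d V k.+1) <= delta1.
Hypothesis gap0 : forall k, (1 <= k <= d.-1)%N ->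
  4 * delta0 k <= (1 / 2) ^+ (d + d) * lam k.
Hypothesis gap1 : forall k, (1 <= k <= d.-1)%N ->
  4 * delta1 <= (1 / 2) ^+ (d + d) * lam k.

Variables (U : nat -> left_family R p r) (V : nat -> right_family R p r).
Variables (Rm : nat -> forall k, 'M[R]_(p k * r k.-1, pR d p k.+1)).
Variables (Rt : nat -> forall k, 'M[R]_(r k, pR d p k.+1)) (Xh : nat -> tensor R d p).
Hypothesis run : is_TTOI Y U V Rm Rt Xh.

Let half_gt0 j : 0 < (1 / 2 : R) ^+ j.
Proof. by rewrite exprn_gt0 // divr_gt0. Qed.

Let half_gap j j' (a b : R) : (j <= d)%N -> (j' <= d)%N -> 0 <= b ->
  a <= (1 / 2) ^+ (d + d) * b -> a <= (1 / 2) ^+ j * ((1 / 2) ^+ j' * b).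
Proof.
move=> hj hj' b0 /le_trans; apply; rewrite mulrA -exprD ler_wpM2r //.
apply: ler_wiXn2l; last exact: leq_add.
  by rewrite divr_ge0.
by rewrite ler_pdivrMr // mul1r ler1n.
Qed.

Lemma left_lower_run t : ~~ odd t ->
  (forall k, (k < d.-1)%N -> left_lower X (U t) k ((1 / 2) ^+ k) ->
     left_close X (U t) k.+1) ->
  forall k, (k <= d.-1)%N -> left_lower X (U t) k ((1 / 2) ^+ k).
Proof.
move=> te h; elim=> [|k IH] hk; first by rewrite expr0; exact: left_lower0.
rewrite exprS; apply: left_lowerS.
- exact: leq_trans hk (leq_pred _).
- exact: ltW (half_gt0 _).
- exact: (TTOI_orthL run te).
- exact/IH/ltnW.
- by apply: h => //; exact/IH/ltnW.
Qed.

Lemma right_lower_run t : odd t ->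
  (forall k, (0 < k <= d.-1)%N -> right_lower X (V t) k.+1 ((1 / 2) ^+ (d - k.+1)) ->
     right_close X (V t) k) ->
  forall k, (0 < k <= d)%N -> right_lower X (V t) k ((1 / 2) ^+ (d - k)).
Proof.
move=> to h k; move En : (d - k)%N => n; elim: n k En => [|n IH] k En /andP[k0 kd].
  have -> : k = d by apply/eqP; rewrite eqn_leq kd -subn_eq0 En.
  by rewrite expr0; exact: right_lower_last.
have hk : (k < d)%N by rewrite -subn_gt0 En.
have En' : (d - k.+1)%N = n by rewrite subnS En.
have kd1 : (k <= d.-1)%N by rewrite -ltnS (ltn_predK hd).
have hR : right_lower X (V t) k.+1 ((1 / 2) ^+ n) by apply: IH => //; rewrite hk.
rewrite exprS; apply: right_lowerS => //.
- by apply: (TTOI_orthR run to); rewrite k0.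
- by apply: h; rewrite ?k0 // En'.
Qed.

Let dS : d.-1.+1 = d. Proof. exact: ltn_predK hd. Qed.

Let in_range k : (k < d.-1)%N -> [/\ (1 <= k.+1 <= d.-1)%N, (1 <= k.+1 <= d)%N & (k < d)%N].
Proof.
move=> h; have kd : (k < d)%N := leq_trans h (leq_pred _).
by split.
Qed.

(** The columns are not compressed yet; the noise enters with its spectral
    norm. *)
Lemma init_close k : (k < d.-1)%N -> left_lower X (U 0%N) k ((1 / 2) ^+ k) ->
  left_close X (U 0%N) k.+1.
Proof.
move=> kd hL; have [k1 k2 k3] := in_range kd.
have [hb _ hrank] := hX k1.
apply: (@left_step _ _ _ _ _ _ _ _ (lam k.+1) _ 1%:M
  (IkronL (U 0%N) k.+1 *m unfolding Z k.+1) (delta0 k.+1) 1 _ _ _ _ _ _ hL hb) => //.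
- exact: lam0.
- exact: delta0_ge0.
- by have [] := hrk k2; rewrite mulnC.
- by rewrite hrank.
- by move=> m C; rewrite mulmx1 mul1r.
- rewrite mulmx1 -mulmxDr -unfoldingD; have := TTOI_U0 run k1.
  by rewrite (TTOI_RmE run).
- exact: noise_op (TTOI_orthL run (isT : ~~ odd 0)) _ k1.
- have := @half_gap 0 k _ _ (leq0n _) (ltnW k3) (ltW (lam0 k1)) (gap0 k1).
  by rewrite expr0.
Qed.

(** The factors of the preceding backward pass compress the columns, so the
    noise enters with the Frobenius norm of a small matrix. *)
Lemma even_close t k : (2 <= t)%N -> ~~ odd t -> (k < d.-1)%N ->
  (forall k, (0 < k <= d)%N -> right_lower X (V t.-1) k ((1 / 2) ^+ (d - k))) ->
  left_lower X (U t) k ((1 / 2) ^+ k) -> left_close X (U t) k.+1.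
Proof.
move=> t2 te kd hR hL; have [k1 k2 k3] := in_range kd.
have [hb _ hrank] := hX k1.
have to : odd t.-1 by case: t t2 te {hR hL} => //= t _; rewrite negbK.
apply: (@left_step _ _ _ _ _ _ _ _ (lam k.+1) _ (Rprod d (V t.-1) k.+2)
  (IkronL (U t) k.+1 *m unfolding Z k.+1 *m Rprod d (V t.-1) k.+2) delta1
  ((1 / 2) ^+ (d - k.+1)) _ _ _ _ _ _ hL hb) => //.
- exact: lam0.
- by have [] := hrk k2; rewrite mulnC.
- by rewrite hrank.
- by move=> m C; exact: hR.
- have := TTOI_U run t2 te k1; rewrite (TTOI_RmE run) // unfoldingD mulmxDr mulmxDl.
  by apply.
- apply: opn_frob; apply: noise_frob => //; first exact: (TTOI_orthL run).
  exact: (TTOI_orthR run).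
- by apply: half_gap (gap1 k1); rewrite ?leq_subr ?(ltnW k3) // ltW // lam0.
Qed.

(** The mirror image of [even_close]: the rows are compressed by the factors of
    the preceding forward pass. *)
Lemma odd_close t k : odd t -> (0 < k <= d.-1)%N ->
  (forall k, (k <= d.-1)%N -> left_lower X (U t.-1) k ((1 / 2) ^+ k)) ->
  right_lower X (V t) k.+1 ((1 / 2) ^+ (d - k.+1)) -> right_close X (V t) k.
Proof.
move=> to k1 hL hR; have /andP[k0 kd1] := k1.
have kd : (k < d)%N by rewrite -dS ltnS.
have te : ~~ odd t.-1 by case: t to {hL hR}.
have k2 : (1 <= k.+1 <= d)%N by [].
have [_ hb hrank] := hX k1.
have UO := TTOI_orthL run te; have VO := TTOI_orthR run to.
apply: (@right_step _ _ _ _ _ _ _ _ (lam k) _ (Lprod (U t.-1) k)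
  ((Lprod (U t.-1) k)^T *m unfolding Z k *m RkronI d (V t) k.+1) delta1
  ((1 / 2) ^+ k) kd _ _ _ _ _ hR hb) => //.
- exact: lam0.
- by have [_] := hrk k2; rewrite mulnC.
- by rewrite hrank.
- move=> q B; have := hL _ kd1 _ erefl _ B.
  by rewrite -unfoldingE mulmxA.
- have := TTOI_V run to k1; rewrite (TTOI_Rt run te k1).
  have -> : Rm t.-1 k = IkronL (U t.-1) k *m unfolding Y k.
    by move: k1 kd1 {hR kd k2 hb hrank hL k0}; case: k => // k _ hk; rewrite (TTOI_RmE run).
  have -> : (Lprod (U t.-1) k)^T = (U t.-1 k)^T *m IkronL (U t.-1) k.
    by case: k k0 {kd1 k1 kd k2 hR hb hrank hL} => // k _; rewrite -Lprod_IkronL.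
  rewrite unfoldingD !mulmxDr !mulmxDl !mulmxA.
  by apply.
- apply: opn_frob; rewrite frob_RkronI // -IkronLS.
  exact: noise_frob.
- by apply: half_gap (gap1 k1); rewrite ?leq_subr ?(ltnW kd) // ltW // lam0.
Qed.

(** The fractions do not deteriorate with [t].  Each pass uses the bounds of the
    preceding one only to know that the compression on the other side has a
    bounded inverse on the signal; its own bounds start again from the
    uncompressed signal. *)
Lemma lower_all t :
  (~~ odd t -> forall k, (k <= d.-1)%N -> left_lower X (U t) k ((1 / 2) ^+ k)) /\
  (odd t -> forall k, (0 < k <= d)%N -> right_lower X (V t) k ((1 / 2) ^+ (d - k))).
Proof.
elim: t => [|t [IHe IHo]].
  by split=> // _; apply: left_lower_run => // k kd; exact: init_close.
split=> /= ot; last first.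
  by apply: right_lower_run => //= k k1; apply: odd_close => //=; exact: IHe.
apply: left_lower_run => //= k kd; apply: even_close => //=.
  by case: t ot {IHe IHo}.
by apply: IHo; move: ot; rewrite negbK.
Qed.

Lemma left_close_all t k : ~~ odd t -> (k < d.-1)%N -> left_close X (U t) k.+1.
Proof.
move=> te kd; have hL := (lower_all t).1 te _ (ltnW kd).
case: t te hL => [|[|t]] // te hL; first exact: init_close.
apply: even_close => //; apply: (lower_all t.+1).2.
by move: te; rewrite /= negbK.
Qed.

Lemma right_close_all t k : odd t -> (0 < k <= d.-1)%N -> right_close X (V t) k.
Proof.
move=> to k1; apply: odd_close => //.
  by apply: (lower_all t.-1).1; case: t to.
by apply: (lower_all t).2 => //; case/andP: k1 => k0 kd; rewrite /= -dS ltnS.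
Qed.

Lemma sinTheta_left t k Ut : ~~ odd t -> (1 <= k <= d.-1)%N ->
  is_Utilde X (U t) Ut -> sinTheta (U t k) Ut <= 1 / 2.
Proof.
case: k Ut => // k Ut te kd hU; have [k1 k2 k3] := in_range kd.
have [_ _ hrank] := hX k1.
apply: (sinTheta_le _ _ _ hU).
- exact: hr.
- by have [] := hrk k2; rewrite mulnC.
- exact: (TTOI_orthL run).
- apply/eqP; rewrite eqn_leq -{1}hrank mxrankM_maxr /= -hrank.
  apply: (rank_le_of_bound (half_gt0 k)) => q B.
  exact: (IkronL_lower k3 ((lower_all t).1 te _ (ltnW kd))).
exact: left_close_all.
Qed.

Lemma sinTheta_right t k Vt : odd t -> (1 <= k <= d.-1)%N ->
  is_Vtilde X (V t) Vt -> sinTheta (V t k.+1) Vt <= 1 / 2.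
Proof.
move=> to k1 /is_SVDL_tr hV; have /andP[k0 kd1] := k1.
have kd : (k < d)%N by rewrite -dS ltnS.
have k2 : (1 <= k.+1 <= d)%N by [].
have [_ _ hrank] := hX k1.
apply: (sinTheta_le _ _ _ hV).
- exact: hr.
- by have [_] := hrk k2; rewrite mulnC.
- exact: (TTOI_orthR run).
- rewrite mxrank_tr; apply/eqP; rewrite eqn_leq -{1}hrank mxrankM_maxl /= -hrank.
  rewrite -(mxrank_tr (unfolding X k)) -(mxrank_tr (_ *m RkronI _ _ _)).
  apply: (rank_le_of_bound (half_gt0 (d - k.+1))) => q B.
  have := RkronI_lower kd ((lower_all t).2 to _ k2) B^T.
  rewrite -(frob_tr (B^T *m _)) -(frob_tr (B^T *m _ *m _)) -mulmxA !trmx_mul !trmxK.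
  by rewrite -trmx_mul.
exact: right_close_all.
Qed.

Lemma A_term_le t k : (1 <= t)%N -> (1 <= k <= d.-1)%N ->
  A_term Z U V t k <= delta1 ^+ 2.
Proof.
move=> t1 k1; have /andP[k0 kd1] := k1.
have kd : (k < d)%N by rewrite -dS ltnS.
have o1 : ~~ odd t -> odd t.-1 by case: (t) t1 => //= n _; rewrite negbK.
have o2 : odd t -> ~~ odd t.-1 by case: (t).
rewrite /A_term; case: ifPn => to; rewrite ler_pXn2r ?nnegrE //.
  rewrite frob_RkronI // -IkronLS; apply: noise_frob => //.
    exact: (TTOI_orthL run (o2 to)).
  exact: (TTOI_orthR run to).
apply: noise_frob => //; last by rewrite k0 ltnW.
  exact: (TTOI_orthL run to).
exact: (TTOI_orthR run (o1 to)).
Qed.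

Lemma B_term_le t : (1 <= t)%N -> B_term Z U V t <= delta1 ^+ 2.
Proof.
move=> t1.
have o1 : ~~ odd t -> odd t.-1 by case: (t) t1 => //= n _; rewrite negbK.
have o2 : odd t -> ~~ odd t.-1 by case: (t).
rewrite /B_term; case: ifPn => to; rewrite ler_pXn2r ?nnegrE //.
  rewrite -(frob_IkronL1 hr0 (U t.-1)) mulmxA; apply: noise_frob => //.
  - exact: (TTOI_orthL run (o2 to)).
  - exact: (TTOI_orthR run to).
  by rewrite /= ltnW.
rewrite -(frob_unfolding_succ Z) ?dS // -IkronLS.
have := noise_frob (TTOI_orthL run to) (TTOI_orthR run (o1 to)) (k := d).
rewrite frob_Rprod_last // => h.
have h2 d' : d' = d -> frob (IkronL (U t) d' *m unfolding Z d') <= delta1.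
  by move=> ->; apply: h; rewrite leqnn ltnW.
exact: h2 dS.
Qed.
End Run.

(** * Nets of exponential size *)

Section Net.
Variables (R : realType) (m n : nat) (ball : R -> 'M[R]_(m, n) -> Prop) (h : R).
Hypothesis h0 : 0 < h.
Hypothesis ballB : forall (a b : R) x y, ball a x -> ball b y -> ball (a + b) (x - y).
Hypothesis ballZ : forall (a c : R) x, ball a x -> ball (`|c| * a) (c *: x).
Hypothesis ball_le : forall (a b : R) x, ball a x -> a <= b -> ball b x.
Hypothesis ball_small : forall (a : R) (x : 'M[R]_(m, n)),
  0 <= a -> (forall i j, `|x i j| <= a) -> ball (h * a) x.
Hypothesis ball_entry : forall (a : R) (x : 'M[R]_(m, n)), ball a x -> forall i j, `|x i j| <= a.

Let ballN a x : ball a x -> ball a (- x).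
Proof. by move/(ballZ (-1)); rewrite normrN1 mul1r scaleN1r. Qed.

Let ballD a b x y : ball a x -> ball b y -> ball (a + b) (x + y).
Proof. by move=> hx /ballN hy; have := ballB hx hy; rewrite opprK. Qed.

(* every point is within distance 1/8 of the lattice of mesh [eta], by [ball_small] *)
Let eta : R := (8 * h)^-1.
Let eta0 : 0 < eta. Proof. by rewrite invr_gt0 mulr_gt0. Qed.
Let B : nat := (Num.truncn (2 / eta)).+1.
Let etaB : 2 <= eta * B%:R.
Proof.
rewrite mulrC -ler_pdivrMr //; apply: ltW; exact: truncnS_gt.
Qed.

(* [k] stands for the lattice point [eta * (k - B)]; by [etaB] the box of side
   [2 * B] holds the lattice points all of whose coordinates are at most 2 *)
Let T : finType := 'M['I_(2 * B).+1]_(m, n).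
Let e (k : T) : 'M[R]_(m, n) := \matrix_(i, j) (eta * ((k i j : nat)%:R - B%:R)).
Let L a : {set T} := [set k : T | `[< ball a (e k) >]].

Let LP a k : reflect (ball a (e k)) (k \in L a).
Proof. by rewrite inE; exact: asboolP. Qed.

Let mkT (f : 'I_m -> 'I_n -> nat) : T := \matrix_(i, j) inord (f i j).

Let mkTE (f : 'I_m -> 'I_n -> nat) i j : (f i j <= 2 * B)%N -> mkT f i j = f i j :> nat.
Proof. by move=> hf; rewrite mxE inordK. Qed.

Lemma lattice_round (x : 'M[R]_(m, n)) : (forall i j, `|x i j| <= 1) ->
  exists k : T, ball (1 / 8) (x - e k).
Proof.
move=> hx.
have y0 i j : 0 <= x i j / eta + B%:R <= 2 * B%:R.
  have := hx i j; rewrite ler_norml => /andP[xl xu].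
  have d1 : x i j / eta <= B%:R
    by rewrite ler_pdivrMr // mulrC (le_trans xu) // (le_trans _ etaB) // ler1n.
  have d2 : - B%:R <= x i j / eta.
    by rewrite ler_pdivlMr // mulNr lerNl mulrC; apply: le_trans etaB; lra.
  by apply/andP; split; lra.
exists (mkT (fun i j => Num.truncn (x i j / eta + B%:R))).
have -> : 1 / 8 = h * eta by rewrite /eta; field; rewrite gt_eqF.
apply: ball_small => [|i j]; first exact: ltW.
have /andP[ya yb] := y0 i j.
have /andP[ta tb] := Num.Theory.truncn_itv ya.
rewrite !mxE inordK; last first.
  rewrite ltnS -(ler_nat R) natrM; exact: le_trans yb.
set t := Num.truncn _ in ta tb *.
have -> : x i j = eta * (x i j / eta) by field; rewrite gt_eqF.
rewrite -mulrBr normrM (gtr0_norm eta0) -[leRHS]mulr1 ler_pM2l //.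
by move: ta tb; rewrite -natr1 => ta tb; rewrite ler_norml; apply/andP; split; lra.
Qed.

(** This comparison replaces a comparison of volumes.  Two lattice points that
    are congruent modulo 18 differ by 18 times a lattice point, and the norm of
    the latter is at most (9/8 + 9/8) / 18 = 1/8.  Subtracting a fixed point of
    the class and dividing by 18 therefore injects every one of the 18^(m n)
    classes into the ball of radius 1/8. *)
Lemma lattice_doubling : (#|L (9 / 8)| <= 18 ^ (m * n) * #|L (1 / 8)|)%N.
Proof.
pose cls (k : T) : 'M['I_18]_(m, n) := \matrix_(i, j) inord (k i j %% 18).
rewrite -sum1_card (partition_big cls xpredT) //=.
have <- : #|{: 'M['I_18]_(m, n)}| = (18 ^ (m * n))%N by rewrite card_mx card_ord.
rewrite -sum_nat_const; apply: leq_sum => c _.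
pose F : {set T} := [set k in L (9 / 8) | cls k == c]%SET.
have -> : (\sum_(k in L (9 / 8) | cls k == c) 1)%N = #|F|.
  by rewrite -sum1_card; apply: eq_bigl => k; rewrite [RHS]inE.
have [->|[k0 k0F]] := set_0Vmem F; first by rewrite cards0.
(* the difference divided by 18, shifted by [B] to stay among the natural numbers *)
pose v (k : T) i j := ((k i j + 18 * B - k0 i j) %/ 18)%N.
have kB (k : T) i j : (k i j <= 2 * B)%N by rewrite -ltnS ltn_ord.
have vE k i j : k \in F -> (18 * v k i j = k i j + 18 * B - k0 i j)%N.
  move=> kF; rewrite /v mulnC divnK //.
  have le0 : (k0 i j <= k i j + 18 * B)%N.
    by apply: leq_trans (kB _ _ _) _; apply: leq_trans (leq_addl _ _); rewrite leq_mul2r orbT.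
  rewrite -(eqn_mod_dvd _ le0) [(k i j + _)%N]addnC (mulnC 18) modnMDl.
  move: kF k0F; rewrite !inE => /andP[_ /eqP <-] /andP[_ /eqP/matrixP/(_ i j)].
  by rewrite !mxE => /(congr1 (@nat_of_ord _)); rewrite !inordK ?ltn_pmod // => ->.
have vB k i j : k \in F -> (v k i j <= 2 * B)%N.
  move=> kF; rewrite -(leq_pmul2l (isT : (0 < 18)%N)) (vE _ _ _ kF).
  apply: leq_trans (leq_subr _ _) _; apply: leq_trans (leq_add (kB k i j) (leqnn _)) _.
  by rewrite -mulnDl mulnA leq_mul2r orbT.
have eE k : k \in F -> e (mkT (v k)) = 18^-1 *: (e k - e k0).
  move=> kF; apply/matrixP => i j; rewrite [LHS]mxE mkTE ?vB // !mxE.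
  have := congr1 (GRing.natmul (1 : R)) (vE _ i j kF).
  rewrite natrB; last first.
    by apply: leq_trans (kB _ _ _) _; apply: leq_trans (leq_addl _ _); rewrite leq_mul2r orbT.
  rewrite natrD !natrM => E; apply: (@mulfI _ 18) => //.
  by rewrite mulrCA mulrBr E; field.
have inj : {in F &, injective (fun k => mkT (v k))}.
  move=> k k' kF kF' /matrixP E; apply/matrixP => i j; apply: val_inj => /=.
  have := E i j => /(congr1 (@nat_of_ord _)); rewrite !mkTE ?vB // => vv.
  have := vE _ i j kF; rewrite vv (vE _ i j kF') => E1.
  have l1 k2 : (k0 i j <= k2 + 18 * B)%N.
    by apply: leq_trans (kB _ _ _) _; apply: leq_trans (leq_addl _ _); rewrite leq_mul2r orbT.
  have := congr1 (addn^~ (k0 i j)) E1; rewrite !subnK // => /eqP.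
  by rewrite eqn_add2r => /eqP.
rewrite -(card_in_imset inj); apply/subset_leq_card/fintype.subsetP => _ /imsetP[k kF ->].
apply/LP; rewrite eE //.
have -> : 1 / 8 = `|18^-1| * (9 / 8 + 9 / 8) :> R by rewrite ger0_norm ?invr_ge0 //; field.
apply: ballZ; apply: ballB;
  move: kF k0F; rewrite !inE => /andP[/asboolP ? _] /andP[/asboolP ? _] //.
Qed.

(** Take a maximal set [S] of lattice points of the unit ball with mutual
    distances above 1/4.  The lattice balls of radius 1/8 around its points are
    disjoint and lie in the ball of radius 9/8, so [lattice_doubling] bounds the
    number of points of [S]. *)
Lemma exists_net : exists S : seq 'M[R]_(m, n),
  [/\ (size S <= 18 ^ (m * n))%N, forall s, s \in S -> ball 1 s &
      forall x, ball 1 x -> exists2 s, s \in S & ball (1 / 2) (x - s)].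
Proof.
pose sep (S : {set T}) := (S \subset L 1) &&
  [forall s in S, forall s' in S, (s != s') ==> ~~ `[< ball (1 / 4) (e s - e s') >]].
have sep0 : sep finset.set0.
  by rewrite /sep finset.sub0set; apply/forall_inP => s; rewrite inE.
have [S maxS _] := maxset_exists sep0.
have /andP[/fintype.subsetP SL /forall_inP Ssep] := maxsetp maxS.
have kB (k : T) i j : (k i j <= 2 * B)%N by rewrite -ltnS ltn_ord.
have sepP s s' : s \in S -> s' \in S -> ball (1 / 4) (e s - e s') -> s = s'.
  move=> sS sS' hb; apply/eqP; apply/negPn/negP => ne.
  by have /forall_inP/(_ _ sS')/implyP/(_ ne)/asboolP := Ssep _ sS.
exists [seq e s | s <- enum S]; split.
- rewrite size_map -cardE.
  pose f (su : T * T) i j := (su.1 i j + su.2 i j - B)%N.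
  have Bsu su i j : su \in finset.setX S (L (1 / 8)) ->
      (B <= su.1 i j + su.2 i j <= 3 * B)%N.
    case: su => s u; rewrite inE /= => /andP[/SL/LP sS /LP uL].
    have := ball_entry (ballD sS uL) i j; rewrite !mxE -mulrDr normrM (gtr0_norm eta0).
    move=> hle; have {hle} : `|(s i j)%:R - B%:R + ((u i j)%:R - B%:R)| <= B%:R :> R.
      rewrite -(ler_pM2l eta0); apply: le_trans hle _; apply: le_trans etaB; lra.
    rewrite ler_norml => /andP[l1 l2]; rewrite -!(ler_nat R) natrM natrD.
    by apply/andP; split; lra.
  have fE su i j : su \in finset.setX S (L (1 / 8)) ->
    mkT (f su) i j = (su.1 i j + su.2 i j - B)%N :> nat.
    move=> /(Bsu _ i j)/andP[l1 l2]; rewrite mkTE //.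
    by rewrite /f leq_subLR -mulSn.
  have eE su : su \in finset.setX S (L (1 / 8)) -> e (mkT (f su)) = e su.1 + e su.2.
    move=> hsu; apply/matrixP => i j; rewrite [LHS]mxE fE // natrB; last first.
      by case/andP: (Bsu _ i j hsu).
    by rewrite !mxE natrD; ring.
  have inj : {in finset.setX S (L (1 / 8)) &, injective (fun su => mkT (f su))}.
    move=> [s u] [s' u'] h1 h2 E.
    have E1 : e s + e u = e s' + e u' by rewrite -(eE (s, u)) // E eE.
    move: (h1) (h2); rewrite !inE /= => /andP[sS /asboolP uL] /andP[sS' /asboolP uL'].
    have ss : s = s'.
      apply: sepP => //; have -> : e s - e s' = e u' - e u.
        by apply/eqP; rewrite subr_eq addrAC eq_sym subr_eq [e u' + _]addrC E1.
      by have -> : 1 / 4 = 1 / 8 + 1 / 8 :> R; [field|exact: ballB].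
    subst s'; congr (_, _); apply/matrixP => i j; apply: val_inj => /=.
    have /andP[l1 _] := Bsu _ i j h1; have /andP[l2 _] := Bsu _ i j h2.
    have /matrixP/(_ i j)/(congr1 (@nat_of_ord _)) := E; rewrite !fE //= => /(congr1 (addn^~ B)).
    by rewrite !subnK // => /eqP; rewrite eqn_add2l => /eqP.
  have L0 : (0 < #|L (1 / 8)|)%N.
    apply/card_gt0P; exists (mkT (fun _ _ => B)); apply/LP.
    have -> : e (mkT (fun _ _ => B)) = 0.
      by apply/matrixP => i j; rewrite mxE mkTE ?subrr ?mulr0 ?mxE // mulSn leq_addr.
    have := @ball_small 0 0 (lexx _); rewrite mulr0 => hb.
    apply: ball_le (hb _) _; last by rewrite divr_ge0.
    by move=> i j; rewrite mxE normr0.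
  rewrite -(leq_pmul2r L0); apply: leq_trans lattice_doubling.
  rewrite -cardsX -(card_in_imset inj);
    apply/subset_leq_card/fintype.subsetP => _ /imsetP[su hsu ->].
  apply/LP; rewrite eE //; move: hsu; rewrite inE => /andP[/SL/LP sS /LP uL].
  by have -> : 9 / 8 = 1 + 1 / 8 :> R; [field|exact: ballD].
- by move=> x /mapP[s]; rewrite mem_enum => /SL/LP hs ->.
move=> x hx.
(* rounding [(7 / 8) *: x] instead of [x] gives a lattice point of the unit ball *)
have hx' : forall i j, `|((7 / 8) *: x) i j| <= 1.
  move=> i j; apply: le_trans (ball_entry (ballZ (7 / 8) hx) i j) _.
  by rewrite ger0_norm ?divr_ge0 //; lra.
have [k hk] := lattice_round hx'.
have k1 : k \in L 1.
  apply/LP; have -> : e k = (7 / 8) *: x - ((7 / 8) *: x - e k) by rewrite opprB addrC subrK.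
  apply: ball_le (ballB (ballZ (7 / 8) hx) hk) _.
  by rewrite ger0_norm ?divr_ge0 //; lra.
have [s sS hs] : exists2 s, s \in S & ball (1 / 4) (e k - e s).
  have [kS|kS] := boolP (k \in S).
    exists k => //; rewrite subrr; have := @ball_small 0 0 (lexx _); rewrite mulr0 => hb.
    apply: ball_le (hb _) _; last by rewrite divr_ge0.
    by move=> i j; rewrite mxE normr0.
  apply: contrapT => no.
  have hno s : s \in S -> ~ ball (1 / 4) (e k - e s) by move=> sS hb; apply: no; exists s.
  have : sep (k |: S).
    apply/andP; split; first by rewrite finset.subUset finset.sub1set k1; apply/fintype.subsetP.
    apply/forall_inP => s /setU1P hs; apply/forall_inP => s' /setU1P hs'; apply/implyP => ne.
    apply/asboolP => hb; case: hs hs' => [sk|sS] [sk'|sS'].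
    - by rewrite sk sk' eqxx in ne.
    - by subst s; exact: (hno _ sS').
    - by subst s'; apply: (hno _ sS); rewrite -opprB; exact: ballN.
    - by rewrite (sepP _ _ sS sS' hb) eqxx in ne.
  move=> /(maxsetsup maxS) /(_ (finset.subsetUr _ _)) E.
  by move/negP: kS; apply; rewrite -E setU11.
exists (e s); first by apply: map_f; rewrite mem_enum.
have -> : x - e s = (1 / 8) *: x + (((7 / 8) *: x - e k) + (e k - e s)).
  by apply/matrixP => i j; rewrite !mxE; field.
apply: ball_le (ballD (ballZ (1 / 8) hx) (ballD hk hs)) _.
by rewrite ger0_norm ?divr_ge0 //; lra.
Qed.
End Net.

(** * Finite test sets for tensor-train forms *)

Section Norming.
Variable R : realType.

Definition linear_form m n (g : 'M[R]_(m, n) -> R) : Prop :=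
  forall a x y, g (a *: x + y) = a * g x + g y.

Lemma linear_form_bound m n (g : 'M[R]_(m, n) -> R) (x : 'M[R]_(m, n)) : linear_form g ->
  (forall i j, `|x i j| <= 1) -> `|g x| <= \sum_i \sum_j `|g (delta_mx i j)|.
Proof.
move=> hg hx.
have g0 : g 0 = 0 by have := hg 1 0 0; rewrite scale1r addr0; lra.
have gD y z : g (y + z) = g y + g z by have := hg 1 y z; rewrite scale1r mul1r.
have gZ a y : g (a *: y) = a * g y by have := hg a y 0; rewrite !addr0 g0 addr0.
have gs (I : Type) (s : seq I) (F : I -> 'M[R]_(m, n)) :
    g (\sum_(i <- s) F i) = \sum_(i <- s) g (F i).
  by elim: s => [|i s IH]; rewrite ?big_nil // !big_cons gD IH.
rewrite [x in g x]matrix_sum_delta gs; apply: le_trans (ler_norm_sum _ _ _) _.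
apply: ler_sum => i _; rewrite gs; apply: le_trans (ler_norm_sum _ _ _) _.
apply: ler_sum => j _; rewrite gZ normrM -[leRHS]mul1r.
by rewrite ler_wpM2r.
Qed.

(** For a form that is linear in each of several variables, the variables can be
    released from [S] to [D] one at a time, and the constants multiply. *)
Definition norming m n (c : R) (S : seq 'M[R]_(m, n)) (D : 'M[R]_(m, n) -> Prop) : Prop :=
  forall g, linear_form g -> forall M, (forall s, s \in S -> `|g s| <= M) ->
  forall x, D x -> `|g x| <= c * M.

(** If G is the supremum of |g| over the ball, writing x = s + y with [s] in [S]
    and [y] in the ball of radius 1/2 gives G <= M + G / 2; and G is finite by
    [linear_form_bound]. *)
Lemma net_norming m n (ball : R -> 'M[R]_(m, n) -> Prop) (S : seq 'M[R]_(m, n)) :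
  (forall (a c : R) x, ball a x -> ball (`|c| * a) (c *: x)) ->
  (forall (a : R) (x : 'M[R]_(m, n)), ball a x -> forall i j, `|x i j| <= a) ->
  (forall x, ball 1 x -> exists2 s, s \in S & ball (1 / 2) (x - s)) ->
  norming 2 S (ball 1).
Proof.
move=> ballZ ballE net g hg M hM x hx.
pose A := [set `|g y| | y in ball 1].
have ubA : ubound A (\sum_i \sum_j `|g (delta_mx i j)|).
  by move=> _ [y hy <-]; apply: linear_form_bound => //; exact: ballE.
have sA : has_sup A by split; [exists `|g x|, x|exists (\sum_i \sum_j `|g (delta_mx i j)|)].
have leA y : ball 1 y -> `|g y| <= sup A.
  by move=> hy; apply: sup_upper_bound => //; exists y.
have : sup A <= M + sup A / 2.
  apply: sup_le_ub; first by case: sA.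
  move=> _ [y hy <-]; have [s sS hs] := net y hy.
  have -> : g y = 2^-1 * g (2 *: (y - s)) + g s.
    by rewrite -hg scalerA mulVf // scale1r subrK.
  apply: le_trans (ler_normD _ _) _; rewrite addrC; apply: lerD; first exact: hM.
  rewrite normrM ger0_norm ?invr_ge0 // mulrC ler_wpM2r ?invr_ge0 //.
  apply: leA; have := ballZ _ 2 _ hs; rewrite ger0_norm //.
  by rewrite mul1r divff.
have := leA x hx; lra.
Qed.

Lemma frob_small m n a (x : 'M[R]_(m, n)) : 0 <= a -> (forall i j, `|x i j| <= a) ->
  frob x <= (m * n).+1%:R * a.
Proof.
move=> a0 hx; rewrite -(@ler_pXn2r _ 2) ?nnegrE ?mulr_ge0 // exprMn frob_sqE.
apply: (@le_trans _ _ (\sum_(i < m) \sum_(j < n) a ^+ 2)).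
  apply: ler_sum => i _; apply: ler_sum => j _.
  by rewrite -[x i j ^+ 2]ger0_norm ?sqr_ge0 // normrX ler_pXn2r ?nnegrE.
under eq_bigr do rewrite sumr_const card_ord.
rewrite sumr_const card_ord -mulrnA -[leLHS]mulr_natl. apply: ler_wpM2r; first exact: sqr_ge0.
rewrite -natrX ler_nat mulnC; apply: leq_trans (leqnSn _) _.
by rewrite expnS expn1 leq_pmulr.
Qed.

Lemma opn_entry m n a (x : 'M[R]_(m, n)) : opn x a -> forall i j, `|x i j| <= a.
Proof.
move=> hx i j; have := hx _ (delta_mx j 0 : 'cV[R]_n).
rewrite frob_delta mulr1; apply: le_trans.
have -> : x i j = (x *m (delta_mx j 0 : 'cV[R]_n)) i 0.
  rewrite mxE (bigD1 j) //= big1 => [|k kj]; rewrite mxE; first by rewrite !eqxx mulr1 addr0.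
  by rewrite (negbTE kj) mulr0.
exact: frob_entry.
Qed.

Lemma net_frob m n : exists S : seq 'M[R]_(m, n),
  [/\ (size S <= 18 ^ (m * n))%N, forall s, s \in S -> frob s <= 1 &
      norming 2 S (fun x => frob x <= 1)].
Proof.
have zz (a c : R) (x : 'M[R]_(m, n)) : frob x <= a -> frob (c *: x) <= `|c| * a.
  by move=> h; rewrite frobZ ler_wpM2l.
have ee (a : R) (x : 'M[R]_(m, n)) : frob x <= a -> forall i j, `|x i j| <= a.
  by move=> h i j; apply: le_trans h; exact: frob_entry.
have [||||S [h1 h2 h3]] := @exists_net R m n (fun a x => frob x <= a) (m * n).+1%:R _ _ zz _ _ ee.
- by rewrite ltr0n.
- by move=> a b x y hx hy; apply: le_trans (frobB _ _) _; exact: lerD.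
- by move=> a b x h /(le_trans h).
- by move=> a x a0; exact: frob_small.
by exists S; split => //; exact: (net_norming zz ee h3).
Qed.

Lemma net_opn m n : exists S : seq 'M[R]_(m, n),
  [/\ (size S <= 18 ^ (m * n))%N, forall s, s \in S -> opn s 1 &
      norming 2 S (fun x => opn x 1)].
Proof.
have zz (a c : R) (x : 'M[R]_(m, n)) : opn x a -> opn (c *: x) (`|c| * a).
  exact: opnZ.
have [||||S [h1 h2 h3]] := @exists_net R m n (fun a x => opn x a) (m * n).+1%:R _ _ zz _ _
   (fun a x => @opn_entry m n a x).
- by rewrite ltr0n.
- move=> a b x y hx /(opnZ (-1)); rewrite normrN1 mul1r scaleN1r => hy; exact: opnD.
- by move=> a b x h; exact: opn_le h.
- by move=> a x a0 h; apply: opn_frob; exact: frob_small.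
by exists S; split => //; exact: (net_norming zz (fun a x => @opn_entry m n a x) h3).
Qed.

Lemma tens1_linear k m n a (x y : 'M[R]_(m, n)) :
  (1%:M : 'M[R]_k) *t (a *: x + y) = a *: (1%:M *t x) + 1%:M *t y.
Proof. by apply/matrixP => i j; rewrite !mxE; ring. Qed.

Lemma tens1r_linear k m n a (x y : 'M[R]_(m, n)) :
  (a *: x + y) *t (1%:M : 'M[R]_k) = a *: (x *t 1%:M) + y *t 1%:M.
Proof. by apply/matrixP => i j; rewrite !mxE; ring. Qed.

Variables (d : nat) (p r : nat -> nat).
Hypothesis hr0 : r 0%N = 1%N.
Hypothesis hrd : r d = 1%N.
Let w i := (p i * r i.-1 * r i)%N.

(** The exponent is the number of entries of the factors.  Contractions are used
    instead of isometries, because they form the unit ball of a norm. *)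
Lemma norming_Lprod k : exists S : seq 'M[R]_(pL p k, r k),
  [/\ (size S <= 18 ^ (\sum_(1 <= i < k.+1) w i))%N, forall s, s \in S -> opn s 1 &
      norming (2 ^+ k) S (fun x => exists U : left_family R p r,
        (forall j, (1 <= j <= k)%N -> opn (U j) 1) /\ x = Lprod U k)].
Proof.
elim: k => [|k [S [s1 s2 s3]]].
  exists [:: const_mx 1]; split.
  - by rewrite big_geq.
  - move=> s; rewrite inE => /eqP ->; apply: opn_isom; exact: const1_isom.
  - move=> g _ M hM _ [U [_ ->]]; rewrite expr0 mul1r; apply: hM; exact: mem_head.
have [S' [t1 t2 t3]] := net_opn (p k.+1 * r k) (r k.+1).
exists [seq (1%:M *t A) *m B | A <- S, B <- S']; split.
- rewrite size_allpairs big_nat_recr //= expnD; exact: leq_mul.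
- move=> _ /allpairsP[[A B] /= [hA hB ->]].
  have := opnM ler01 (opn_tens1l (k := p k.+1) ler01 (s2 _ hA)) (t2 _ hB).
  by rewrite mulr1.
move=> g hg M hM _ [U [hU ->]] /=.
rewrite exprS -mulrA.
apply: (t3 (fun B => g ((1%:M *t Lprod U k) *m B))) (hU k.+1 _); rewrite ?leqnn //.
  by move=> a x y; rewrite mulmxDr -scalemxAr hg.
move=> B hB; apply: (s3 (fun A => g ((1%:M *t A) *m B))).
- by move=> a x y; rewrite tens1_linear mulmxDl -scalemxAl hg.
- by move=> A hA; apply: hM; apply/allpairsP; exists (A, B).
exists U; split => // j /andP[j1 jk]; apply: hU; by rewrite j1 leqW.
Qed.

Lemma norming_Rprod n k : (k + n = d.+1)%N -> exists S : seq 'M[R]_(prodR p k n, r k.-1),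
  [/\ (size S <= 18 ^ (\sum_(k <= i < k + n) w i))%N, forall s, s \in S -> opn s 1 &
      norming (2 ^+ n) S (fun x => exists V : right_family R p r,
        (forall j, (k <= j <= d)%N -> opn (V j) 1) /\ x = Rprod_rec V k n)].
Proof.
elim: n k => [|n IH] k kn.
  exists [:: const_mx 1]; split.
  - by rewrite addn0 big_geq.
  - move=> s; rewrite inE => /eqP ->; apply: opn_isom; apply: const1_isom => //.
    by move: kn; rewrite addn0 => ->.
  - move=> g _ M hM _ [U [_ ->]]; rewrite expr0 mul1r; apply: hM; exact: mem_head.
have [|S [s1 s2 s3]] := IH k.+1; first by rewrite addSnnS.
have [S' [t1 t2 t3]] := net_opn (r k * p k) (r k.-1).
exists [seq (A *t 1%:M) *m B | A <- S, B <- S']; split.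
- rewrite size_allpairs [X in (18 ^ X)%N]big_ltn; last by rewrite -addSnnS leq_addr.
  rewrite mulnC expnD -addSnnS; apply: leq_mul => //.
  by rewrite /w mulnAC [(p k * r k)%N]mulnC.
- move=> _ /allpairsP[[A B] /= [hA hB ->]].
  have := opnM ler01 (opn_tens1r (k := p k) ler01 (s2 _ hA)) (t2 _ hB).
  by rewrite mulr1.
have kd : (k <= d)%N by rewrite -ltnS -kn -addSnnS leq_addr.
move=> g hg M hM _ [V [hV ->]] /=.
rewrite exprS -mulrA.
apply: (t3 (fun B => g ((Rprod_rec V k.+1 n *t 1%:M) *m B))) (hV k _); rewrite ?leqnn //.
  by move=> a x y; rewrite mulmxDr -scalemxAr hg.
move=> B hB; apply: (s3 (fun A => g ((A *t 1%:M) *m B))).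
- by move=> a x y; rewrite tens1r_linear mulmxDl -scalemxAl hg.
- by move=> A hA; apply: hM; apply/allpairsP; exists (A, B).
exists V; split => // j /andP[j1 jk]; apply: hV; by rewrite jk (ltnW j1).
Qed.

(** The Frobenius norm on the left is the supremum, over [W] of norm at most 1,
    of the trace of [W^T] times the compressed [Z]; this trace is linear in
    [A], [B] and [W], and pairs [Z] with the tensor (1 (x) A) W B^T. *)
Lemma norming_product k q cA cB (SA : seq 'M[R]_(pL p k, r k)) DA
    (SB : seq 'M[R]_(pR d p k.+2, q)) DB :
  0 <= cA -> 0 <= cB ->
  (forall s, s \in SA -> opn s 1) -> norming cA SA DA ->
  (forall s, s \in SB -> opn s 1) -> norming cB SB DB ->
  exists L : seq 'M[R]_(pL p k.+1, pR d p k.+2),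
  [/\ (size L <= size SA * 18 ^ (p k.+1 * r k * q) * size SB)%N,
      forall T, T \in L -> frob T <= 1 &
      forall (Z : 'M[R]_(pL p k.+1, pR d p k.+2)) s,
      (forall T, T \in L -> `|\tr (T^T *m Z)| <= s) ->
      forall A B, DA A -> DB B ->
      frob ((1%:M *t A^T) *m Z *m B) <= cB * (cA * (2 * s))].
Proof.
move=> cA0 cB0 oA nA oB nB.
have [SW [w1 w2 w3]] := net_frob (p k.+1 * r k) q.
pose T (A : 'M[R]_(pL p k, r k)) (W : 'M[R]_(p k.+1 * r k, q)) (B : 'M[R]_(pR d p k.+2, q)) :
  'M[R]_(pL p k.+1, pR d p k.+2) := ((1%:M : 'M[R]_(p k.+1)) *t A) *m W *m B^T.
exists [seq T AW.1 AW.2 B | AW <- [seq (A, W) | A <- SA, W <- SW], B <- SB]; split.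
- rewrite !size_allpairs; apply: leq_mul => //; exact: leq_mul.
- move=> _ /allpairsP[[[A W] B] /= [/allpairsP[[A' W'] /= [hA hW [-> ->]]] hB ->]].
  apply: (@le_trans _ _ (1 * frob ((1%:M *t A') *m W'))).
    by apply: opn_mulr => //; apply: opn_tr => //; exact: oB.
  rewrite mul1r; apply: le_trans (frob_tens1l W' ler01 (oA _ hA)) _.
  by rewrite mul1r; exact: w2.
move=> Z s hL A B hA hB.
pose g A W B := \tr ((T A W B)^T *m Z).
have gE A' W' B' : g A' W' B' = \tr (W'^T *m ((1%:M *t A'^T) *m Z *m B')).
  rewrite /g /T !trmx_mul trmxK trmx_tens trmx1 -!mulmxA mxtrace_mulC.
  by rewrite !mulmxA.
have gW W' : frob W' <= 1 -> `|g A W' B| <= cB * (cA * (2 * s)).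
  move=> hW'.
  apply: (nB (fun B => g A W' B)) hB => [a x y|B' hB'].
    rewrite !gE; rewrite mulmxDr -scalemxAr mulmxDr -scalemxAr.
    by rewrite raddfD /= mxtraceZ.
  apply: (nA (fun A => g A W' B')) hA => [a x y|A' hA'].
    rewrite /g /T tens1_linear !mulmxDl -!scalemxAl.
    have -> (m n : nat) (u v : 'M[R]_(m, n)) : (a *: u + v)^T = a *: u^T + v^T.
      by apply/matrixP => i j; rewrite !mxE.
    by rewrite mulmxDl -scalemxAl raddfD /= mxtraceZ.
  apply: (w3 (fun W => g A' W B')) hW' => [a x y|W'' hW''].
    rewrite !gE.
    have -> (m n : nat) (u v : 'M[R]_(m, n)) : (a *: u + v)^T = a *: u^T + v^T.
      by apply/matrixP => i j; rewrite !mxE.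
    by rewrite mulmxDl -scalemxAl raddfD /= mxtraceZ.
  apply: hL; apply/allpairsP; exists ((A', W''), B'); split => //=.
  by apply/allpairsP; exists (A', W'').
set F := (1%:M *t A^T) *m Z *m B.
have [F0|F0] := eqVneq (frob F) 0.
  by rewrite F0; apply: le_trans (gW 0 _) => //; rewrite frob0.
have Fp : 0 < frob F by rewrite lt_def F0 frob_ge0.
have := gW ((frob F)^-1 *: F); rewrite frobZ ger0_norm ?invr_ge0 // mulVf //.
move=> /(_ (lexx _)); apply: le_trans; rewrite gE -/F.
have -> : ((frob F)^-1 *: F)^T = (frob F)^-1 *: F^T.
  by apply/matrixP => i j; rewrite !mxE.
by rewrite -scalemxAl mxtraceZ -frob_sq_tr expr2 mulrA mulVf // mul1r ler_norm.
Qed.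

Definition contrL (U : left_family R p r) : Prop :=
  forall k, (1 <= k <= d.-1)%N -> opn (U k) 1.
Definition contrR (V : right_family R p r) : Prop :=
  forall k, (1 <= k <= d.-1)%N -> opn (V k.+1) 1.

Let N := (\sum_(1 <= i < d.+1) w i)%N.

(** The middle matrix [W] of [norming_product] has as many entries as the k-th
    factor, so that all exponents add up to [N].  The constant is
    2^(k-1) * 2 * 2^(d-k). *)
Lemma tests_frob k : (1 <= k <= d)%N -> exists L : seq 'M[R]_(pL p k, pR d p k.+1),
  [/\ (size L <= 18 ^ N)%N, forall T, T \in L -> frob T <= 1 &
      forall (Z : 'M[R]_(pL p k, pR d p k.+1)) s,
      (forall T, T \in L -> `|\tr (T^T *m Z)| <= s) ->
      forall U V, contrL U -> contrR V ->
      frob (IkronL U k *m Z *m Rprod d V k.+1) <= 2 ^+ d * s].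
Proof.
case: k => // k /= kd.
have [SA [a1 a2 a3]] := norming_Lprod k.
have e : (k.+2 + (d.+1 - k.+2) = d.+1)%N by rewrite subnKC.
have [SB [b1 b2 b3]] := norming_Rprod e.
have c0 j : 0 <= 2 ^+ j :> R by rewrite exprn_ge0.
have [L [l1 l2 l3]] := norming_product (c0 k) (c0 _) a2 a3 b2 b3.
exists L; split => //.
  apply: leq_trans l1 _; apply: leq_trans (leq_mul (leq_mul a1 (leqnn _)) b1) _.
  rewrite -!expnD leq_pexp2l // e /N (@big_cat_nat _ _ _ k.+2 1 d.+1) //=.
  by rewrite [in leqRHS]big_nat_recr.
move=> Z s hs U V hU hV.
have -> : 2 ^+ d * s = 2 ^+ (d.+1 - k.+2) * (2 ^+ k * (2 * s)).
  rewrite !mulrA -exprD -exprSr; congr (_ ^+ _ * _).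
  by rewrite subSS -addnS subnK.
apply: l3 => //.
  exists U; split => // j /andP[j1 jk]; apply: hU; rewrite j1 (leq_trans jk) //.
  by rewrite -ltnS (leq_trans kd) // leqSpred.
exists V; split => // -[|j] // /andP[jk jd]; apply: hV.
apply/andP; split; first exact: leq_ltn_trans (leq0n k) jk.
by rewrite -ltnS (leq_trans jd) // leqSpred.
Qed.

(** [norming_product] with column vectors for [W] and [B]. *)
Lemma tests_op k : (1 <= k <= d.-1)%N -> (0 < r k)%N ->
  exists L : seq 'M[R]_(pL p k, pR d p k.+1),
  [/\ (size L <= 18 ^ (N + pR d p k.+1))%N, forall T, T \in L -> frob T <= 1 &
      forall (Z : 'M[R]_(pL p k, pR d p k.+1)) s, 0 <= s ->
      (forall T, T \in L -> `|\tr (T^T *m Z)| <= s) ->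
      forall U, contrL U -> opn (IkronL U k *m Z) (2 ^+ d * s)].
Proof.
case: k => // k /= kd rk.
have kd' : (k.+1 < d)%N by case: (d) kd.
have [SA [a1 a2 a3]] := norming_Lprod k.
have [SB [b1 b2 b3]] := net_frob (pR d p k.+2) 1.
have c0 j : 0 <= 2 ^+ j :> R by rewrite exprn_ge0.
have b2' s : s \in SB -> opn s 1 by move=> /b2 ?; exact: opn_frob.
have [L [l1 l2 l3]] := norming_product (c0 k) (c0 1%N) a2 a3 b2' b3.
exists L; split => //.
  apply: leq_trans l1 _; apply: leq_trans (leq_mul (leq_mul a1 (leqnn _)) b1) _.
  rewrite -!expnD leq_pexp2l // !muln1 leq_add2r.
  rewrite /N (@big_cat_nat _ _ _ k.+2 1 d.+1) //=; last by rewrite ltnS ltnW.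
  apply: leq_trans (leq_addr _ _); rewrite [in leqRHS]big_nat_recr //= leq_add2l.
  by rewrite /w leq_pmulr.
move=> Z s s0 hs U hU; apply: opn_cols => [|x]; first by rewrite mulr_ge0.
have DA : exists U0 : left_family R p r,
  (forall j, (1 <= j <= k)%N -> opn (U0 j) 1) /\ Lprod U k = Lprod U0 k.
  exists U; split => // j /andP[j1 jk]; apply: hU; rewrite j1 (leq_trans jk) //.
  exact: ltnW.
have key (y : 'cV[R]_(pR d p k.+2)) : frob y <= 1 -> frob (IkronL U k.+1 *m Z *m y) <= 2 ^+ d * s.
  move=> hy; have h := l3 Z s hs (Lprod U k) y DA hy.
  rewrite IkronLS; apply: le_trans h _.
  apply: (@le_trans _ _ (2 ^+ k.+2 * s)).
    by rewrite le_eqVlt; apply/orP; left; apply/eqP; rewrite !exprS; ring.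
  by rewrite ler_wpM2r // ler_eXn2l ?ltr1n.
have [x0|x0] := eqVneq (frob x) 0.
  by move/eqP: x0; rewrite frob_eq0 => /eqP ->; rewrite mulmx0 !frob0 mulr0.
have xp : 0 < frob x by rewrite lt_def x0 frob_ge0.
have := key ((frob x)^-1 *: x); rewrite frobZ ger0_norm ?invr_ge0 // mulVf //.
move=> /(_ (lexx _)); rewrite -scalemxAr frobZ ger0_norm ?invr_ge0 //.
by rewrite mulrC ler_pdivrMr.
Qed.
End Norming.

(** * Expectation of products of independent variables *)

From mathcomp Require Import finmap.

Section Independence.
Context {dsp : measure_display} {T : measurableType dsp} {R : realType}.
Variable P : probability T R.
Local Open Scope ereal_scope.

Lemma integral_mul_nnsfun (g X : T -> R) (h : {nnsfun R >-> R}) :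
  measurable_fun setT g -> (forall w, 0 <= g w)%R -> measurable_fun setT X ->
  let s := fset_set (range h) in
  \int[P]_w (g w * h (X w))%:E =
  \sum_(i < #|` s|) (s`_i)%:E * \int[P]_w (g w * \1_(h @^-1` [set s`_i]) (X w))%:E.
Proof.
move=> mg g0 mX s.
have mh i : measurable_fun setT (fun w => \1_(h @^-1` [set s`_i]) (X w) : R).
  apply: measurableT_comp => //; exact: measurable_indic.
have s0 (i : 'I_(#|` s|)) : (0 <= s`_i)%R.
  have : s`_i \in s by exact: mem_nth.
  by rewrite in_fset_set // => /set_mem[x _ <-].
transitivity (\int[P]_w \sum_(i < #|` s|) (s`_i)%:E * (g w * \1_(h @^-1` [set s`_i]) (X w))%:E).
  apply: eq_integral => w _; rewrite (fimfunEord h) -/s mulr_sumr -sumEFin.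
  by apply: eq_bigr => i _; rewrite -EFinM mulrCA.
rewrite ge0_integral_sum //.
- apply: eq_bigr => i _; rewrite ge0_integralZl_EFin //.
  + by move=> w _; rewrite lee_fin mulr_ge0.
  + by apply/measurable_EFinP; exact: measurable_funM.
- move=> i; apply: measurable_funeM; apply/measurable_EFinP; exact: measurable_funM.
- by move=> i w _; rewrite -EFinM lee_fin mulr_ge0 ?mulr_ge0.
Qed.

(** For simple functions the claim follows from the case of indicators by
    linearity, and then for [f] by monotone convergence on both sides. *)
Lemma integral_mul_indep (g X : T -> R) (f : R -> R) (c : R) :
  measurable_fun setT g -> (forall w, 0 <= g w)%R -> measurable_fun setT X ->
  measurable_fun setT f -> (forall x, 0 <= f x)%R -> (0 <= c)%R ->
  (forall A, measurable A ->
    \int[P]_w (g w * \1_A (X w))%:E = c%:E * \int[P]_w (\1_A (X w))%:E) ->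
  \int[P]_w (g w * f (X w))%:E = c%:E * \int[P]_w (f (X w))%:E.
Proof.
move=> mg g0 mX mf f0 c0 H.
have mef : measurable_fun setT (EFin \o f) by exact/measurable_EFinP.
pose h := nnsfun_approx measurableT mef.
have hh n : \int[P]_w (g w * h n (X w))%:E = c%:E * \int[P]_w (h n (X w))%:E.
  rewrite integral_mul_nnsfun //.
  have -> : \int[P]_w (h n (X w))%:E = \int[P]_w (1 * h n (X w))%:E.
    by apply: eq_integral => w _; rewrite mul1r.
  rewrite (@integral_mul_nnsfun (fun=> 1%R)) // ge0_sume_distrr; last first.
    move=> i _; apply: mule_ge0.
      rewrite lee_fin; have : (fset_set (range (h n)))`_i \in fset_set (range (h n))
        by exact: mem_nth.
      by rewrite in_fset_set // => /set_mem[x _ <-].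
    by apply: integral_ge0 => w _; rewrite lee_fin mulr_ge0.
  apply: eq_bigr => i _; rewrite H; last exact: measurable_funPTI.
  rewrite muleCA; congr (_ * (_ * _)).
  by apply: eq_integral => w _; rewrite mul1r.
have hcv x : (h n x)%:E @[n --> \oo] --> (f x)%:E.
  by have := cvg_nnsfun_approx measurableT mef (fun x _ => f0 x) (x := x) Logic.I.
have hnd x : {homo (fun n => h n x) : m n / (m <= n)%N >-> (m <= n)%R}.
  by move=> m n mn; have /lefP/(_ x) := nd_nnsfun_approx measurableT mef mn.
have mhX n : measurable_fun setT (fun w => h n (X w)).
  by apply: measurableT_comp.
have cv1 : \int[P]_w (g w * h n (X w))%:E @[n --> \oo] --> \int[P]_w (g w * f (X w))%:E.
  have E : (fun w => (g w * f (X w))%:E) = (fun w => limn (fun n => (g w * h n (X w))%:E)).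
    apply/funext => w; apply/esym/cvg_lim => //.
    under eq_fun do rewrite EFinM.
    by rewrite EFinM; apply: cvgeZl.
  rewrite E; apply: cvg_monotone_convergence => //.
  - by move=> n; apply/measurable_EFinP; exact: measurable_funM.
  - by move=> n w _; rewrite lee_fin mulr_ge0.
  - by move=> w _ m n mn; rewrite lee_fin ler_wpM2l // hnd.
have cv2 : \int[P]_w (h n (X w))%:E @[n --> \oo] --> \int[P]_w (f (X w))%:E.
  have E : (fun w => (f (X w))%:E) = (fun w => limn (fun n => (h n (X w))%:E)).
    by apply/funext => w; apply/esym/cvg_lim.
  rewrite E; apply: cvg_monotone_convergence => //.
  - by move=> n; apply/measurable_EFinP.
  - by move=> n w _; rewrite lee_fin.
  - by move=> w _ m n mn; rewrite lee_fin hnd.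
have cv3 : c%:E * \int[P]_w (h n (X w))%:E @[n --> \oo] --> c%:E * \int[P]_w (f (X w))%:E.
  exact: cvgeZl.
have E : (fun n => \int[P]_w (g w * h n (X w))%:E) =
    (fun n => c%:E * \int[P]_w (h n (X w))%:E) by exact/funext.
by move: cv1; rewrite E => cv1; apply: cvg_unique cv1 cv3.
Qed.

Variables (I : finType) (Z : I -> {RV P >-> R}).
Hypothesis indep : mutually_independent Z.

(** If all factors are indicators, the claim is the definition of independence.
    The indicators are replaced by the functions [f i] one at a time, each time
    by [integral_mul_indep]: as the indicator of the replaced variable was
    arbitrary, its hypothesis is the induction hypothesis. *)
Lemma integral_prod_indep (f : I -> R -> R) (e : I -> R) :
  (forall i, measurable_fun setT (f i)) -> (forall i x, 0 <= f i x)%R ->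
  (forall i, 0 <= e i)%R ->
  (forall i, \int[P]_w (f i (Z i w))%:E = (e i)%:E) ->
  \int[P]_w (\prod_i f i (Z i w))%:E = (\prod_i e i)%:E.
Proof.
move=> mf f0 e0 fe.
suff G (s : seq I) : uniq s -> forall B : I -> set R, (forall i, measurable (B i)) ->
    \int[P]_w ((\prod_(i <- s) f i (Z i w)) * \prod_(j | j \notin s) \1_(B j) (Z j w))%:E =
    (\prod_(i <- s) e i)%:E * \prod_(j | j \notin s) P (Z j @^-1` B j).
  have := G (index_enum I) (index_enum_uniq I) (fun=> setT) (fun=> measurableT).
  rewrite [X in _ * X]big_pred0 => [|j]; last by rewrite mem_index_enum.
  rewrite mule1 => <-; apply: eq_integral => w _.
  by rewrite [X in (_ * X)%R]big_pred0 ?mulr1 // => j; rewrite mem_index_enum.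
have mZ i : measurable_fun setT (Z i) by exact: measurable_funP.
elim: s => [_|i s IH /= /andP[si us]] B mB.
  rewrite big_nil mul1e.
  transitivity (\int[P]_w (\1_(\bigcap_(j in [set` [set: I]%SET]) (Z j @^-1` B j)) w)%:E).
    apply: eq_integral => w _; rewrite big_nil mul1r; congr (_%:E).
    rewrite indicE; case: (pselect ((\bigcap_(j in [set` [set: I]%SET]) (Z j @^-1` B j)) w)) => h.
      rewrite mem_set // big1 // => j _; rewrite indicE mem_set //.
      by apply: h; rewrite /= inE.
    rewrite memNset //; have [j nj] : exists j, ~ B j (Z j w).
      by apply/existsNP => hj; apply: h => j _; exact: hj.
    by rewrite (bigD1 j) //= indicE memNset // mul0r.
  rewrite integral_indic ?setIT //; last first.
    apply: fin_bigcap_measurable => // j _; rewrite -[X in measurable X]setTI; exact: mZ.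
  apply: etrans (indep (J := [set: I]%SET) (B := B) (fun j _ => mB j)) _.
  by apply: eq_bigl => j; rewrite inE.
(* the induction hypothesis is used with an arbitrary [A] in position [i] *)
pose B' (A : set R) j := if j == i then A else B j.
have prodB' (A : set R) w : (\prod_(j | j \notin s) \1_(B' A j) (Z j w) =
    \1_A (Z i w) * \prod_(j | j \notin i :: s) \1_(B j) (Z j w) :> R)%R.
  rewrite (bigD1 i) //= /B' eqxx; congr (_ * _)%R.
  apply: eq_big => [j|j /andP[_ /negbTE ->]] //.
  by rewrite inE negb_or andbC.
have prodP (A : set R) : \prod_(j | j \notin s) P (Z j @^-1` B' A j) =
    P (Z i @^-1` A) * \prod_(j | j \notin i :: s) P (Z j @^-1` B j).
  rewrite (bigD1 i) //= /B' eqxx; congr (_ * _).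
  apply: eq_big => [j|j /andP[_ /negbTE ->]] //.
  by rewrite inE negb_or andbC.
have Pfin (A : set R) j : measurable A -> P (Z j @^-1` A) = (fine (P (Z j @^-1` A)))%:E.
  move=> mA; rewrite fineK // fin_num_measure //.
  by rewrite -[X in measurable X]setTI; exact: mZ.
pose q := (\prod_(j | j \notin i :: s) fine (P (Z j @^-1` B j)))%R.
have qE : \prod_(j | j \notin i :: s) P (Z j @^-1` B j) = q%:E.
  by rewrite /q -prodEFin; apply: eq_bigr => j _; exact: Pfin.
pose g w := ((\prod_(k <- s) f k (Z k w)) * \prod_(j | j \notin i :: s) \1_(B j) (Z j w))%R.
have mprod (J : eqType) (l : seq J) (F : J -> T -> R) : (forall j, measurable_fun setT (F j)) ->
    measurable_fun setT (fun w => \prod_(j <- l) F j w)%R.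
  by move=> mF; apply: measurable_prod => j _; exact: mF.
have mg : measurable_fun setT g.
  apply: measurable_funM.
    by apply: mprod => j; apply: measurableT_comp.
  under eq_fun do rewrite big_mkcond /=.
  apply: mprod => j; case: (j \notin i :: s) => //.
  by apply: measurableT_comp => //; exact: measurable_indic.
have g0 w : (0 <= g w)%R.
  by apply: mulr_ge0; apply: prodr_ge0 => j _.
transitivity (\int[P]_w (g w * f i (Z i w))%:E).
  by apply: eq_integral => w _; rewrite big_cons /g; congr (_%:E); ring.
have q0 : (0 <= q)%R by apply: prodr_ge0 => j _; rewrite fine_ge0.
have c0 : (0 <= (\prod_(k <- s) e k) * q)%R.
  by apply: mulr_ge0 => //; apply: prodr_ge0.
rewrite (integral_mul_indep mg g0 (mZ i) (mf i) (f0 i) c0).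
  by rewrite fe qE big_cons -!EFinM; congr (_%:E); ring.
move=> A mA.
have mB' j : measurable (B' A j) by rewrite /B'; case: ifP.
have := IH us (B' A) mB'; rewrite prodP qE => E.
transitivity ((\prod_(k <- s) e k)%:E * (P (Z i @^-1` A) * q%:E)).
  by rewrite -E; apply: eq_integral => w _; rewrite prodB' /g; congr (_%:E); ring.
have -> : \int[P]_w (\1_A (Z i w))%:E = P (Z i @^-1` A).
  have mZA : measurable (Z i @^-1` A) by rewrite -[X in measurable X]setTI; exact: mZ.
  by rewrite -[X in P X]setIT -integral_indic.
by rewrite (Pfin A i mA) -!EFinM; congr (_%:E); ring.
Qed.

End Independence.

(** * Concentration of linear forms *)

Section Tail.
Context {dsp : measure_display} {T : measurableType dsp} {R : realType}.
Variable P : probability T R.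
Variables (I : finType) (Z : I -> {RV P >-> R}) (sigma : R).
Hypothesis sigma0 : 0 < sigma.
Hypothesis indep : mutually_independent Z.
Hypothesis mean0 : forall i, ('E_P[Z i] = 0)%E.
Hypothesis subg : forall i, sub_gaussian sigma (Z i).

Let lin (a : I -> R) (w : T) : R := \sum_i a i * Z i w.

Let mlin a : measurable_fun setT (lin a).
Proof. by apply: measurable_sum => i; apply: measurable_funM => //; exact: measurable_funP. Qed.

Lemma mgf_lin (a : I -> R) (t : R) :
  (\int[P]_w (expR (t * lin a w))%:E <=
   (expR (sigma ^+ 2 * t ^+ 2 / 2 * \sum_i a i ^+ 2))%:E)%E.
Proof.
pose f i x := expR (t * a i * x).
have mf i : measurable_fun setT (f i).
  by apply: measurableT_comp => //; exact: measurable_funM.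
have f0 i x : 0 <= f i x by exact: expR_ge0.
have bd i : (\int[P]_w (f i (Z i w))%:E <= (expR (sigma ^+ 2 * (t * a i) ^+ 2 / 2))%:E)%E.
  have := subg i (t * a i); rewrite mean0 /= expectation.unlock.
  by under eq_integral do rewrite subr0.
have int0 i : (0 <= \int[P]_w (f i (Z i w))%:E)%E.
  by apply: integral_ge0 => w _; rewrite lee_fin.
pose e i := fine (\int[P]_w (f i (Z i w))%:E).
have eE i : (\int[P]_w (f i (Z i w))%:E = (e i)%:E)%E.
  by rewrite fineK // ge0_fin_numE // (le_lt_trans (bd i)) ?ltry.
have e0 i : 0 <= e i by rewrite fine_ge0.
have -> : (\int[P]_w (expR (t * lin a w))%:E = \int[P]_w (\prod_i f i (Z i w))%:E)%E.
  apply: eq_integral => w _; rewrite /lin mulr_sumr expR_sum; congr (_%:E).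
  by apply: eq_bigr => i _; rewrite /f mulrA.
rewrite (integral_prod_indep indep mf f0 e0 eE) lee_fin mulr_sumr expR_sum.
apply: ler_prod => i _; rewrite e0 /= -lee_fin -eE (le_trans (bd i)) // lee_fin ler_expR.
by rewrite exprMn; lra.
Qed.

Lemma tail_lin (a : I -> R) (s : R) : 0 < s -> \sum_i a i ^+ 2 <= 1 ->
  (P [set w | (s <= lin a w)%R] <= (expR (- (s ^+ 2 / (2 * sigma ^+ 2))))%:E)%E.
Proof.
(* this [t] minimizes the exponent sigma^2 t^2 / 2 - t s *)
move=> s0 a1; pose t := s / sigma ^+ 2.
have t0 : 0 < t by rewrite divr_gt0 // exprn_gt0.
pose A : set T := [set w | s <= lin a w].
have mA : measurable A.
  rewrite (_ : A = lin a @^-1` `[s, +oo[%classic).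
    by rewrite -[X in measurable X]setTI; exact: mlin.
  by apply/seteqP; split => w; rewrite /A /= in_itv /= andbT.
have mE : measurable_fun setT (fun w => (expR (t * lin a w))%:E).
  apply/measurable_EFinP; apply: measurableT_comp => //; exact: measurable_funM.
have h : ((expR (t * s))%:E * P A <= \int[P]_w (expR (t * lin a w))%:E)%E.
  have <- : (\int[P]_w (\1_A w)%:E = P A)%E by rewrite integral_indic // setIT.
  rewrite -ge0_integralZl_EFin ?expR_ge0 //; last first.
    by apply/measurable_EFinP; exact: measurable_indic.
  apply: ge0_le_integral => //.
  - by apply: measurable_funeM; apply/measurable_EFinP; exact: measurable_indic.
  - move=> w _; rewrite -EFinM lee_fin indicE; case: (pselect (A w)) => hA.
      by rewrite mem_set // mulr1 ler_expR ler_pM2l.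
    by rewrite memNset // mulr0 expR_ge0.
have {h} := le_trans h (mgf_lin a t).
rewrite muleC -lee_pdivlMr ?expR_gt0 // => /le_trans; apply.
rewrite -expRN -EFinM -expRD lee_fin ler_expR.
have sg : 0 < sigma ^+ 2 by rewrite exprn_gt0.
apply: (@le_trans _ _ (sigma ^+ 2 * t ^+ 2 / 2 * 1 - t * s)).
  by rewrite lerB // ler_wpM2l // divr_ge0 // mulr_ge0 ?sqr_ge0.
by rewrite le_eqVlt; apply/orP; left; apply/eqP; rewrite /t; field; rewrite gt_eqF.
Qed.

Lemma tail_abs (a : I -> R) (s : R) : 0 < s -> \sum_i a i ^+ 2 <= 1 ->
  measurable [set w | s < `|lin a w|] /\
  (P [set w | (s < `|lin a w|)%R ] <= (2 * expR (- (s ^+ 2 / (2 * sigma ^+ 2))))%:E)%E.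
Proof.
move=> s0 a1.
have mset (b : I -> R) : measurable [set w | s <= lin b w].
  rewrite (_ : [set w | s <= lin b w] = lin b @^-1` `[s, +oo[%classic).
    by rewrite -[X in measurable X]setTI; exact: mlin.
  by apply/seteqP; split => w; rewrite /= in_itv /= andbT.
have mabs : measurable [set w | s < `|lin a w|].
  rewrite (_ : [set w | s < `|lin a w|] = (fun w => `|lin a w|) @^-1` `]s, +oo[%classic).
    rewrite -[X in measurable X]setTI.
    have : measurable_fun setT (fun w => `|lin a w|) by apply: measurableT_comp.
    by apply.
  by apply/seteqP; split => w; rewrite /= in_itv /= andbT.
split => //.
have a1' : \sum_i (- a i) ^+ 2 <= 1 by under eq_bigr do rewrite sqrrN.
have linN w : lin (fun i => - a i) w = - lin a w.
  by rewrite /lin -sumrN; apply: eq_bigr => i _; rewrite mulNr.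
have sub : [set w | s < `|lin a w|] `<=`
    [set w | s <= lin a w] `|` [set w | s <= lin (fun i => - a i) w].
  move=> w /=; rewrite linN; have [h|h] := leP 0 (lin a w).
    by rewrite ger0_norm // => /ltW; left.
  by rewrite ltr0_norm // => /ltW; right.
have := le_measure P (mem_set mabs) (mem_set (measurableU _ _ (mset a) (mset _))) sub.
move/le_trans; apply.
have := measureU2 P (mset a) (mset (fun i => - a i)); move/le_trans; apply.
rewrite mulr_natl mulr2n EFinD; apply: leeD; exact: tail_lin.
Qed.

(** At the level s = 6 sigma sqrt(n) each tail is at most 2 exp (- 18 n), while
    there are at most 18^n <= exp (17 n) tests. *)
Lemma event_of_tests n (K : eqType) (L : seq K) (a : K -> I -> R) :
  (0 < n)%N -> (size L <= 18 ^ n)%N -> (forall x, x \in L -> \sum_i a x i ^+ 2 <= 1) ->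
  exists E : set T, [/\ measurable E,
    (P (~` E) <= (2 * expR (- n%:R))%:E)%E &
    forall w, E w -> forall x, x \in L -> `|lin (a x) w| <= 6 * sigma * Num.sqrt n%:R].
Proof.
move=> n0 sL ha; set s := 6 * sigma * Num.sqrt n%:R.
have s0 : 0 < s by rewrite !mulr_gt0 // sqrtr_gt0 ltr0n.
have sE : s ^+ 2 / (2 * sigma ^+ 2) = 18 * n%:R.
  by rewrite /s !exprMn sqr_sqrtr ?ler0n //; field; rewrite gt_eqF.
have [E [mE PE hE]] : exists E : set T, [/\ measurable E,
    (P (~` E) <= ((size L)%:R * (2 * expR (- (18 * n%:R))))%:E)%E &
    forall w, E w -> forall x, x \in L -> `|lin (a x) w| <= s].
  elim: L {sL} ha => [|x L IH] ha.
    by exists setT; split => //; rewrite setCT measure0 mul0r.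
  have [|E [mE PE hE]] := IH; first by move=> y yL; apply: ha; rewrite in_cons yL orbT.
  have [m1 P1] := tail_abs s0 (ha x (mem_head _ _)).
  exists (E `&` ~` [set w | s < `|lin (a x) w|]); split.
  - by apply: measurableI => //; exact: measurableC.
  - rewrite setCI setCK.
    apply: le_trans (measureU2 P (measurableC mE) m1) _.
    apply: le_trans (leeD PE P1) _.
    by rewrite -EFinD lee_fin sE /= -[in leRHS]natr1; lra.
  move=> w [Ew /= /negP hw] y; rewrite in_cons => /predU1P[->|]; last exact: hE.
  by rewrite leNgt.
exists E; split => //; apply: le_trans PE _; rewrite lee_fin.
have h18 : (18 ^ n)%:R <= expR (17 * n%:R) :> R.
  rewrite natrX mulrC expRM_natl ler_pXn2r ?nnegrE ?expR_ge0 //.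
  by apply: le_trans (expR_ge1Dx _); lra.
have -> : expR (- n%:R) = expR (17 * n%:R) * expR (- (18 * n%:R)) :> R.
  by rewrite -expRD; congr expR; ring.
have e0 : 0 <= expR (- (18 * n%:R)) :> R := expR_ge0 _.
rewrite mulrCA ler_pM2l // ler_wpM2r //; apply: le_trans h18.
by rewrite ler_nat.
Qed.

Lemma event_forall (Q : nat -> T -> Prop) (e : R) m :
  (forall k, (k < m)%N -> exists E : set T, [/\ measurable E, (P (~` E) <= e%:E)%E &
     forall w, E w -> Q k w]) ->
  exists E : set T, [/\ measurable E, (P (~` E) <= (m%:R * e)%:E)%E &
     forall w, E w -> forall k, (k < m)%N -> Q k w].
Proof.
elim: m => [|m IH] h.
  by exists setT; split => //; rewrite setCT measure0 mul0r.
have [|E [mE PE hE]] := IH; first by move=> k km; apply: h; exact: ltnW.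
have [E' [mE' PE' hE']] := h m (ltnSn m).
exists (E `&` E'); split; first exact: measurableI.
  rewrite setCI; apply: le_trans (measureU2 P (measurableC mE) (measurableC mE')) _.
  apply: le_trans (leeD PE PE') _; rewrite -EFinD lee_fin -natr1; lra.
move=> w [Ew E'w] k; rewrite ltnS leq_eqVlt => /predU1P[->|]; first exact: hE'.
exact: hE.
Qed.
End Tail.

(** * The noise event and the theorem *)

Section NoiseEvent.
Context {dsp : measure_display} {T : measurableType dsp} {R : realType}.
Variable P : probability T R.
Variables (d : nat) (p r : nat -> nat) (sigma : R) (Z : mindex d p -> {RV P >-> R}).
Hypothesis hr0 : r 0%N = 1%N.
Hypothesis hrd : r d = 1%N.
Hypothesis hr : forall k, (1 <= k <= d.-1)%N -> (0 < r k)%N.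
Hypothesis sigma0 : 0 < sigma.
Hypothesis indep : mutually_independent Z.
Hypothesis mean0 : forall i, ('E_P[Z i] = 0)%E.
Hypothesis subg : forall i, sub_gaussian sigma (Z i).

Let N := (\sum_(1 <= i < d.+1) p i * r i.-1 * r i)%N.
Hypothesis N0 : (0 < N)%N.
Let Zw w : tensor R d p := fun i => Z i w.

Lemma event_frob k : (1 <= k <= d)%N -> exists E : set T, [/\ measurable E,
  (P (~` E) <= (2 * expR (- N%:R))%:E)%E &
  forall w, E w -> forall (U : left_family R p r) (V : right_family R p r),
    orthL d U -> orthR d V ->
  frob (IkronL U k *m unfolding (Zw w) k *m Rprod d V k.+1) <=
  2 ^+ d * (6 * sigma * Num.sqrt N%:R)].
Proof.
move=> hk; have kd : (k <= d)%N by case/andP: hk.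
have [L [l1 l2 l3]] := tests_frob R p hr0 hrd hk.
have a1 A : A \in L -> \sum_i coef kd A i ^+ 2 <= 1.
  move=> AL; apply: le_trans (coef_sq kd A) _.
  by rewrite -[1 in leRHS](expr1n _ 2) ler_pXn2r ?nnegrE // l2.
have [E [mE PE hE]] := event_of_tests sigma0 indep mean0 subg N0 l1 a1.
exists E; split => // w Ew U V oU oV.
apply: l3 => [A AL|j hj|j hj]; try exact/opn_isom/oU; try exact/opn_isom/oV.
by rewrite (trace_unfolding kd); exact: hE.
Qed.

Lemma event_op k : (1 <= k <= d.-1)%N -> exists E : set T, [/\ measurable E,
  (P (~` E) <= (2 * expR (- N%:R))%:E)%E &
  forall w, E w -> forall U : left_family R p r, orthL d U ->
  opn (IkronL U k *m unfolding (Zw w) k)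
  (2 ^+ d * (6 * sigma * Num.sqrt (N + pR d p k.+1)%N%:R))].
Proof.
move=> hk; have kd : (k <= d)%N by case/andP: hk => _ /leq_trans; apply; exact: leq_pred.
have [L [l1 l2 l3]] := tests_op R p hr0 hk (hr hk).
have a1 A : A \in L -> \sum_i coef kd A i ^+ 2 <= 1.
  move=> AL; apply: le_trans (coef_sq kd A) _.
  by rewrite -[1 in leRHS](expr1n _ 2) ler_pXn2r ?nnegrE // l2.
have n0 : (0 < N + pR d p k.+1)%N by rewrite addn_gt0 N0.
have [E [mE PE hE]] := event_of_tests sigma0 indep mean0 subg n0 l1 a1.
exists E; split => //.
  apply: le_trans PE _; rewrite lee_fin ler_pM2l // ler_expR lerN2 ler_nat.
  exact: leq_addr.
move=> w Ew U oU.
apply: l3 => [|A AL|j hj]; last exact/opn_isom/oU.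
  by rewrite !mulr_ge0 // ?ltW // sqrtr_ge0.
by rewrite (trace_unfolding kd); exact: hE.
Qed.

Lemma noise_event : exists E : set T, [/\ measurable E,
  (P (~` E) <= (d.+1%:R * (4 * expR (- N%:R)))%:E)%E &
  forall w, E w ->
  (forall (U : left_family R p r) (V : right_family R p r),
    orthL d U -> orthR d V -> forall k, (1 <= k <= d)%N ->
    frob (IkronL U k *m unfolding (Zw w) k *m Rprod d V k.+1) <=
    2 ^+ d * (6 * sigma * Num.sqrt N%:R)) /\
  (forall U : left_family R p r, orthL d U -> forall k, (1 <= k <= d.-1)%N ->
    opn (IkronL U k *m unfolding (Zw w) k)
      (2 ^+ d * (6 * sigma * Num.sqrt (N + pR d p k.+1)%N%:R)))].
Proof.
pose Q k w := ((1 <= k <= d)%N ->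
  forall (U : left_family R p r) (V : right_family R p r), orthL d U -> orthR d V ->
    frob (IkronL U k *m unfolding (Zw w) k *m Rprod d V k.+1) <=
    2 ^+ d * (6 * sigma * Num.sqrt N%:R)) /\
  ((1 <= k <= d.-1)%N -> forall U : left_family R p r, orthL d U ->
    opn (IkronL U k *m unfolding (Zw w) k)
      (2 ^+ d * (6 * sigma * Num.sqrt (N + pR d p k.+1)%N%:R))).
have e0 : 0 <= expR (- N%:R) :> R := expR_ge0 _.
have triv : exists E : set T, [/\ measurable E, (P (~` E) <= (2 * expR (- N%:R))%:E)%E & True].
  by exists setT; split => //; rewrite setCT measure0 lee_fin mulr_ge0.
have [|E [mE PE hE]] := @event_forall _ _ _ P Q (4 * expR (- N%:R)) d.+1.
  move=> k _.
  have [E1 [m1 P1 h1]] : exists E : set T, [/\ measurable E,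
      (P (~` E) <= (2 * expR (- N%:R))%:E)%E &
      forall w, E w -> (1 <= k <= d)%N ->
        forall (U : left_family R p r) (V : right_family R p r), orthL d U -> orthR d V ->
      frob (IkronL U k *m unfolding (Zw w) k *m Rprod d V k.+1) <=
      2 ^+ d * (6 * sigma * Num.sqrt N%:R)].
    have [hk|hk] := boolP (1 <= k <= d)%N.
      by have [E [mE PE hE]] := event_frob hk; exists E; split => // w Ew _; exact: hE.
    by have [E [mE PE _]] := triv; exists E.
  have [E2 [m2 P2 h2]] : exists E : set T, [/\ measurable E,
      (P (~` E) <= (2 * expR (- N%:R))%:E)%E &
      forall w, E w -> (1 <= k <= d.-1)%N -> forall U : left_family R p r, orthL d U ->
      opn (IkronL U k *m unfolding (Zw w) k)
        (2 ^+ d * (6 * sigma * Num.sqrt (N + pR d p k.+1)%N%:R))].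
    have [hk|hk] := boolP (1 <= k <= d.-1)%N.
      by have [E [mE PE hE]] := event_op hk; exists E; split => // w Ew _; exact: hE.
    by have [E [mE PE _]] := triv; exists E.
  exists (E1 `&` E2); split; first exact: measurableI.
    rewrite setCI; apply: le_trans (measureU2 P (measurableC m1) (measurableC m2)) _.
    apply: le_trans (leeD P1 P2) _; rewrite -EFinD lee_fin; lra.
  by move=> w [w1 w2]; split; [exact: h1|exact: h2].
exists E; split => // w Ew; split.
  move=> U V oU oV k hk; apply: (hE w Ew k _).1 => //.
  by case/andP: hk.
move=> U oU k hk; apply: (hE w Ew k _).2 => //.
by case/andP: hk => _ kd; rewrite ltnS (leq_trans kd) // leq_pred.
Qed.
End NoiseEvent.

Theorem theorem4p1 (R : realType) (d : nat) (hd : (2 <= d)%N) :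
  exists Cgap C c Cd : R,
    [/\ 0 < Cgap, 0 < C, 0 < c & 0 < Cd] /\
    forall (p r : nat -> nat)
      (hp : forall k, (1 <= k <= d)%N -> (0 < p k)%N)
      (hr : forall k, (1 <= k <= d.-1)%N -> (0 < r k)%N)
      (hr0 : r 0%N = 1%N) (hrd : r d = 1%N)
      (hrk : forall k, (1 <= k <= d)%N ->
         (r k <= r k.-1 * p k)%N /\ (r k.-1 <= p k * r k)%N)
      (dsp : measure_display) (T : measurableType dsp) (P : probability T R)
      (sigma : R) (hsigma : 0 < sigma)
      (X : tensor R d p) (hX : has_TT r X)
      (Z : mindex d p -> {RV P >-> R})
      (hZind : mutually_independent Z)
      (hZmean : forall i, ('E_P[Z i] = 0)%E)
      (hZsub : forall i, sub_gaussian sigma (Z i))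
      (hgap : forall k, (1 <= k <= d.-1)%N ->
         Cgap * (Num.sqrt (\sum_(1 <= i < d.+1) p i * r i.-1 * r i)%N%:R
                 + Num.sqrt (\prod_(k.+1 <= i < d.+1) p i)%N%:R) * sigma
         <= singval (unfolding X k) (r k)),
    exists E : set T,
      [/\ measurable E,
          ((1 - C * expR (- c * (\big[minn/p 1%N]_(1 <= i < d.+1) p i)%:R))%:E
             <= P E)%E &
          forall w, E w ->
          forall (U : nat -> left_family R p r) (V : nat -> right_family R p r)
            Rm Rt Xh,
            is_TTOI (fun i => X i + Z i w) U V Rm Rt Xh ->
            [/\ forall k, (1 <= k <= d.-1)%N ->
                  forall Ut, is_Utilde X (U 0%N) Ut ->
                  sinTheta (U 0%N k) Ut <= 1 / 2,
                forall t k, (2 <= t)%N -> ~~ odd t -> (1 <= k <= d.-1)%N ->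
                  forall Ut, is_Utilde X (U t) Ut ->
                  sinTheta (U t k) Ut <= 1 / 2,
                forall t k, odd t -> (1 <= k <= d.-1)%N ->
                  forall Vt, is_Vtilde X (V t) Vt ->
                  sinTheta (V t k.+1) Vt <= 1 / 2 &
                forall t k, (1 <= t)%N -> (1 <= k <= d.-1)%N ->
                  Num.max (A_term (fun i => Z i w) U V t k)
                          (B_term (fun i => Z i w) U V t)
                  <= Cd * sigma ^+ 2
                     * (\sum_(1 <= i < d.+1) p i * r i * r i.-1)%N%:R]].
Proof.
(* [6 * 2 ^+ d] is the noise level in [noise_event]; in [Cgap] the factor 4 comes
   from [svd_perturb] and [2 ^+ (d + d)] from the fractions kept on both sides *)
exists (24 * 2 ^+ d * 2 ^+ (d + d)), (4 * d.+1%:R), 1, (36 * 2 ^+ d * 2 ^+ d).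
split; first by split; rewrite ?mulr_gt0 ?exprn_gt0 ?ltr0n.
move=> p r hp hr hr0 hrd hrk dsp T P sigma hsigma X hX Z hZind hZmean hZsub hgap.
set N := (\sum_(1 <= i < d.+1) p i * r i.-1 * r i)%N in hgap *.
have NE : (\sum_(1 <= i < d.+1) p i * r i * r i.-1)%N = N.
  by apply: eq_bigr => i _; rewrite mulnAC.
have d1 : (1 < d.+1)%N by rewrite ltnS ltnW.
have d11 : (1 <= 1 <= d.-1)%N by rewrite /= -ltnS (ltn_predK hd).
have p1N : (p 1 <= N)%N.
  rewrite /N big_ltn // hr0 muln1; apply: leq_trans (leq_addr _ _).
  by rewrite leq_pmulr // hr.
have N0 : (0 < N)%N by apply: leq_trans p1N; apply: hp; rewrite (ltnW hd).
have [E [mE PE hE]] := noise_event hr0 hrd hr hsigma hZind hZmean hZsub N0.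
exists E; split => //.
  have pm : (\big[minn/p 1%N]_(1 <= i < d.+1) p i <= N)%N.
    by apply: leq_trans p1N; rewrite big_ltn // geq_minl.
  rewrite -(setCK E) probability_setC; last exact: measurableC.
  have -> : P (~` E) = (fine (P (~` E)))%:E.
    by rewrite fineK // fin_num_measure //; exact: measurableC.
  rewrite -EFinB lee_fin lerB //.
  have := PE; rewrite -[P (~` E)]fineK ?fin_num_measure //; last exact: measurableC.
  rewrite lee_fin => /le_trans; apply.
  rewrite mulrCA mulrA ler_pM2l ?mulr_gt0 ?ltr0n // ler_expR mulN1r lerN2 ler_nat //.
move=> w Ew U V Rm Rt Xh run.
have [hF hO] := hE w Ew.
pose lam k := singval (unfolding X k) (r k).
pose delta1 : R := 2 ^+ d * (6 * sigma * Num.sqrt N%:R).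
pose delta0 k : R := 2 ^+ d * (6 * sigma * Num.sqrt (N + pR d p k.+1)%N%:R).
have c0 j : 0 < 2 ^+ j :> R by rewrite exprn_gt0.
have sN : 0 < Num.sqrt N%:R :> R by rewrite sqrtr_gt0 ltr0n.
have gapE k : (1 <= k <= d.-1)%N ->
    24 * 2 ^+ d * 2 ^+ (d + d) * (Num.sqrt N%:R + Num.sqrt (pR d p k.+1)%:R) * sigma <= lam k.
  move=> hk; have kd : (k <= d)%N.
    by case/andP: hk => _ /leq_trans; apply; exact: leq_pred.
  have pE : pR d p k.+1 = (\prod_(k.+1 <= i < d.+1) p i)%N.
    by rewrite /pR prodRE subnKC.
  by rewrite pE; exact: hgap.
have lam0 k : (1 <= k <= d.-1)%N -> 0 < lam k.
  move=> hk; apply: lt_le_trans (gapE k hk).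
  by rewrite !mulr_gt0 // ltr_wpDr // sqrtr_ge0.
have hXb k : (1 <= k <= d.-1)%N -> [/\ bounded_below (unfolding X k) (lam k),
    bounded_below (unfolding X k)^T (lam k) & \rank (unfolding X k) = r k].
  move=> hk; apply: singval_bounded_below => //; [exact: hr|exact: lam0|].
  by apply: rank_unfolding hX _; case/andP: hk => _ /leq_trans; apply; exact: leq_pred.
have d00 k : (1 <= k <= d.-1)%N -> 0 <= delta0 k.
  by move=> _; rewrite /delta0 !mulr_ge0 // ?ltW // sqrtr_ge0.
have d10 : 0 <= delta1 by rewrite /delta1 !mulr_ge0 // ltW.
have half j x : x <= (1 / 2) ^+ j * (2 ^+ j * x) :> R.
  by rewrite mulrA -exprMn divrK ?unitfE // expr1n mul1r.
have g0 k : (1 <= k <= d.-1)%N -> 4 * delta0 k <= (1 / 2) ^+ (d + d) * lam k.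
  move=> hk; apply: le_trans (half (d + d)%N _) _; rewrite ler_wpM2l ?exprn_ge0 ?divr_ge0 //.
  apply: le_trans (gapE k hk).
  have hs : Num.sqrt (N + pR d p k.+1)%N%:R <= Num.sqrt N%:R + Num.sqrt (pR d p k.+1)%:R :> R.
    rewrite -(@ler_pXn2r _ 2) ?nnegrE ?addr_ge0 ?sqrtr_ge0 // sqrrD !sqr_sqrtr ?ler0n //.
    by rewrite natrD lerD2r lerDl mulrn_wge0 // mulr_ge0 ?sqrtr_ge0.
  have -> : 2 ^+ (d + d) * (4 * delta0 k) =
     24 * 2 ^+ d * 2 ^+ (d + d) * Num.sqrt (N + pR d p k.+1)%N%:R * sigma.
    by rewrite /delta0; ring.
  by rewrite ler_pM2r // ler_pM2l // !mulr_gt0.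
have g1 k : (1 <= k <= d.-1)%N -> 4 * delta1 <= (1 / 2) ^+ (d + d) * lam k.
  move=> hk; apply: le_trans (g0 k hk).
  rewrite ler_pM2l // /delta1 /delta0 ler_pM2l // ler_pM2l ?mulr_gt0 //.
  by rewrite ler_wsqrtr // ler_nat leq_addr.
split.
- move=> k hk Ut; exact: (sinTheta_left hd hr0 hrd hr hrk lam0 hXb d00 d10 hO hF g0 g1 run).
- move=> t k t2 te hk Ut; exact: (sinTheta_left hd hr0 hrd hr hrk lam0 hXb d00 d10 hO hF g0 g1 run).
- move=> t k to hk Vt; exact: (sinTheta_right hd hr0 hrd hr hrk lam0 hXb d00 d10 hO hF g0 g1 run).
move=> t k t1 hk.
have dE : delta1 ^+ 2 = 36 * 2 ^+ d * 2 ^+ d * sigma ^+ 2 * N%:R.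
  rewrite /delta1 !exprMn sqr_sqrtr ?ler0n //.
  have -> : (2 ^+ d) ^+ 2 = 2 ^+ d * 2 ^+ d :> R by [].
  by ring.
rewrite NE -dE ge_max.
rewrite (A_term_le hd hrk d10 hF run t1 hk).
exact: (B_term_le hd hr0 hrd hrk d10 hF run t1).
Qed.
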